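(* Let $f:\mathbb{R}^n\to\mathbb{R}$ be continuously differentiable, let $\varphi:\mathbb{R}^n\to(-\infty,\infty]$ be convex, lower semicontinuous and proper, and put $\psi=f+\varphi$. Let $\{z_k\}$ be generated by the Algorithm described in the context, with $x_k=\mathrm{prox}_{\lambda\varphi}(z_k)$ and with $\nu_k=\min\{\nu,\;a_k^2\,\|\mathrm{prox}_{\lambda\varphi}(z_k+s_k(\alpha_k))-x_k\|^{2p}\}$, $a_k=(k\ln^2(k+1))^p$, $p>0$. Assume the Algorithm does not terminate after finitely many steps, let $\bar z$ be an accumulation point of $\{z_k\}$, and put $\bar x=\mathrm{prox}_{\lambda\varphi}(\bar z)$. Suppose that: - $\nabla f$ is Lipschitz continuous on $\mathrm{dom}(\varphi)$ with modulus $L$, and $\psi$ is bounded from below on $\mathrm{dom}(\partial\varphi)$; - $f$ is twice continuously differentiable on $\mathrm{dom}(\varphi)$; - $\mathrm{prox}_{\lambda\varphi}$ is semismooth at $\bar z$; - there exist $\kappa_M>0$ and $K\in\mathbb{N}$ such that for all $k\ge K$ the matrix $D_kM_k$ is positive semidefinite and $M_k$ is invertible with $\|M_k^{-1}\|\le\kappa_M$; - $\displaystyle\lim_{k\to\infty}\frac{\|[B_k-\nabla^2f(x_k)](x_k-\bar x)\|}{\|z_k-\bar z\|}=0$; - the CG tolerances satisfy $\epsilon_k\le\mathcal E(F^\lambda_{\mathrm{nor}}(z_k))$, where $\mathcal E:\mathbb{R}^n\to[0,\infty)$ is continuous with $\mathcal E(0)=0$ and $\mathcal E(h)=o(\|h\|)$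 as $h\to0$; - there is $\kappa_B$ such that $\|B_k\|\le\kappa_B$ for all $k\in\mathbb{N}$. Then: (i) There exists $\bar k\in\mathbb{N}$ such that for all $k\ge\bar k$ the Algorithm always uses the second-order direction $\bar s_k=\lambda(d_k+e_k)$ with stepsize $\alpha_k=1$ (so $z_{k+1}=z_k+\bar s_k$). Moreover, $\{z_k\}$ converges q-superlinearly to the limit point $\bar z$. (ii) If, in addition, $\mathrm{prox}_{\lambda\varphi}$ is $\beta$-order semismooth at $\bar z$ for some $\beta\in(0,1]$, $\mathcal E(h)=O(\|h\|^{1+\beta})$ as $h\to0$, $B_k=\nabla^2f(x_k)$, and $\nabla^2f$ is Lipschitz continuous near $\bar x$, then the rate of convergence is of order $1+\beta$, i.e. $\|z_{k+1}-\bar z\|=O(\|z_k-\bar z\|^{1+\beta})$.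
   Context: Notation. $\lambda>0$ is fixed; $\mathrm{prox}_{\lambda\varphi}(z)=\mathrm{argmin}_{y}\,\varphi(y)+\frac1{2\lambda}\|z-y\|^2$; $F^\lambda_{\mathrm{nor}}(z)=\nabla f(\mathrm{prox}_{\lambda\varphi}(z))+\lambda^{-1}(z-\mathrm{prox}_{\lambda\varphi}(z))$ (normal map); $\chi(z)=\|F^\lambda_{\mathrm{nor}}(z)\|$; merit function $H(\tau,z)=\psi(\mathrm{prox}_{\lambda\varphi}(z))+\frac{\tau\lambda}{2}\|F^\lambda_{\mathrm{nor}}(z)\|^2$. $\partial\,\mathrm{prox}_{\lambda\varphi}(z)$ is Clarke's generalized Jacobian. Matrix norms are spectral norms. Semismoothness. $\mathrm{prox}_{\lambda\varphi}$ is semismooth at $z$ if it is Lipschitz near $z$, directionally differentiable at $z$, and $\sup_{D\in\partial\,\mathrm{prox}_{\lambda\varphi}(z+h)}\|\mathrm{prox}_{\lambda\varphi}(z+h)-\mathrm{prox}_{\lambda\varphi}(z)-Dh\|=o(\|h\|)$ as $h\to0$; it is $\beta$-order semismooth if $o(\|h\|)$ can be replaced by $O(\|h\|^{1+\beta})$. Q-superlinear convergence means $z_k\to\bar z$ and $\|z_{k+1}-\bar z\|=o(\|z_k-\bar z\|)$. CG method. For a symmetric matrix $S\in\mathbb{R}^{n\times n}$, $g\in\mathbb{R}^n$, $\epsilon\ge0$, CG$(S,g,\epsilon)$ for the system $S\tilde q=-g$ is: set $q_0=0$, $r_0=g$, $p_0=-g$. If $\|r_0\|\le\epsilon$ return $q_0$.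 For $i=0,1,\dots,n-1$: if $\langle p_i,Sp_i\rangle\le 0$, return $p_0$ when $i=0$ and $q_i$ when $i\ne0$; otherwise set $\alpha_i=\|r_i\|^2/\langle p_i,Sp_i\rangle$, $q_{i+1}=q_i+\alpha_ip_i$, $r_{i+1}=r_i+\alpha_iSp_i$; if $\|r_{i+1}\|\le\epsilon$ return $q_{i+1}$; otherwise set $\beta_{i+1}=\|r_{i+1}\|^2/\|r_i\|^2$, $p_{i+1}=-r_{i+1}+\beta_{i+1}p_i$. Algorithm. Parameters: $z_0\in\mathbb{R}^n$, symmetric $B_0$, $\bar L,\lambda,\tau_{-1}>0$, $\sigma,\rho,\gamma,\nu\in(0,1)$, $q,\eta>0$, tolerances $\epsilon_k\ge0$. For $k=0,1,\dots$, while $F^\lambda_{\mathrm{nor}}(z_k)\neq0$ (otherwise terminate): (1) Choose $D_k\in\partial\,\mathrm{prox}_{\lambda\varphi}(z_k)$ and set $M_k=B_kD_k+\frac1\lambda(I-D_k)$. (2) Let $q_k$ be the output of CG$(D_kM_k,\,D_kF^\lambda_{\mathrm{nor}}(z_k),\,\epsilon_k)$; set $d_k=-F^\lambda_{\mathrm{nor}}(z_k)$ and $e_k=q_k/\lambda-M_kq_k$. (3) With $b_k=(k\ln^2(k+1))^q$ and $\eta_k=\min\{b_k\chi(z_k)^q,\eta\}$, test whether $\eta_k\|e_k\|\le\chi(z_k)$. If the test holds, set $s_k(\alpha)=\alpha\lambda(d_k+\alpha e_k)$ (second-order case); otherwise set $s_k(\alpha)=\alpha\lambda d_k$ (first-order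 case). (4) Linesearch: for $t=0,1,2,\dots$ put $\alpha=\rho^t$, $x_k=\mathrm{prox}_{\lambda\varphi}(z_k)$, $p_\alpha=\mathrm{prox}_{\lambda\varphi}(z_k+s_k(\alpha))$, $U_\alpha=f(p_\alpha)-f(x_k)-\langle\nabla f(x_k),p_\alpha-x_k\rangle$, $V_\alpha=\|p_\alpha-x_k\|$, $W_\alpha=\|\nabla f(p_\alpha)-\nabla f(x_k)\|$; set $L_k^{(t)}=\max\{2U_\alpha/V_\alpha^2,\,W_\alpha/V_\alpha\}$ if $V_\alpha\ne0$ and $L_k^{(t)}=\bar L$ otherwise; set $\tau_k^{(t)}=\min\{\frac{2\gamma(1-\nu_k)}{(L_k^{(t)})^2\lambda^2+2},\tau_{k-1}\}$. Stop at the first $t$ for which $$H(\tau_k^{(t)},z_k+s_k(\alpha))-H(\tau_k^{(t)},z_k)\le-\frac{\sigma\lambda\tau_k^{(t)}\alpha}{2}\chi(z_k)^2-\frac{\nu_k}{\lambda\alpha}\|p_\alpha-x_k\|^2,$$ and then set $\alpha_k=\alpha$, $\tau_k=\tau_k^{(t)}$, $L_k=L_k^{(t)}$. During the linesearch, $\nu_k$ is evaluated by its formula with the trial step, i.e. $\nu_k=\min\{\nu,a_k^2\|p_\alpha-x_k\|^{2p}\}$, so that upon acceptance it equals the formula with $\alpha=\alpha_k$. (5) Set $z_{k+1}=z_k+s_k(\alpha_k)$ and choose a symmetric matrix $B_{k+1}$ (an approximation of $\nabla^2 f(\mathrm{prox}_{\lambda\varphi}(z_{k+1}))$; no accuracy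 is required unless stated). *)

(* Defs.v *)
From HB Require Import structures.
From mathcomp Require Import all_boot all_order all_algebra.
From mathcomp Require Import all_classical all_reals all_analysis.

Set Implicit Arguments.
Unset Strict Implicit.
Unset Printing Implicit Defensive.

Import Order.TTheory GRing.Theory Num.Theory.
Import numFieldNormedType.Exports.

Local Open Scope classical_set_scope.
Local Open Scope ring_scope.

(* Vectors of R^n are column vectors.  The library norm on matrices is the
   max-norm; it is only used for the topology and for differentiability.  All
   norms of the statement are the Euclidean norm [enorm] and the induced
   spectral norm [specnorm]. *)

Definition dotv (R : realType) n (u v : 'cV[R]_n) : R :=
  \sum_(i < n) u i 0 * v i 0.

Definition enorm (R : realType) n (u : 'cV[R]_n) : R := Num.sqrt (dotv u u).

Definition specnorm (R : realType) n (A : 'M[R]_n) : R :=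
  sup [set enorm (A *m u) | u in [set u : 'cV[R]_n | enorm u <= 1]].

(* When S is symmetric (as is D_k M_k below, Clarke Jacobians of a proximal
   mapping being symmetric) this is the usual positive semidefiniteness. *)
Definition psd (R : realType) n (S : 'M[R]_n) : Prop :=
  forall u : 'cV[R]_n, 0 <= dotv u (S *m u).

Definition elipschitz_on (R : realType) n (L : R) (A : set 'cV[R]_n)
    (F : 'cV[R]_n -> 'cV[R]_n) : Prop :=
  forall x y, A x -> A y -> enorm (F x - F y) <= L * enorm (x - y).

(* [grad] and [jac] represent the Frechet derivative, hence are meaningful only
   at points of differentiability.  The library's [jacobian] is for row
   vectors, i.e. transposed. *)
Definition grad (R : realType) n (f : 'cV[R]_n -> R) (x : 'cV[R]_n) : 'cV[R]_n :=
  \col_i 'd f x (delta_mx i 0).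

Definition jac (R : realType) n (F : 'cV[R]_n -> 'cV[R]_n) (x : 'cV[R]_n) :
    'M[R]_n :=
  \matrix_(i, j) ('d F x (delta_mx j 0) : 'cV[R]_n) i 0.

Definition hess (R : realType) n (f : 'cV[R]_n -> R) (x : 'cV[R]_n) : 'M[R]_n :=
  jac (grad f) x.

Definition C1 (R : realType) n (f : 'cV[R]_n -> R) : Prop :=
  (forall x, differentiable f x) /\ continuous (grad f).

(* A need not be open: the Hessian exists at every point of A and is continuous
   relatively to A; likewise [hess_lipschitz_near] compares Hessians only at
   points of A, where they are known to exist. *)
Definition C2_on (R : realType) n (A : set 'cV[R]_n) (f : 'cV[R]_n -> R) : Prop :=
  (forall x, A x -> differentiable (grad f) x) /\
  {within A, continuous (hess f)}.

Definition hess_lipschitz_near (R : realType) n (A : set 'cV[R]_n)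
    (f : 'cV[R]_n -> R) (x0 : 'cV[R]_n) : Prop :=
  exists l : R, exists2 U : set 'cV[R]_n, nbhs x0 U &
    forall x y, U x -> A x -> U y -> A y ->
      specnorm (hess f x - hess f y) <= l * enorm (x - y).

Definition eproper (R : realType) n (phi : 'cV[R]_n -> \bar R) : Prop :=
  (forall x, phi x != -oo%E) /\ (exists x, (phi x < +oo)%E).

(* For a function that never takes the value -oo the right-hand side is well
   defined, with the usual convention 0 * +oo = 0 at the end points. *)
Definition econvex (R : realType) n (phi : 'cV[R]_n -> \bar R) : Prop :=
  forall (x y : 'cV[R]_n) (t : R), 0 <= t <= 1 ->
    (phi (t *: x + (1 - t) *: y)%R <= t%:E * phi x + (1 - t)%R%:E * phi y)%E.

Definition edom (R : realType) n (phi : 'cV[R]_n -> \bar R) : set 'cV[R]_n :=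
  [set x | (phi x < +oo)%E].

Definition subdiff (R : realType) n (phi : 'cV[R]_n -> \bar R) (x : 'cV[R]_n) :
    set 'cV[R]_n :=
  [set g | edom phi x /\
    forall y, (phi x + (dotv g (y - x))%R%:E <= phi y)%E].

Definition dom_subdiff (R : realType) n (phi : 'cV[R]_n -> \bar R) :
    set 'cV[R]_n :=
  [set x | subdiff phi x !=set0].

Definition argmin (R : realType) n (h : 'cV[R]_n -> \bar R) : set 'cV[R]_n :=
  [set y | forall w, (h y <= h w)%E].

Definition prox (R : realType) n (lam : R) (phi : 'cV[R]_n -> \bar R)
    (z : 'cV[R]_n) : 'cV[R]_n :=
  xget 0 (argmin (fun y => phi y + ((2 * lam)^-1 * enorm (z - y) ^+ 2)%R%:E)%E).

Definition bouligand (R : realType) n (F : 'cV[R]_n -> 'cV[R]_n) (z : 'cV[R]_n) :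
    set 'M[R]_n :=
  [set V | exists y : nat -> 'cV[R]_n,
    [/\ forall k, differentiable F (y k), y @ \oo --> z &
        (fun k => jac F (y k)) @ \oo --> V]].

Definition conv_hull (R : realType) n (A : set 'M[R]_n) : set 'M[R]_n :=
  [set V | exists m (w : 'I_m -> R) (P : 'I_m -> 'M[R]_n),
    [/\ forall i, 0 <= w i, \sum_(i < m) w i = 1, forall i, A (P i) &
        V = \sum_(i < m) w i *: P i]].

Definition clarke (R : realType) n (F : 'cV[R]_n -> 'cV[R]_n) (z : 'cV[R]_n) :
    set 'M[R]_n :=
  conv_hull (bouligand F z).

Definition lipschitz_near (R : realType) n (F : 'cV[R]_n -> 'cV[R]_n)
    (z : 'cV[R]_n) : Prop :=
  exists l : R, exists2 U : set 'cV[R]_n, nbhs z U & elipschitz_on l U F.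

Definition dir_differentiable (R : realType) n (F : 'cV[R]_n -> 'cV[R]_n)
    (z : 'cV[R]_n) : Prop :=
  forall v : 'cV[R]_n, cvg ((fun t : R => t^-1 *: (F (z + t *: v) - F z)) @ 0^'+).

Definition semismooth_gap (R : realType) n (F : 'cV[R]_n -> 'cV[R]_n)
    (z h : 'cV[R]_n) : \bar R :=
  ereal_sup [set (enorm (F (z + h) - F z - D *m h))%:E | D in clarke F (z + h)].

Definition semismooth (R : realType) n (F : 'cV[R]_n -> 'cV[R]_n)
    (z : 'cV[R]_n) : Prop :=
  [/\ lipschitz_near F z, dir_differentiable F z &
      forall e : R, 0 < e -> \forall h \near (0 : 'cV[R]_n),
        (semismooth_gap F z h <= (e * enorm h)%R%:E)%E].

Definition semismooth_order (R : realType) n (beta : R)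
    (F : 'cV[R]_n -> 'cV[R]_n) (z : 'cV[R]_n) : Prop :=
  [/\ lipschitz_near F z, dir_differentiable F z &
      exists c : R, \forall h \near (0 : 'cV[R]_n),
        (semismooth_gap F z h <= (c * enorm h `^ (1 + beta))%R%:E)%E].

Definition Fnor (R : realType) n (lam : R) (f : 'cV[R]_n -> R)
    (phi : 'cV[R]_n -> \bar R) (z : 'cV[R]_n) : 'cV[R]_n :=
  grad f (prox lam phi z) + lam^-1 *: (z - prox lam phi z).

Definition chi (R : realType) n (lam : R) (f : 'cV[R]_n -> R)
    (phi : 'cV[R]_n -> \bar R) (z : 'cV[R]_n) : R :=
  enorm (Fnor lam f phi z).

Definition psi (R : realType) n (f : 'cV[R]_n -> R) (phi : 'cV[R]_n -> \bar R)
    (x : 'cV[R]_n) : \bar R :=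
  ((f x)%:E + phi x)%E.

Definition merit (R : realType) n (lam : R) (f : 'cV[R]_n -> R)
    (phi : 'cV[R]_n -> \bar R) (tau : R) (z : 'cV[R]_n) : \bar R :=
  (psi f phi (prox lam phi z)
   + (tau * lam / 2 * enorm (Fnor lam f phi z) ^+ 2)%R%:E)%E.

(* [m] is the number of iterations left, [i] the current iteration, [p0] the
   initial direction and [q], [r], [p] are q_i, r_i, p_i. *)
Fixpoint cg_loop (R : realType) n (S : 'M[R]_n) (eps : R) (p0 : 'cV[R]_n)
    (m i : nat) (q r p : 'cV[R]_n) {struct m} : 'cV[R]_n :=
  if m is m'.+1 then
    let curv := dotv p (S *m p) in
    if curv <= 0 then (if i == 0%N then p0 else q) else
    let alpha := enorm r ^+ 2 / curv in
    let q' := q + alpha *: p in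
    let r' := r + alpha *: (S *m p) in
    if enorm r' <= eps then q' else
    let beta := enorm r' ^+ 2 / enorm r ^+ 2 in
    cg_loop S eps p0 m' i.+1 q' r' (- r' + beta *: p)
  else q.

Definition cg (R : realType) n (S : 'M[R]_n) (g : 'cV[R]_n) (eps : R) :
    'cV[R]_n :=
  if enorm g <= eps then 0 else cg_loop S eps (- g) n 0 0 g (- g).

(* [par_q] is the exponent called q in eta_k, [par_p] the exponent called p in
   nu_k, and [par_tau0] is tau_{-1}. *)
Record params (R : realType) (n : nat) := Params {
  par_z0 : 'cV[R]_n;
  par_B0 : 'M[R]_n;
  par_Lbar : R;
  par_lam : R;
  par_tau0 : R;
  par_sigma : R;
  par_rho : R;
  par_gamma : R;
  par_nu : R;
  par_q : R;
  par_p : R;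
  par_eta : R;
  par_eps : nat -> R
}.

Definition valid_params (R : realType) n (P : params R n) : Prop :=
  [/\ (par_B0 P)^T = par_B0 P,
      [/\ 0 < par_Lbar P, 0 < par_lam P & 0 < par_tau0 P],
      [/\ 0 < par_sigma P < 1, 0 < par_rho P < 1,
          0 < par_gamma P < 1 & 0 < par_nu P < 1],
      [/\ 0 < par_q P, 0 < par_p P & 0 < par_eta P] &
      forall k, 0 <= par_eps P k].

(* Data produced by a non-terminating run; [it_t k] is the linesearch index
   accepted at iteration k and [it_tau k] is tau_k. *)
Record iterates (R : realType) (n : nat) := Iterates {
  it_z : nat -> 'cV[R]_n;
  it_B : nat -> 'M[R]_n;
  it_D : nat -> 'M[R]_n;
  it_t : nat -> nat;
  it_tau : nat -> R
}.

Definition it_x (R : realType) n (P : params R n) (phi : 'cV[R]_n -> \bar R)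
    (I : iterates R n) (k : nat) : 'cV[R]_n :=
  prox (par_lam P) phi (it_z I k).

Definition it_F (R : realType) n (P : params R n) (f : 'cV[R]_n -> R)
    (phi : 'cV[R]_n -> \bar R) (I : iterates R n) (k : nat) : 'cV[R]_n :=
  Fnor (par_lam P) f phi (it_z I k).

Definition it_chi (R : realType) n (P : params R n) (f : 'cV[R]_n -> R)
    (phi : 'cV[R]_n -> \bar R) (I : iterates R n) (k : nat) : R :=
  chi (par_lam P) f phi (it_z I k).

Definition it_M (R : realType) n (P : params R n) (I : iterates R n) (k : nat) :
    'M[R]_n :=
  it_B I k *m it_D I k + (par_lam P)^-1 *: (1%:M - it_D I k).

Definition it_q (R : realType) n (P : params R n) (f : 'cV[R]_n -> R)
    (phi : 'cV[R]_n -> \bar R) (I : iterates R n) (k : nat) : 'cV[R]_n :=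
  cg (it_D I k *m it_M P I k) (it_D I k *m it_F P f phi I k) (par_eps P k).

Definition it_d (R : realType) n (P : params R n) (f : 'cV[R]_n -> R)
    (phi : 'cV[R]_n -> \bar R) (I : iterates R n) (k : nat) : 'cV[R]_n :=
  - it_F P f phi I k.

Definition it_e (R : realType) n (P : params R n) (f : 'cV[R]_n -> R)
    (phi : 'cV[R]_n -> \bar R) (I : iterates R n) (k : nat) : 'cV[R]_n :=
  (par_lam P)^-1 *: it_q P f phi I k - it_M P I k *m it_q P f phi I k.

(* [growth q k] is b_k and [growth p k] is a_k. *)
Definition growth (R : realType) (s : R) (k : nat) : R :=
  (k%:R * ln (k.+1%:R : R) ^+ 2) `^ s.

Definition it_eta (R : realType) n (P : params R n) (f : 'cV[R]_n -> R)
    (phi : 'cV[R]_n -> \bar R) (I : iterates R n) (k : nat) : R :=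
  Num.min (growth (par_q P) k * it_chi P f phi I k `^ par_q P) (par_eta P).

Definition second_order (R : realType) n (P : params R n) (f : 'cV[R]_n -> R)
    (phi : 'cV[R]_n -> \bar R) (I : iterates R n) (k : nat) : bool :=
  it_eta P f phi I k * enorm (it_e P f phi I k) <= it_chi P f phi I k.

Definition it_step (R : realType) n (P : params R n) (f : 'cV[R]_n -> R)
    (phi : 'cV[R]_n -> \bar R) (I : iterates R n) (k : nat) (alpha : R) :
    'cV[R]_n :=
  if second_order P f phi I k then
    (alpha * par_lam P) *: (it_d P f phi I k + alpha *: it_e P f phi I k)
  else (alpha * par_lam P) *: it_d P f phi I k.

Definition trial_z (R : realType) n (P : params R n) (f : 'cV[R]_n -> R)
    (phi : 'cV[R]_n -> \bar R) (I : iterates R n) (k t : nat) : 'cV[R]_n :=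
  it_z I k + it_step P f phi I k (par_rho P ^+ t).

Definition trial_x (R : realType) n (P : params R n) (f : 'cV[R]_n -> R)
    (phi : 'cV[R]_n -> \bar R) (I : iterates R n) (k t : nat) : 'cV[R]_n :=
  prox (par_lam P) phi (trial_z P f phi I k t).

Definition trial_L (R : realType) n (P : params R n) (f : 'cV[R]_n -> R)
    (phi : 'cV[R]_n -> \bar R) (I : iterates R n) (k t : nat) : R :=
  let x := it_x P phi I k in
  let y := trial_x P f phi I k t in
  let U := f y - f x - dotv (grad f x) (y - x) in
  let V := enorm (y - x) in
  let W := enorm (grad f y - grad f x) in
  if V != 0 then Num.max (2 * U / V ^+ 2) (W / V) else par_Lbar P.

Definition trial_nu (R : realType) n (P : params R n) (f : 'cV[R]_n -> R)
    (phi : 'cV[R]_n -> \bar R) (I : iterates R n) (k t : nat) : R :=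
  Num.min (par_nu P)
    (growth (par_p P) k ^+ 2
     * enorm (trial_x P f phi I k t - it_x P phi I k) `^ (2 * par_p P)).

Definition prev_tau (R : realType) n (P : params R n) (I : iterates R n)
    (k : nat) : R :=
  if k is j.+1 then it_tau I j else par_tau0 P.

Definition trial_tau (R : realType) n (P : params R n) (f : 'cV[R]_n -> R)
    (phi : 'cV[R]_n -> \bar R) (I : iterates R n) (k t : nat) : R :=
  Num.min
    (2 * par_gamma P * (1 - trial_nu P f phi I k t)
     / (trial_L P f phi I k t ^+ 2 * par_lam P ^+ 2 + 2))
    (prev_tau P I k).

Definition accept (R : realType) n (P : params R n) (f : 'cV[R]_n -> R)
    (phi : 'cV[R]_n -> \bar R) (I : iterates R n) (k t : nat) : Prop :=
  let lam := par_lam P in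
  let alpha := par_rho P ^+ t in
  let tau := trial_tau P f phi I k t in
  (merit lam f phi tau (trial_z P f phi I k t) - merit lam f phi tau (it_z I k)
   <= (- (par_sigma P * lam * tau * alpha / 2 * it_chi P f phi I k ^+ 2)
       - trial_nu P f phi I k t / (lam * alpha)
         * enorm (trial_x P f phi I k t - it_x P phi I k) ^+ 2)%R%:E)%E.

Definition it_alpha (R : realType) n (P : params R n) (I : iterates R n)
    (k : nat) : R :=
  par_rho P ^+ it_t I k.

Record generated (R : realType) n (P : params R n) (f : 'cV[R]_n -> R)
    (phi : 'cV[R]_n -> \bar R) (I : iterates R n) : Prop := Generated {
  gen_z0 : it_z I 0%N = par_z0 P;
  gen_B0 : it_B I 0%N = par_B0 P;
  gen_Bsym : forall k, (it_B I k)^T = it_B I k;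
  gen_D : forall k, clarke (prox (par_lam P) phi) (it_z I k) (it_D I k);
  gen_accept : forall k, accept P f phi I k (it_t I k);
  gen_first : forall k t, (t < it_t I k)%N -> ~ accept P f phi I k t;
  gen_tau : forall k, it_tau I k = trial_tau P f phi I k (it_t I k);
  gen_next : forall k,
    it_z I k.+1 = it_z I k + it_step P f phi I k (it_alpha P I k)
}.

(* Main.v *)
Require Import Defs.
From HB Require Import structures.
From mathcomp Require Import all_boot all_order all_algebra.
From mathcomp Require Import all_classical all_reals all_analysis.
From mathcomp Require Import ring lra.

Set Implicit Arguments.
Unset Strict Implicit.
Unset Printing Implicit Defensive.

Import Order.TTheory GRing.Theory Num.Theory.
Import numFieldNormedType.Exports.

Local Open Scope classical_set_scope.
Local Open Scope ring_scope.

(** Write [h = z - zbar], [x = prox z], [v = x - prox zbar], [F] for the normal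
    map and [chi = |F|].

    Globally, the linesearch makes the merit function decrease by a multiple of
    [alpha_k * chi_k^2]: firm nonexpansiveness of [prox] gives a descent term
    [- |p - x|^2 / (lam * alpha)], and the choice of [tau_k] lets it absorb the
    change of [|F|^2].  Stepsizes stay bounded below as long as the correction
    [e_k] is bounded by a multiple of [chi_k] ([accept_small_step]), which the
    bounds on [M_k^-1] and on the CG residual provide; hence every accumulation
    point is a zero of [F] ([Fzbar0]).  The bound on the CG residual rests on
    the symmetry of the Clarke Jacobians of [prox] ([clarke_prox_sym]): then
    [D_k M_k] is symmetric and positive semidefinite with right-hand side in its
    range, so that CG never meets a direction of zero curvature and must reach
    the tolerance ([cg_residual_le]).

    Locally, [s_k = lam (d_k + e_k)] solves [M_k s = - F] up to [O(eps_k)]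
    ([newton_equation]), and [M_k h - F] is [o(|h|)] by semismoothness, the
    Dennis-More condition and differentiability of [grad f] at the limit.  Hence
    [z_k + s_k - zbar = o(|h|)] ([newton_superlinear]).  This also yields the
    local error bound [|h| <= C chi], which isolates [zbar] among the
    accumulation points, turns accumulation into convergence ([z_converges]),
    and, bounding the merit gap by a multiple of [chi^2], forces [chi_k] to
    decay geometrically ([residual_geometric]).  Geometric decay beats the
    factors [k ln^2 (k + 1)], so the second order direction is eventually
    selected and [nu_k] tends to zero.

    It remains that the unit step passes the linesearch.  The residual part of
    the merit function drops by almost [tau lam chi^2 / 2], so it suffices that
    the objective satisfies [psi (prox zbar) - psi x <= o(|h|^2)]
    ([psi_second_order]).  The curvature of [f] contributes [<v, B v> / 2], that
    of [phi] contributes [<h - v, v> / (2 lam)] ([prox_val_second_order]), and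
    their sum is [<h, D M h> / 2 >= 0] up to [o(|h|^2)] because [v] is [D h] up
    to [o(|h|)].  The rate [1 + beta] follows from the same bound on the Newton
    step with [o] replaced by [O] of order [1 + beta]. *)

(** * Euclidean geometry of column vectors *)

Section Euclid.
Variables (R : realType) (n : nat).
Implicit Types (u v w x y : 'cV[R]_n) (a b : R) (A : 'M[R]_n).

Lemma dotvC u v : dotv u v = dotv v u.
Proof. by apply: eq_bigr => i _; rewrite mulrC. Qed.

Lemma dotvDl u v w : dotv (u + v) w = dotv u w + dotv v w.
Proof. by rewrite /dotv -big_split; apply: eq_bigr => i _; rewrite mxE mulrDl. Qed.

Lemma dotvDr u v w : dotv w (u + v) = dotv w u + dotv w v.
Proof. by rewrite !(dotvC w) dotvDl. Qed.

Lemma dotvZl a u v : dotv (a *: u) v = a * dotv u v.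
Proof. by rewrite /dotv mulr_sumr; apply: eq_bigr => i _; rewrite mxE mulrA. Qed.

Lemma dotvZr a u v : dotv u (a *: v) = a * dotv u v.
Proof. by rewrite dotvC dotvZl dotvC. Qed.

Lemma dotvNl u v : dotv (- u) v = - dotv u v.
Proof. by rewrite -scaleN1r dotvZl mulN1r. Qed.

Lemma dotvNr u v : dotv u (- v) = - dotv u v.
Proof. by rewrite dotvC dotvNl dotvC. Qed.

Lemma dotv0l u : dotv 0 u = 0.
Proof. by rewrite -(scale0r u) dotvZl mul0r. Qed.

Lemma dotv0r u : dotv u 0 = 0.
Proof. by rewrite dotvC dotv0l. Qed.

Definition dotvE := (dotvDl, dotvDr, dotvNl, dotvNr, dotvZl, dotvZr).

Lemma dotv_mulmx A u v : dotv u (A *m v) = dotv (A^T *m u) v.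
Proof.
rewrite /dotv; under eq_bigr do rewrite mxE mulr_sumr.
rewrite exchange_big; apply: eq_bigr => i _; rewrite mxE mulr_suml.
by apply: eq_bigr => j _; rewrite mxE; ring.
Qed.

Lemma dotv_delta u (i : 'I_n) : dotv u (delta_mx i 0) = u i 0.
Proof.
rewrite /dotv (bigD1 i)//= big1 => [|j ji]; last by rewrite mxE (negbTE ji) mulr0.
by rewrite mxE !eqxx mulr1 addr0.
Qed.

Lemma dotvv_ge0 u : 0 <= dotv u u.
Proof. by apply: sumr_ge0 => i _; rewrite -expr2 sqr_ge0. Qed.

Lemma enorm_ge0 u : 0 <= enorm u.
Proof. exact: sqrtr_ge0. Qed.

Lemma enorm_sqr u : enorm u ^+ 2 = dotv u u.
Proof. by rewrite sqr_sqrtr ?dotvv_ge0. Qed.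

Lemma enorm_eq0 u : (enorm u == 0) = (u == 0).
Proof.
apply/idP/eqP => [|->]; last by rewrite /enorm dotv0l sqrtr0.
rewrite sqrtr_eq0 => u0; apply/colP => i; rewrite mxE.
have /eqP : dotv u u = 0 by apply/eqP; rewrite eq_le u0 dotvv_ge0.
rewrite psumr_eq0 => [|j _]; last by rewrite -expr2 sqr_ge0.
by move=> /allP/(_ i (mem_index_enum i))/=; rewrite -expr2 sqrf_eq0 => /eqP.
Qed.

Lemma enorm0 : enorm (0 : 'cV[R]_n) = 0.
Proof. by apply/eqP; rewrite enorm_eq0. Qed.

Lemma enorm_gt0 u : (0 < enorm u) = (u != 0).
Proof. by rewrite lt_neqAle enorm_ge0 andbT eq_sym enorm_eq0. Qed.

Lemma enormZ a u : enorm (a *: u) = `|a| * enorm u.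
Proof.
by rewrite /enorm dotvZl dotvZr mulrA -expr2 sqrtrM ?sqr_ge0// sqrtr_sqr.
Qed.

Lemma enormN u : enorm (- u) = enorm u.
Proof. by rewrite -scaleN1r enormZ normrN1 mul1r. Qed.

Lemma enormC u v : enorm (u - v) = enorm (v - u).
Proof. by rewrite -enormN opprB. Qed.

Lemma cauchy_schwarz u v : dotv u v <= enorm u * enorm v.
Proof.
have [->|v0] := eqVneq v 0; first by rewrite dotv0r enorm0 mulr0.
have [->|u0] := eqVneq u 0; first by rewrite dotv0l enorm0 mul0r.
have := dotvv_ge0 (enorm v *: u - enorm u *: v).
rewrite !dotvE -!enorm_sqr (dotvC v u).
rewrite -enorm_gt0 in v0; rewrite -enorm_gt0 in u0.
set a := enorm u in u0 *; set b := enorm v in v0 *.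
rewrite (_ : _ + _ = (a * b) * (2 * (a * b - dotv u v))); last by ring.
by rewrite pmulr_rge0 ?mulr_gt0// pmulr_rge0// subr_ge0.
Qed.

Lemma cauchy_schwarzN u v : - dotv u v <= enorm u * enorm v.
Proof. by rewrite -dotvNl -(enormN u) cauchy_schwarz. Qed.

Lemma cauchy_schwarz_norm u v : `|dotv u v| <= enorm u * enorm v.
Proof. by rewrite ler_norml lerNl cauchy_schwarzN cauchy_schwarz. Qed.

Lemma enormD u v : enorm (u + v) <= enorm u + enorm v.
Proof.
rewrite -(@ler_pXn2r _ 2)// ?nnegrE ?addr_ge0 ?enorm_ge0//.
rewrite enorm_sqr !dotvE -!enorm_sqr (dotvC v u).
by have := cauchy_schwarz u v; lra.
Qed.

Lemma enormB u v : enorm (u - v) <= enorm u + enorm v.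
Proof. by rewrite -(enormN v) enormD. Qed.

Lemma enorm_triangle u v w : enorm (u - w) <= enorm (u - v) + enorm (v - w).
Proof. by rewrite -[u - w](subrKA v) enormD. Qed.

Lemma enorm_le_dist u v : enorm u <= enorm (v - u) + enorm v.
Proof. by have := enorm_triangle u v 0; rewrite !subr0 (enormC u). Qed.

Lemma enorm_sum m (F : 'I_m -> 'cV[R]_n) :
  enorm (\sum_i F i) <= \sum_i enorm (F i).
Proof.
elim/big_rec2 : _ => [|i b s _ h]; first by rewrite enorm0.
by rewrite (le_trans (enormD _ _))// lerD2l.
Qed.

(** The topology comes from the maximum norm; the two comparisons below
    let every neighbourhood be described by Euclidean balls. *)
Lemma mxnorm_le_enorm u : `|u| <= enorm u.
Proof.
rewrite [leLHS]/Num.norm /= mx_normrE; apply/bigmax_leP; split; first exact: enorm_ge0.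
move=> [i j] _ /=; rewrite ord1 -sqrtr_sqr ler_wsqrtr//.
rewrite /dotv (bigD1 i)//= expr2 lerDl sumr_ge0// => k _.
by rewrite -expr2 sqr_ge0.
Qed.

Lemma coord_le_mxnorm u (i : 'I_n) : `|u i 0| <= `|u|.
Proof.
rewrite [leRHS]/Num.norm /= mx_normrE; apply/bigmax_geP; right => /=.
by exists (i, 0).
Qed.

Lemma enorm_delta (i : 'I_n) : enorm (delta_mx i 0 : 'cV[R]_n) = 1.
Proof. by rewrite /enorm dotv_delta mxE !eqxx sqrtr1. Qed.

Lemma col_sum_delta u : u = \sum_i u i 0 *: delta_mx i 0.
Proof.
rewrite {1}[u]matrix_sum_delta; apply: eq_bigr => i _.
by rewrite big_ord1.
Qed.

Lemma enorm_le_mxnorm u : enorm u <= n%:R * `|u|.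
Proof.
rewrite [u in enorm u]col_sum_delta (le_trans (enorm_sum _))//.
rewrite mulr_natl (_ : `|u| *+ n = \sum_(i < n) `|u|); last first.
  by rewrite sumr_const card_ord.
apply: ler_sum => i _.
by rewrite enormZ enorm_delta mulr1 coord_le_mxnorm.
Qed.

Lemma nbhs_enormP x (A : set 'cV[R]_n) :
  nbhs x A <-> exists2 d, 0 < d & forall y, enorm (y - x) < d -> A y.
Proof.
split=> [/nbhs_ballP[d /= d0 dA]|[d d0 dA]].
  exists d => // y yx; apply: dA.
  by rewrite -ball_normE /= distrC (le_lt_trans (mxnorm_le_enorm _)).
apply/nbhs_ballP; exists (d / n.+1%:R) => /=; first by rewrite divr_gt0.
move=> y; rewrite -ball_normE /= distrC ltr_pdivlMr// => xy.
apply: dA; apply: le_lt_trans (enorm_le_mxnorm _) _.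
by rewrite (le_lt_trans _ xy)// mulrC ler_wpM2l// ler_nat.
Qed.

Lemma cvg_enormP (T : Type) (F : set_system T) (FF : Filter F)
    (g : T -> 'cV[R]_n) x :
  g @ F --> x <-> forall e, 0 < e -> \forall t \near F, enorm (g t - x) < e.
Proof.
split=> [gx e e0|gx A /nbhs_enormP[d d0 dA]].
  by apply: (gx [set y | enorm (y - x) < e]); apply/nbhs_enormP; exists e.
by rewrite /nbhs /=; near do apply: dA; exact: gx.
Unshelve. all: by end_near. Qed.

Lemma enorm_mulmx_bounded A : exists2 c, 0 <= c &
  forall u, enorm (A *m u) <= c * enorm u.
Proof.
exists (\sum_i enorm (col i A)); first by apply: sumr_ge0 => i _; exact: enorm_ge0.
move=> u.
have -> : A *m u = \sum_i u i 0 *: col i A.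
  apply/colP => i; rewrite mxE summxE; apply: eq_bigr => j _.
  by rewrite !mxE mulrC.
rewrite (le_trans (enorm_sum _))// mulr_suml; apply: ler_sum => i _.
rewrite enormZ mulrC ler_wpM2l ?enorm_ge0//.
exact: le_trans (coord_le_mxnorm u i) (mxnorm_le_enorm u).
Qed.

Lemma enorm_mulmx A u : enorm (A *m u) <= specnorm A * enorm u.
Proof.
have [c c0 cA] := enorm_mulmx_bounded A.
have [->|u0] := eqVneq u 0; first by rewrite mulmx0 enorm0 mulr0.
rewrite -enorm_gt0 in u0; rewrite -ler_pdivrMr//.
apply: ub_le_sup.
  exists c => _ [v /= v1 <-]; rewrite (le_trans (cA v))//.
  by rewrite -[leRHS]mulr1 ler_wpM2l.
exists ((enorm u)^-1 *: u) => /=.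
  by rewrite enormZ ger0_norm ?invr_ge0 ?enorm_ge0// mulVf ?gt_eqF.
by rewrite -scalemxAr enormZ ger0_norm ?invr_ge0 ?enorm_ge0// mulrC.
Qed.

Lemma enorm_mulmx_le A u a : specnorm A <= a -> enorm (A *m u) <= a * enorm u.
Proof. by move=> h; rewrite (le_trans (enorm_mulmx A u))// ler_wpM2r// enorm_ge0. Qed.

Lemma closed_eball_compact x r : compact [set y : 'cV[R]_n | enorm (y - x) <= r].
Proof.
have ctr : continuous (fun v : 'rV[R]_n => v^T).
  move=> v A /nbhs_ballP[e /= e0 eA]; apply/nbhs_ballP; exists e => //= w [_ vw].
  by apply: eA; split => // i j; rewrite !mxE.
have cen : continuous (fun y : 'cV[R]_n => enorm (y - x)).
  move=> y; apply/(@cvgrPdist_le _ _ _ (nbhs y)) => e e0.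
  apply/nbhs_enormP; exists e => // w wy.
  rewrite ler_norml; have := enorm_triangle w y x; have := enorm_triangle y w x.
  by rewrite (enormC y w); lra.
rewrite (_ : mkset _ =
    (fun v : 'rV[R]_n => v^T) @` [set v : 'rV[R]_n | enorm (v^T - x) <= r]); last first.
  apply/seteqP; split=> [y yr|_ [v vr <-]//].
  by exists y^T; rewrite /= trmxK.
apply: continuous_compact; first exact: continuous_subspaceT.
apply: bounded_closed_compact.
  exists (r + enorm x); split; first exact: num_real.
  move=> M /ltW rM v /= vr; apply: le_trans rM.
  have -> : `|v| = `|v^T|.
    rewrite /Num.norm /= !mx_normrE; apply/eqP; rewrite eq_le.
    apply/andP; split; apply/bigmax_leP; split=> /=.
    - by apply/bigmax_geP; left.
    - by move=> [i j] _; apply/bigmax_geP; right; exists (j, i) => //=; rewrite mxE.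
    - by apply/bigmax_geP; left.
    - by move=> [i j] _; apply/bigmax_geP; right; exists (j, i) => //=; rewrite mxE.
  rewrite (le_trans (mxnorm_le_enorm _))//.
  rewrite -[v^T](subrK x) (le_trans (enormD _ _))// lerD2r.
  exact: vr.
apply: (@closed_comp _ _ (fun v : 'rV[R]_n => enorm (v^T - x)) [set t | t <= r]).
  move=> v _; apply: (@continuous_comp _ _ _ (fun v : 'rV[R]_n => v^T)
     (fun y : 'cV[R]_n => enorm (y - x))); [exact: ctr|exact: cen].
exact: closed_le.
Qed.

End Euclid.

(** * Minimization of lower semicontinuous functions *)

Section Lsc.
Variables (R : realType) (X : topologicalType).
Implicit Types (h : X -> \bar R) (K : set X).

Lemma ereal_between (a b : \bar R) : (a < b)%E ->
  exists r : R, (a < r%:E)%E /\ (r%:E < b)%E.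
Proof.
case: a b => [a| |] [b| |] //.
- rewrite lte_fin => ab; exists ((a + b) / 2); rewrite !lte_fin; lra.
- by move=> _; exists (a + 1); rewrite lte_fin ltrDl ltr01 ltry.
- by move=> _; exists (b - 1); rewrite ltNyr lte_fin ltrBlDr ltrDl ltr01.
- by move=> _; exists 0; rewrite ltNyr ltry.
Qed.

(** Locally bounded below by semicontinuity, hence bounded below on [K]. *)
Lemma lsc_compact_lbound h K : compact K -> lower_semicontinuous h ->
  (forall x, h x != -oo%E) -> exists m : R, forall x, K x -> (m%:E < h x)%E.
Proof.
move=> /compact_near_coveringP Kc hl hN.
have : \forall M \near +oo, K `<=` (fun x => ((- M)%:E < h x)%E).
  apply: Kc => x Kx.
  have [a [_ ax]] : exists r : R, (-oo < r%:E)%E /\ (r%:E < h x)%E.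
    by apply: ereal_between; rewrite ltNye.
  have [V Vx Va] := hl _ _ ax.
  exists (V, [set M | - a < M]).
    by split => //=; apply: nbhs_pinfty_gt; exact: num_real.
  move=> [y M] /= [Vy aM]; apply: le_lt_trans (Va _ Vy).
  by rewrite lee_fin lerNl ltW.
move=> [M [_ MK]]; exists (- (M + 1)) => x Kx.
by apply: (MK (M + 1)) => //; rewrite ltrDl.
Qed.

(** If the minimum were not attained, every point of [K] would have a
    neighbourhood where [h] exceeds some level above the infimum; by compactness
    one level would do for all of [K]. *)
Lemma lsc_compact_min h K x0 : compact K -> lower_semicontinuous h ->
  (forall x, h x != -oo%E) -> K x0 ->
  exists2 x, K x & forall y, K y -> (h x <= h y)%E.
Proof.
move=> Kc hl hN Kx0; apply: contrapT => noMin.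
have [m mK] := lsc_compact_lbound Kc hl hN.
have below x : K x -> exists2 y, K y & (h y < h x)%E.
  move=> Kx; apply: contrapT => H; apply: noMin; exists x => // y Ky.
  by rewrite leNgt; apply/negP => yx; apply: H; exists y.
pose V := [set a : R | exists2 w, K w & (h w < a%:E)%E].
have Vlb : has_lbound V.
  exists m => a [w Kw wa]; rewrite -lee_fin ltW//.
  exact: lt_trans (mK _ Kw) wa.
have V0 : V !=set0.
  have [w Kw wx] := below _ Kx0.
  by have [a [wa _]] := ereal_between wx; exists a, w.
have iK x : K x -> ((inf V)%:E < h x)%E.
  move=> Kx; have [w Kw wx] := below _ Kx.
  have [a [wa ax]] := ereal_between wx.
  by apply: le_lt_trans ax; rewrite lee_fin ge_inf//; exists w.
have /compact_near_coveringP Kc' := Kc.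
have : \forall a \near (inf V)^'+, K `<=` (fun x => (a%:E < h x)%E).
  apply: Kc' => x Kx.
  have [b [ib bx]] := ereal_between (iK _ Kx).
  have [W Wx Wb] := hl _ _ bx.
  exists (W, [set a | a < b]).
    by split => //=; apply: nbhs_right_lt; rewrite -lte_fin.
  move=> [y a] /= [Wy ab]; apply: lt_trans (Wb _ Wy).
  by rewrite lte_fin.
move=> /(filterI (nbhs_right_gt (inf V))) /filter_ex[a [ia aK]].
have [|a' [w Kw wa'] a'a] := inf_adherent (_ : 0 < a - inf V) (conj V0 Vlb).
  by rewrite subr_gt0.
have := lt_trans (aK _ Kw) wa'; rewrite lte_fin => aa'.
by move: a'a; rewrite addrCA subrr addr0 ltNge (ltW aa').
Qed.

End Lsc.

(** * Proximal mappings of convex functions *)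

Lemma enorm_segment_sqr (R : realType) n (p y z : 'cV[R]_n) (t : R) :
  enorm (z - (t *: y + (1 - t) *: p)) ^+ 2 =
  enorm (z - p) ^+ 2 - 2 * t * dotv (z - p) (y - p) + t ^+ 2 * enorm (y - p) ^+ 2.
Proof.
rewrite !enorm_sqr !dotvE (dotvC p z) (dotvC y z) (dotvC y p).
by ring.
Qed.

Lemma firm_of_obtuse (R : realType) n (p q z w : 'cV[R]_n) :
  dotv (z - p) (q - p) + dotv (w - q) (p - q) <= 0 ->
  enorm (p - q) ^+ 2 <= dotv (p - q) (z - w).
Proof.
rewrite enorm_sqr (dotvC _ (z - w)) !dotvE (dotvC q p).
by lra.
Qed.

Lemma segment_min_ineq (R : realType) (lam a fy t e e' D N : R) :
  0 < lam -> 0 < t -> e' = e - 2 * t * D + t ^+ 2 * N ->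
  a + (2 * lam)^-1 * e <= t * fy + (1 - t) * a + (2 * lam)^-1 * e' ->
  lam * (a - fy) + D <= t * (N / 2).
Proof.
move=> lam0 t0 -> H; rewrite -(ler_pM2l t0).
have /ler_wpM2l/(_ _ _ H) : 0 <= 2 * lam by rewrite mulr_ge0// ltW.
rewrite !mulrDr !(mulrA (2 * lam) (2 * lam)^-1) mulfV ?mul1r; first by lra.
by rewrite mulf_neq0// gt_eqF.
Qed.

Section Prox.
Variables (R : realType) (n : nat) (phi : 'cV[R]_n -> \bar R) (lam : R).
Hypothesis phi_proper : eproper phi.
Hypothesis phi_lsc : lower_semicontinuous phi.
Hypothesis phi_convex : econvex phi.
Hypothesis lam_gt0 : 0 < lam.
Implicit Types x y z w u v : 'cV[R]_n.

Local Notation prx := (prox lam phi).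

Let phi_real y : (phi y < +oo)%E -> exists r : R, phi y = r%:E.
Proof.
by case: phi_proper => /(_ y) + _; case: (phi y) => // r _ _; exists r.
Qed.

(** A convex function which is bounded below on a ball decreases at most
    linearly: a point far away is pulled back into the ball along the segment
    joining it to the centre. *)
Lemma convex_linear_lbound : exists x0, exists f0 c : R,
  [/\ phi x0 = f0%:E, 0 <= c &
      forall y, ((f0 - c * (1 + enorm (y - x0)))%:E <= phi y)%E].
Proof.
have [phiN [x0 x0fin]] := phi_proper.
have [f0 f0E] := phi_real x0fin.
have [m mK] := lsc_compact_lbound (@closed_eball_compact R n x0 1) phi_lsc phiN.
have mf0 : m < f0.
  by rewrite -lte_fin -f0E; apply: mK => /=; rewrite subrr enorm0.
exists x0, f0, (f0 - m); split => //; first by rewrite subr_ge0 ltW.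
move=> y; set r := enorm (y - x0).
have r0 : 0 <= r by exact: enorm_ge0.
have [r1|r1] := leP r 1.
  apply: le_trans (ltW (mK y r1)); rewrite lee_fin.
  have : 0 <= (f0 - m) * r by rewrite mulr_ge0// subr_ge0 ltW.
  by lra.
have [yinf|] := eqVneq (phi y) +oo%E; first by rewrite yinf leey.
rewrite -ltey => /phi_real[fy fyE]; rewrite fyE lee_fin.
have r_gt0 : 0 < r by lra.
have ri : 0 <= r^-1 <= 1 by rewrite invr_ge0 r0 invf_le1// ltW.
have := phi_convex y x0 ri; rewrite f0E fyE.
have : (m%:E < phi (r^-1 *: y + (1 - r^-1) *: x0))%E.
  apply: mK => /=; rewrite scalerBl scale1r addrCA -scalerBr.
  by rewrite addrAC subrr add0r enormZ ger0_norm ?invr_ge0// mulVf ?gt_eqF.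
move=> /lt_le_trans /[apply]; rewrite -!EFinM -EFinD lte_fin => H.
have : r * m < r * (r^-1 * fy + (1 - r^-1) * f0) by rewrite ltr_pM2l.
rewrite (_ : r * (r^-1 * fy + (1 - r^-1) * f0) = fy + (r - 1) * f0); last first.
  by field; rewrite gt_eqF.
by lra.
Qed.

Let obj z y := (phi y + ((2 * lam)^-1 * enorm (z - y) ^+ 2)%R%:E)%E.

Let obj_lsc z : lower_semicontinuous (obj z).
Proof.
move=> x a ax.
have ax' : ((a - (2 * lam)^-1 * enorm (z - x) ^+ 2)%:E < phi x)%E.
  move: ax; rewrite /obj; case: (phi x) => [r| |] //.
    by rewrite -EFinD !lte_fin ltrBlDr.
  by move=> _; rewrite ltry.
have [b [ab bx]] := ereal_between ax'.
have [V Vx Vb] := phi_lsc bx.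
move: ab; rewrite lte_fin => ab.
set e := b - (a - (2 * lam)^-1 * enorm (z - x) ^+ 2).
have e0 : 0 < e by rewrite subr_gt0.
have k0 : 0 < (2 * lam)^-1 by rewrite invr_gt0 mulr_gt0.
have q0 : 0 <= enorm (z - x) := enorm_ge0 _.
set d := e / ((2 * lam)^-1 * (2 * enorm (z - x) + 1)).
have d0 : 0 < d by rewrite divr_gt0// mulr_gt0//; lra.
exists (V `&` [set y | enorm (y - x) < d]).
  by apply: filterI => //; apply/nbhs_enormP; exists d.
move=> y [Vy /= yx].
apply: (@lt_le_trans _ _ (b + (2 * lam)^-1 * enorm (z - y) ^+ 2)%:E); last first.
  by rewrite EFinD leeD2r// ltW// Vb.
rewrite lte_fin.
have t1 : enorm (z - x) <= enorm (z - y) + enorm (y - x) := enorm_triangle _ _ _.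
move: yx; rewrite /d ltr_pdivlMr ?mulr_gt0//; last by lra.
move: t1 (enorm_ge0 (z - y)) (enorm_ge0 (y - x)).
set A := enorm (z - x) in q0 e e0 d d0 *; set B := enorm (z - y).
set C := enorm (y - x); set k := (2 * lam)^-1 in k0 e e0 d d0 * => t1 B0 C0 Ce.
have [AB|BA] := leP A B.
  have : k * A ^+ 2 <= k * B ^+ 2 by rewrite ler_pM2l// ler_pXn2r// nnegrE.
  by move: e0; rewrite /e; lra.
have h1 : A ^+ 2 - B ^+ 2 <= C * (2 * A).
  rewrite (_ : A ^+ 2 - B ^+ 2 = (A - B) * (A + B)); last by ring.
  by apply: ler_pM; lra.
have : k * (A ^+ 2 - B ^+ 2) <= k * (C * (2 * A)) by rewrite ler_pM2l.
have : 0 <= k * C by rewrite mulr_ge0// ltW.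
by move: Ce; rewrite /e; lra.
Qed.

(** The quadratic term outgrows the linear lower bound of [phi], which reduces
    the minimization to a ball. *)
Lemma prox_exists z : exists y, argmin (obj z) y.
Proof.
have [x0 [f0 [c [f0E c0 lb]]]] := convex_linear_lbound.
set b := enorm (z - x0).
have b0 : 0 <= b := enorm_ge0 _.
set rho := 1 + 2 * b + 4 * lam * c.
have lc : 0 <= lam * c by rewrite mulr_ge0// ltW.
have rho0 : 0 <= rho by rewrite /rho; lra.
have objN y : obj z y != -oo%E.
  rewrite /obj; case: phi_proper => /(_ y) + _.
  by case: (phi y).
have K0 : [set y | enorm (y - x0) <= rho] x0 by rewrite /= subrr enorm0.
have [y Ky ymin] := lsc_compact_min (@closed_eball_compact R n x0 rho)
  (@obj_lsc z) objN K0.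
exists y => w.
have [wr|wr] := leP (enorm (w - x0)) rho; first exact: ymin.
apply: le_trans (ymin _ K0) _; rewrite /obj f0E.
apply: (@le_trans _ _ ((f0 - c * (1 + enorm (w - x0))) +
    (2 * lam)^-1 * enorm (z - w) ^+ 2)%:E); last first.
  by rewrite EFinD leeD2r.
rewrite -EFinD lee_fin -/b.
have t1 : enorm (w - x0) <= enorm (z - w) + b.
  by rewrite (enormC z w) enorm_triangle.
set r := enorm (w - x0) in wr t1 *; set q := enorm (z - w) in t1 *.
have q0 : 0 <= q := enorm_ge0 _.
have hr : r - b <= q by lra.
have rb : 0 <= r - b by move: wr; rewrite /rho; lra.
have h2 : (r - b) ^+ 2 <= q ^+ 2 by rewrite ler_pXn2r// nnegrE.
have h3 : r * (2 * b + 4 * (lam * c)) <= r * r.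
  by rewrite ler_pM2l; move: wr; rewrite /rho; lra.
have r1 : 1 <= r by move: wr; rewrite /rho; lra.
have h4 : lam * c * 1 <= lam * c * r by rewrite ler_wpM2l.
suff : b ^+ 2 + 2 * lam * (c * (1 + r)) <= q ^+ 2.
  move=> H; have /ler_wpM2l/(_ _ _ H) : 0 <= (2 * lam)^-1.
    by rewrite invr_ge0 mulr_ge0// ltW.
  rewrite mulrDr [_^-1 * (2 * lam * _)]mulrA mulVf ?mul1r; first by lra.
  by rewrite mulf_neq0// gt_eqF.
by apply: le_trans h2; lra.
Qed.

Lemma prox_min z y : (obj z (prx z) <= obj z y)%E.
Proof. exact: (xgetPex 0 (prox_exists z)). Qed.

Lemma prox_edom z : edom phi (prx z).
Proof.
have [phiN [x0 x0fin]] := phi_proper.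
have [f0 f0E] := phi_real x0fin.
have := prox_min z x0; rewrite /edom /obj /= f0E -EFinD => H.
have := le_lt_trans H (ltry _); have := phiN (prx z).
by case: (phi (prx z)) => // r _ _; rewrite ltry.
Qed.

(** Proximal points lie in the domain of [phi], so nothing is lost by [fine]. *)
Definition prox_val z : R := fine (phi (prx z)).

Lemma prox_valE z : phi (prx z) = (prox_val z)%:E.
Proof. by have [r rE] := phi_real (prox_edom z); rewrite /prox_val rE. Qed.

(** Comparing the minimizer with points of the segment towards [y] and letting
    the segment shrink gives the optimality condition
    [(z - prox z) / lam \in subdiff phi (prox z)]. *)
Lemma prox_subdiff z : subdiff phi (prx z) (lam^-1 *: (z - prx z)).
Proof.
split=> [|y]; first exact: prox_edom.
rewrite prox_valE -EFinD.
have [yinf|] := eqVneq (phi y) +oo%E; first by rewrite yinf leey.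
rewrite -ltey => /phi_real[fy fyE]; rewrite fyE lee_fin.
set p := prx z; set a := prox_val z.
set D := dotv (z - p) (y - p); set N := enorm (y - p) ^+ 2.
rewrite dotvZl -/D.
have key t : 0 < t <= 1 -> lam * (a - fy) + D <= t * (N / 2).
  move=> /andP[t0 t1].
  have t01 : 0 <= t <= 1 by rewrite (ltW t0).
  apply: (segment_min_ineq lam_gt0 t0 (enorm_segment_sqr p y z t)).
  rewrite -lee_fin; have := le_trans (prox_min z (t *: y + (1 - t) *: p))
    (leeD2r _ (phi_convex y p t01)).
  by rewrite /obj prox_valE fyE -!EFinM -!EFinD.
have : lam * (a - fy) + D <= 0.
  apply/ler_addgt0Pl => e e0; rewrite addr0.
  have N0 : 0 <= N by rewrite sqr_ge0.
  pose t := Num.min 1 (e / (N + 1)).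
  have t0 : 0 < t by rewrite lt_min ltr01 divr_gt0//; lra.
  have t1 : t <= 1 by rewrite ge_min lexx.
  apply: le_trans (key t _) _; first by rewrite t0.
  have : t <= e / (N + 1) by rewrite ge_min lexx orbT.
  rewrite ler_pdivlMr; last by lra.
  have : 0 <= t * N by rewrite mulr_ge0// ltW.
  by lra.
move=> H; rewrite -subr_le0 -(pmulr_rle0 _ lam_gt0).
rewrite !mulrDr mulrA mulfV ?gt_eqF// mul1r.
by move: H; lra.
Qed.

Lemma prox_val_ge z w :
  prox_val z + lam^-1 * dotv (z - prx z) (prx w - prx z) <= prox_val w.
Proof.
have [_ /(_ (prx w))] := prox_subdiff z.
by rewrite !prox_valE -EFinD lee_fin dotvZl.
Qed.

Lemma prox_firm z w :
  enorm (prx z - prx w) ^+ 2 <= dotv (prx z - prx w) (z - w).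
Proof.
have aux (a b c d : R) : a + c <= b -> b + d <= a -> c + d <= 0 by lra.
have h1 := prox_val_ge z w; have h2 := prox_val_ge w z.
apply: firm_of_obtuse; rewrite -(@pmulr_rle0 _ lam^-1) ?invr_gt0// mulrDr.
exact: aux h1 h2.
Qed.

Lemma prox_nonexpansive z w : enorm (prx z - prx w) <= enorm (z - w).
Proof.
have := le_trans (prox_firm z w) (cauchy_schwarz _ _).
have [->|p0] := eqVneq (prx z - prx w) 0; first by rewrite enorm0 enorm_ge0.
by rewrite expr2 ler_pM2l// enorm_gt0.
Qed.

End Prox.
(** * Derivatives along lines *)

Section Lines.
Variable R : realType.

Lemma is_derive_of_littleo (g : R -> R) (s d : R) :
  (forall e, 0 < e -> exists2 r, 0 < r &
     forall h, `|h| < r -> `|g (h + s) - g s - h * d| <= e * `|h|) ->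
  is_derive s 1 g d.
Proof.
move=> H.
have cv : (fun h : R => h^-1 *: ((g \o shift s) (h *: 1) - g s)) @ 0^' --> d.
  apply/cvgrPdist_le => e e0; have [r r0 rP] := H e e0.
  near=> h.
  have h0 : h != 0 by near: h; exact: nbhs_dnbhs_neq.
  have hr : `|h| < r.
    near: h; apply: nbhs_dnbhs; apply/nbhs_ballP; exists r => //= t.
    by rewrite -ball_normE /= sub0r normrN.
  rewrite /= /GRing.scale /= mulr1 distrC.
  have -> : h^-1 * (g (h + s) - g s) - d = h^-1 * (g (h + s) - g s - h * d).
    by rewrite [in RHS]mulrBr mulKf.
  by rewrite normrM normfV ler_pdivrMl ?normr_gt0// [leRHS]mulrC rP.
by apply: DeriveDef; [exact: (cvgP _ cv)|exact: (cvg_lim _ cv)].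
Unshelve. all: by end_near. Qed.

Lemma is_derive_of_quadratic (g : R -> R) (s d C : R) :
  (forall h, `|g (h + s) - g s - h * d| <= C * h ^+ 2) -> is_derive s 1 g d.
Proof.
move=> H; apply: is_derive_of_littleo => e e0.
have C0 : 0 <= C by have := le_trans (normr_ge0 _) (H 1); rewrite expr1n mulr1.
exists (e / (C + 1)) => [|h]; first by rewrite divr_gt0// ltr_wpDl.
rewrite ltr_pdivlMr ?ltr_wpDl// => he.
apply: le_trans (H h) _; rewrite -real_normK ?num_real// expr2 mulrA.
apply: ler_wpM2r => //; apply: le_trans (ltW he); rewrite mulrC.
by apply: ler_wpM2l => //; rewrite lerDl.
Qed.

Lemma mean_value_unit (g dg : R -> R) (t : R) : 0 < t ->
  (forall s, 0 <= s <= t -> is_derive s 1 g (dg s)) ->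
  exists2 c, 0 < c < t & g t - g 0 = dg c * t.
Proof.
move=> t0 H; have [||c ct E] := @MVT R g dg 0 t t0.
- by move=> s; rewrite in_itv /= => /andP[s0 st]; apply: H; rewrite !ltW.
- apply: derivable_within_continuous => s; rewrite in_itv /= => sI.
  by have [] := H _ sI.
by exists c; [rewrite in_itv in ct|rewrite E subr0].
Qed.

Variable n : nat.
Implicit Types x y u v w : 'cV[R]_n.

Lemma dlin_jac (F : 'cV[R]_n -> 'cV[R]_n) x w : differentiable F x ->
  'd F x w = jac F x *m w.
Proof.
move=> Fx; rewrite [w in LHS]col_sum_delta linear_sum; apply/colP => i.
rewrite summxE mxE; apply: eq_bigr => j _.
by rewrite linearZ /= !mxE mulrC.
Qed.

Lemma dlin_grad (f : 'cV[R]_n -> R) x w : differentiable f x ->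
  'd f x w = dotv (grad f x) w.
Proof.
move=> fx; rewrite [w in LHS]col_sum_delta linear_sum.
by apply: eq_bigr => j _; rewrite linearZ /= !mxE mulrC.
Qed.

Lemma differentiable_expansion (F : 'cV[R]_n -> 'cV[R]_n) x :
  differentiable F x -> forall e, 0 < e -> exists2 d, 0 < d &
  forall w, enorm w < d -> enorm (F (x + w) - F x - jac F x *m w) <= e * enorm w.
Proof.
move=> Fx e e0.
have en : 0 < e / n.+1%:R by rewrite divr_gt0.
have /eqaddoP/(_ _ en)/nbhs_enormP[d d0 dP] := diff_locally Fx.
exists d => // w wd; have := dP w; rewrite subr0 => /(_ wd) /= H.
rewrite -dlin_jac// -addrA -opprD (le_trans (enorm_le_mxnorm _))//.
rewrite [x + w]addrC.
rewrite -[leRHS](@mulfVK _ n.+1%:R)//.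
rewrite mulrC; apply: ler_pM => //; last by rewrite ler_nat.
by rewrite (le_trans H)// [leRHS]mulrAC ler_wpM2l ?mxnorm_le_enorm// ltW.
Qed.

Lemma is_derive_line (f : 'cV[R]_n -> R) x v (s : R) :
  differentiable f (x + s *: v) ->
  is_derive s 1 (fun t => f (x + t *: v)) (dotv (grad f (x + s *: v)) v).
Proof.
move=> fx.
have dv := @diff_derivable _ _ _ _ _ v fx.
have E : (fun h : R => h^-1 *: (((fun t => f (x + t *: v)) \o shift s) (h *: 1)
             - f (x + s *: v))) =
         (fun h : R => h^-1 *: ((f \o shift (x + s *: v)) (h *: v) - f (x + s *: v))).
  apply/funext => h /=; congr (_ *: (f _ - _)).
  by rewrite [h *: 1]mulr1 scalerDl addrCA.
apply: DeriveDef.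
  by rewrite /derivable E.
by rewrite /derive E -[lim _]/('D_v f (x + s *: v)) deriveE// dlin_grad.
Qed.

(** Scalar form of the chain rule, suited to the mean value theorem for
    vector-valued maps. *)
Lemma is_derive_line_dotv (F : 'cV[R]_n -> 'cV[R]_n) x v u (s : R) :
  differentiable F (x + s *: v) ->
  is_derive s 1 (fun t => dotv u (F (x + t *: v))) (dotv u (jac F (x + s *: v) *m v)).
Proof.
move=> Fx; apply: is_derive_of_littleo => e e0.
pose c := (enorm u + 1) * (enorm v + 1).
have c0 : 0 < c by rewrite mulr_gt0// ltr_wpDl// enorm_ge0.
have [r r0 rP] := differentiable_expansion Fx (divr_gt0 e0 c0).
have v1 : 0 < enorm v + 1 by rewrite ltr_wpDl// enorm_ge0.
exists (r / (enorm v + 1)) => [|h]; first by rewrite divr_gt0.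
rewrite ltr_pdivlMr// => hr.
have hv : enorm (h *: v) < r.
  rewrite enormZ; apply: le_lt_trans hr; apply: ler_wpM2l => //.
  by rewrite lerDl.
have := rP _ hv; rewrite -(addrA x) -scalerDl [s + h]addrC.
rewrite -scalemxAr; move: (F _) (F _) (jac _ _ *m v) => a b w H.
rewrite -dotvNr -dotvDr -dotvZr -dotvNr -dotvDr.
apply: le_trans (cauchy_schwarz_norm _ _) _.
apply: le_trans (ler_wpM2l (enorm_ge0 u) H) _.
rewrite enormZ /c; move: (enorm u) (enorm v) (enorm_ge0 u) (enorm_ge0 v) => y y' y0 y0'.
have -> : y * (e / ((y + 1) * (y' + 1)) * (`|h| * y')) =
    e * `|h| * (y * y' / ((y + 1) * (y' + 1))).
  by field; rewrite !gt_eqF// ltr_wpDl.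
rewrite ler_piMr// ?mulr_ge0 ?(ltW e0)//.
rewrite ler_pdivrMr ?mul1r; last by rewrite mulr_gt0// ltr_wpDl.
by rewrite mulrDl mul1r mulrDr mulr1 -addrA lerDl addr_ge0// addr_ge0.
Qed.

End Lines.
(** * The potential of a proximal mapping *)

Section PotentialEstimates.
Variables (R : realType) (n : nat).
Implicit Types (p q z w u v h : 'cV[R]_n).

(** Here [p] and [q] stand for the proximal points of [z] and [w], and [a], [b]
    for the values of the convex function there.  The subgradient inequality of
    the potential holds with a surplus of [|p - q|^2 / 2]. *)
Lemma potential_ineq p q z w (a b lam : R) : 0 < lam ->
  b + lam^-1 * dotv (w - q) (p - q) <= a ->
  dotv z p - enorm p ^+ 2 / 2 - lam * a + dotv p (w - z) <=
  dotv w q - enorm q ^+ 2 / 2 - lam * b.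
Proof.
move=> lam0; rewrite -(ler_pM2l lam0) mulrDr mulrA mulfV ?gt_eqF// mul1r.
have := dotvv_ge0 (p - q).
rewrite !enorm_sqr !dotvE (dotvC q p) (dotvC p w) (dotvC p z).
by lra.
Qed.

Lemma potential_model (zb xb h v : 'cV[R]_n) (lam a b e : R) :
  dotv (zb + h) (xb + v) - enorm (xb + v) ^+ 2 / 2 - lam * b
    - (dotv zb xb - enorm xb ^+ 2 / 2 - lam * a) <= dotv xb h + dotv v h / 2 + e ->
  dotv (zb - xb) v + dotv (h - v) v / 2 - e <= lam * (b - a).
Proof.
rewrite !enorm_sqr !dotvE (dotvC v h) (dotvC v xb) (dotvC xb h).
by lra.
Qed.

Lemma mulmx_increment (A : 'M[R]_n) (P0 P1 P2 u v : 'cV[R]_n) (t c : R) :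
  (P1 - P0 - A *m (t *: u + c *: v)) - (P2 - P0 - A *m (c *: v)) =
  P1 - P2 - t *: (A *m u).
Proof.
rewrite mulmxDr -!scalemxAr; move: (A *m u) (A *m v) => a b.
by apply/colP => i; rewrite !mxE; ring.
Qed.

Lemma bounded_gap_eq (x y c : R) : (forall e, 0 < e -> `|x - y| <= e * c) -> x = y.
Proof.
move=> H; apply/eqP; rewrite -subr_eq0 -normr_le0; apply/ler_addgt0Pl => e e0.
have c1 : 0 < `|c| + 1 by have := normr_ge0 c; lra.
rewrite addr0 (le_trans (H (e / (`|c| + 1)) _)) ?divr_gt0//.
rewrite mulrAC ler_pdivrMr// ler_wpM2l ?ltW//.
by have := ler_norm c; lra.
Qed.

(** Nonexpansiveness and compactness of the unit ball make the directional
    expansion uniform in the direction.  Positive homogeneity of the directional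
    derivative is then expressed without naming that derivative: the increment
    along [s *: h] is [s] times the increment along [h], up to [o(|h|)]. *)
Lemma dir_differentiable_uniform (F : 'cV[R]_n -> 'cV[R]_n) zb :
  (forall z w, enorm (F z - F w) <= enorm (z - w)) ->
  dir_differentiable F zb -> forall e, 0 < e -> exists2 d, 0 < d &
  forall h s, enorm h < d -> 0 <= s <= 1 ->
    enorm (F (zb + s *: h) - F zb - s *: (F (zb + h) - F zb)) <= e * enorm h.
Proof.
move=> Fne Fdir e e0.
pose Q (t : R) (u : 'cV[R]_n) := exists l, forall s, 0 < s < t ->
  enorm (F (zb + s *: u) - F zb - s *: l) <= e / 2 * s.
have : \forall t \near 0^'+, [set u | enorm (u - 0) <= 1] `<=` Q t.
  have /compact_near_coveringP := @closed_eball_compact R n 0 1.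
  apply => u _; have /cvg_ex[l /cvg_enormP ul] := Fdir u.
  have e4 : 0 < e / 4 by lra.
  have [d /= d0 dP] := ul _ e4.
  exists ([set w | enorm (w - u) < e / 4], [set t | t < d]).
    split => /=; first by apply/nbhs_enormP; exists (e / 4).
    exact: nbhs_right_lt.
  move=> [w t] /= [wu td]; exists l => s /andP[s0 st].
  have s1 : enorm (F (zb + s *: u) - F zb - s *: l) <= e / 4 * s.
    have := dP s; rewrite /ball_ /= sub0r normrN gtr0_norm// => /(_ (lt_trans st td) s0).
    rewrite (_ : F (zb + s *: u) - F zb - s *: l =
       s *: (s^-1 *: (F (zb + s *: u) - F zb) - l)); last first.
      by rewrite [in RHS]scalerBr scalerA mulfV ?gt_eqF// scale1r.
    by rewrite enormZ gtr0_norm// => /ltW H; rewrite mulrC ler_wpM2r// ltW.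
  have s2 : enorm (F (zb + s *: w) - F (zb + s *: u)) <= e / 4 * s.
    apply: le_trans (Fne _ _) _.
    rewrite opprD addrACA subrr add0r -scalerBr enormZ gtr0_norm// mulrC.
    by rewrite ler_wpM2r// ltW.
  have := enorm_triangle (F (zb + s *: w) - F zb - s *: l) (F (zb + s *: u) - F zb - s *: l) 0.
  rewrite !subr0.
  rewrite (_ : F (zb + s *: w) - F zb - s *: l - (F (zb + s *: u) - F zb - s *: l) =
     F (zb + s *: w) - F (zb + s *: u)); last first.
    by move: (F _) (F _) (F zb) => a b c; apply/colP => i; rewrite !mxE; ring.
  by move: s1 s2; lra.
move=> /(filterI (nbhs_right_gt 0)) /filter_ex[t [t0 tP]].
exists t => // h s ht /andP[s0 s1].
have [->|h0] := eqVneq h 0.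
  by rewrite enorm0 mulr0 scaler0 addr0 subrr scaler0 subrr enorm0.
rewrite -enorm_gt0 in h0; set r := enorm h in ht h0 *.
have hE : h = r *: (r^-1 *: h) by rewrite scalerA mulfV ?gt_eqF// scale1r.
have [|l lP] := tP (r^-1 *: h).
  by rewrite /= subr0 enormZ gtr0_norm ?invr_gt0// mulVf ?gt_eqF.
have := lP r; rewrite h0 ht -hE => /(_ isT) H1.
have [s_gt0|] := ltP 0 s; last first.
  move=> sle; have -> : s = 0 by apply/le_anti; rewrite sle s0.
  by rewrite !scale0r addr0 !subrr enorm0 mulr_ge0 // ltW.
have sr : 0 < s * r < t.
  by rewrite mulr_gt0// (le_lt_trans _ ht)// ler_piMl// ltW.
have shE : s *: h = (s * r) *: (r^-1 *: h) by rewrite -scalerA -hE.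
have H2 := lP _ sr; rewrite -shE in H2.
have := enormB (F (zb + s *: h) - F zb - (s * r) *: l) (s *: (F (zb + h) - F zb - r *: l)).
rewrite (_ : _ - _ - s *: (F (zb + h) - F zb - r *: l) =
   F (zb + s *: h) - F zb - s *: (F (zb + h) - F zb)); last first.
  by move: (F _) (F _) (F zb) => a b c; apply/colP => i; rewrite !mxE; ring.
rewrite enormZ gtr0_norm// => H3; apply: le_trans H3 _.
have h4 : s * enorm (F (zb + h) - F zb - r *: l) <= 1 * (e / 2 * r).
  by apply: ler_pM => //; exact: enorm_ge0.
have h5 : e / 2 * (s * r) <= e / 2 * r.
  by rewrite ler_wpM2l ?ler_piMl// ltW//; lra.
by apply: le_trans (lerD H2 h4) _; move: h5; lra.
Qed.

End PotentialEstimates.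

Section ProxPotential.
Variables (R : realType) (n : nat) (phi : 'cV[R]_n -> \bar R) (lam : R).
Hypothesis phi_proper : eproper phi.
Hypothesis phi_lsc : lower_semicontinuous phi.
Hypothesis phi_convex : econvex phi.
Hypothesis lam_gt0 : 0 < lam.
Implicit Types x y z w u v : 'cV[R]_n.

Local Notation prx := (prox lam phi).
Local Notation pval := (prox_val phi lam).

(** The convex conjugate of [lam * phi + |.|^2 / 2], whose gradient is the
    proximal mapping. *)
Definition prox_potential z : R :=
  dotv z (prx z) - enorm (prx z) ^+ 2 / 2 - lam * pval z.

Local Notation pot := prox_potential.

Lemma prox_potential_ge z w : pot z + dotv (prx z) (w - z) <= pot w.
Proof. exact/potential_ineq/prox_val_ge. Qed.

Lemma prox_potential_ge_line z v t : pot z + t * dotv (prx z) v <= pot (z + t *: v).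
Proof.
rewrite -dotvZr; have -> : t *: v = z + t *: v - z by rewrite addrAC subrr add0r.
by rewrite addrCA subrr addr0; exact: prox_potential_ge.
Qed.

Lemma prox_potential_line z v (s : R) :
  is_derive s 1 (fun t => pot (z + t *: v)) (dotv (prx (z + s *: v)) v).
Proof.
apply: (@is_derive_of_quadratic _ _ _ _ (enorm v ^+ 2)) => h.
have := prox_potential_ge_line (z + s *: v) v h.
have := prox_potential_ge_line (z + (h + s) *: v) v (- h).
have shE : z + (h + s) *: v = z + s *: v + h *: v.
  by rewrite -addrA -scalerDl [s + h]addrC.
rewrite -shE (_ : z + (h + s) *: v + - h *: v = z + s *: v); last first.
  by rewrite -addrA -scalerDl addrAC subrr add0r.
have ne : enorm (prx (z + (h + s) *: v) - prx (z + s *: v)) <= `|h| * enorm v.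
  rewrite (le_trans (prox_nonexpansive phi_proper phi_lsc phi_convex lam_gt0 _ _))//.
  by rewrite shE addrAC subrr add0r enormZ.
have := le_trans (cauchy_schwarz_norm _ _) (ler_wpM2r (enorm_ge0 v) ne).
rewrite dotvDl dotvNl.
move: (pot (z + s *: v)) (pot (z + (h + s) *: v)) (dotv (prx (z + s *: v)) v)
  (dotv (prx (z + (h + s) *: v)) v) (enorm v) (enorm_ge0 v) => b a d c e e0.
move=> H1 H2 H3.
have : `|h| * `|c - d| <= `|h| * (`|h| * e * e) by rewrite ler_wpM2l.
rewrite -normrM ler_norml => /andP[H4 H5].
rewrite ger0_norm; last by lra.
have -> : e ^+ 2 * h ^+ 2 = `|h| * (`|h| * e * e).
  by rewrite -(real_normK (num_real h)); ring.
by lra.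
Qed.

(** Second differences of the potential are symmetric in the two increments,
    and the mean value theorem identifies their leading term with the
    bilinear form of the Jacobian. *)
Lemma jac_prox_sym y : differentiable prx y -> (jac prx y)^T = jac prx y.
Proof.
move=> Py; set A := jac prx y.
have key (u v : 'cV[R]_n) (e d t : R) : 0 < t ->
    (forall w, enorm w < d -> enorm (prx (y + w) - prx y - A *m w) <= e * enorm w) ->
    0 < e -> t * (enorm u + enorm v) < d ->
    `|pot (y + t *: u + t *: v) - pot (y + t *: v) - (pot (y + t *: u) - pot y)
      - t ^+ 2 * dotv (A *m u) v| <= 2 * e * t ^+ 2 * (enorm u + enorm v) * enorm v.
  move=> t0 AP e0 td.
  pose gg s := pot (y + t *: u + s *: v) - pot (y + s *: v).
  have [|c /andP[c0 ct]] := @mean_value_unit _ gg (fun s => dotv (prx (y + t *: u + s *: v)) v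
      - dotv (prx (y + s *: v)) v) t t0.
    by move=> s _; apply: is_deriveB; exact: prox_potential_line.
  rewrite /gg scale0r !addr0 => ->.
  rewrite -dotvNl -dotvDl.
  have -> : dotv (prx (y + t *: u + c *: v) - prx (y + c *: v)) v * t -
     t ^+ 2 * dotv (A *m u) v = t * dotv (prx (y + t *: u + c *: v) - prx (y + c *: v)
       - t *: (A *m u)) v.
    rewrite !dotvDl !dotvNl dotvZl.
    by move: (dotv _ _) (dotv _ _) (dotv _ _) => a b c'; ring.
  rewrite normrM gtr0_norm// (_ : 2 * e * t ^+ 2 * (enorm u + enorm v) * enorm v =
    t * (2 * (e * (t * (enorm u + enorm v))) * enorm v)); last first.
    by move: (enorm u) (enorm v) => a b; ring.
  apply: ler_wpM2l; first exact: ltW.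
  apply: le_trans (cauchy_schwarz_norm _ _) _.
  apply: ler_wpM2r; first exact: enorm_ge0.
  rewrite -(mulmx_increment A (prx y) _ _ u v t c).
  have n1 : enorm (t *: u + c *: v) <= t * (enorm u + enorm v).
    apply: le_trans (enormD _ _) _; rewrite !enormZ !gtr0_norm// mulrDr lerD2l.
    by rewrite ler_wpM2r ?enorm_ge0// ltW.
  have n2 : enorm (c *: v) <= t * (enorm u + enorm v).
    rewrite enormZ gtr0_norm//.
    apply: ler_pM; [exact: ltW|exact: enorm_ge0|exact: ltW|].
    by rewrite lerDr enorm_ge0.
  have m1 := AP _ (le_lt_trans n1 td); have m2 := AP _ (le_lt_trans n2 td).
  rewrite addrA in m1.
  apply: le_trans (enormB _ _) _; apply: le_trans (lerD m1 m2) _.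
  rewrite -mulrDr mulrCA; apply: ler_wpM2l; first exact: ltW.
  by apply: le_trans (lerD n1 n2) _; rewrite mulr2n mulrDl mul1r.
have sym (u v : 'cV[R]_n) : dotv (A *m u) v = dotv (A *m v) u.
  apply: (@bounded_gap_eq _ _ _ (4 * (enorm u + enorm v) ^+ 2)) => e e0.
  have [d d0 AP] := differentiable_expansion Py e0.
  pose c := enorm u + enorm v; have c0 : 0 <= c by rewrite addr_ge0 ?enorm_ge0.
  pose t := d / (c + 1); have t0 : 0 < t by rewrite divr_gt0//; lra.
  have td : t * (enorm u + enorm v) < d.
    rewrite -/c /t mulrAC ltr_pdivrMr; last by lra.
    by rewrite ltr_pM2l//; lra.
  have k1 := key u v e d t t0 AP e0 td.
  have k2 : t * (enorm v + enorm u) < d by rewrite [_ + enorm u]addrC.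
  move/(key v u e d t t0 AP e0): k2.
  rewrite (addrAC y) [enorm v + _]addrC -/c.
  move: k1; rewrite -/c.
  have uc : enorm u <= c by rewrite lerDl enorm_ge0.
  have vc : enorm v <= c by rewrite lerDr enorm_ge0.
  have u0 := enorm_ge0 u; have v0 := enorm_ge0 v.
  move: (pot _) (pot _) (pot _) (pot _) (dotv _ _) (dotv _ _) => p1 p2 p3 p4 q1 q2.
  move: (enorm u) (enorm v) uc vc u0 v0 => a b ac bc a0 b0.
  have t2 : 0 < t ^+ 2 by rewrite exprn_gt0.
  have K0 : 0 <= 2 * e * t ^+ 2 * c.
    by rewrite mulr_ge0// mulr_ge0// ?ltW//; lra.
  have K1 : 2 * e * t ^+ 2 * c * a <= 2 * e * t ^+ 2 * c * c by rewrite ler_wpM2l.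
  have K2 : 2 * e * t ^+ 2 * c * b <= 2 * e * t ^+ 2 * c * c by rewrite ler_wpM2l.
  rewrite !ler_norml => /andP[k3 k4] /andP[k5 k6].
  by rewrite -lerN2 opprK; apply/andP; split; rewrite -(ler_pM2l t2); lra.
apply/matrixP => i j; rewrite mxE.
have := sym (delta_mx i 0) (delta_mx j 0).
by rewrite !dotv_delta -!colE !mxE.
Qed.

Lemma clarke_prox_sym z D : clarke prx z D -> D^T = D.
Proof.
move=> [m [w [Q [_ _ QB ->]]]].
rewrite linear_sum; apply: eq_bigr => i _; rewrite linearZ /=; congr (_ *: _).
have [y [yd _ yV]] := QB i.
apply/matrixP => a b; rewrite mxE.
have cc c d : (fun k => jac prx (y k) c d) @ \oo --> Q i c d.
  exact: (continuous_cvg _ (@coord_continuous _ _ _ c d (Q i)) yV).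
have c1 := cc a b; have c2 := cc b a.
have E : (fun k => jac prx (y k) a b) = (fun k => jac prx (y k) b a).
  by apply/funext => k; rewrite -{1}(jac_prox_sym (yd k)) mxE.
by rewrite E in c1; apply: (cvg_unique _ c2 c1).
Qed.

(** Second order lower estimate of [phi] along the range of the proximal
    mapping: by positive homogeneity of the directional derivative, [prox] is
    linear up to [o(|h|)] on the segment from [zb] to [zb + h], so the mean
    value theorem applied to the potential gives the curvature term. *)
Lemma prox_val_second_order zb : dir_differentiable prx zb ->
  forall e, 0 < e -> exists2 d, 0 < d & forall h v, enorm h < d ->
    v = prx (zb + h) - prx zb ->
    dotv (zb - prx zb) v + dotv (h - v) v / 2 - e * enorm h ^+ 2 <=
    lam * (pval (zb + h) - pval zb).
Proof.
move=> Pdir e e0.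
have [d d0 dP] := dir_differentiable_uniform
  (prox_nonexpansive phi_proper phi_lsc phi_convex lam_gt0) Pdir e0.
exists d => // h v hd vE; apply: potential_model.
have -> : prx zb + v = prx (zb + h) by rewrite vE addrC subrK.
rewrite -[X in X - _ <= _]/(pot (zb + h)) -[X in _ - X <= _]/(pot zb).
pose gg s := pot (zb + s *: h) - s ^+ 2 * (dotv v h / 2).
have [|c /andP[c0 c1]] := @mean_value_unit _ gg (fun s => dotv (prx (zb + s *: h)) h
    - s * dotv v h) 1 ltr01.
  move=> s _.
  have dq : is_derive s 1 (fun s => s ^+ 2 * (dotv v h / 2)) (s * dotv v h).
    apply: is_derive_eq; rewrite /GRing.scale /=.
    by move: (dotv v h) => a; field.
  exact: (is_deriveB (prox_potential_line _ _ _) dq).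
rewrite /gg scale0r scale1r addr0 expr1n expr0n mul0r subr0 mul1r mulr1 => E.
have c01 : 0 <= c <= 1 by rewrite !ltW.
have := le_trans (cauchy_schwarz _ _) (ler_wpM2r (enorm_ge0 h) (dP h c hd c01)).
rewrite -vE.
rewrite !dotvDl !dotvNl dotvZl expr2 mulrA.
move: E; move: (pot _) (pot _) (dotv _ _) (dotv _ _) (dotv _ _) (_ * enorm h).
by move=> p1 p2 q1 q2 q3 q4; lra.
Qed.

End ProxPotential.
(** * The conjugate gradient method on a consistent semidefinite system *)

Section ConjugateGradient.
Variables (R : realType) (n : nat) (S : 'M[R]_n) (g : 'cV[R]_n) (eps : R).
Hypothesis S_sym : S^T = S.
Hypothesis S_psd : psd S.
Hypothesis eps_ge0 : 0 <= eps.
Implicit Types (q r p w x : 'cV[R]_n) (K : {vspace 'cV[R]_n}).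

Lemma sym_dotv x w : dotv (S *m x) w = dotv x (S *m w).
Proof. by rewrite dotv_mulmx S_sym. Qed.

(** Perturbing [p] in the direction [- S p] changes the nonnegative form by
    [- 2 t |S p|^2 + O(t^2)]. *)
Lemma psd_curvature0 p : dotv p (S *m p) <= 0 -> S *m p = 0.
Proof.
move=> curv; set a := S *m p.
suff : dotv a a <= 0 by rewrite -enorm_sqr exprn_even_le0//= enorm_eq0 => /eqP.
set b := dotv a (S *m a).
have b0 : 0 <= b := S_psd a.
have key t : 0 < t -> 2 * dotv a a <= t * b.
  move=> t0; have := S_psd (p - t *: a).
  rewrite mulmxBr -scalemxAr -/a !dotvE -/b -(sym_dotv p a) -/a.
  move: curv; rewrite -/a => curv H.
  rewrite -(ler_pM2l t0); move: H curv.
  by move: (dotv p a) (dotv a a) => u v; lra.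
apply/ler_addgt0Pl => e e0; rewrite addr0.
have t0 : 0 < e / (b + 1) by rewrite divr_gt0//; lra.
have := key _ t0; have : e / (b + 1) * b <= e.
  by rewrite mulrAC ler_pdivrMr; nra.
by have := dotvv_ge0 a; move: (dotv a a) => v; lra.
Qed.

(** [K] plays the role of the Krylov space spanned by the residuals produced so
    far.  The last two clauses keep residual and direction in the range of [S],
    where [S] is injective; this is what excludes a vanishing curvature. *)
Record cg_invariant K i q r p : Prop := CgInvariant {
  cg_residual : r = S *m q + g;
  cg_dim : \dim K = i;
  cg_active : eps < enorm r;
  cg_orth : forall x, x \in K -> dotv r x = 0;
  cg_conj : forall x, x \in K -> dotv (S *m p) x = 0;
  cg_dir : r + p \in K;
  cg_krylov : forall x, x \in K -> S *m x \in (<[r]> + K)%VS;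
  cg_range_r : exists w, r = S *m w;
  cg_range_p : exists w, p = S *m w
}.

Lemma cg_curvature_gt0 K i q r p : cg_invariant K i q r p -> 0 < dotv p (S *m p).
Proof.
move=> H; rewrite ltNge; apply/negP => /psd_curvature0 Sp0.
have [w pE] := cg_range_p H.
have p0 : p = 0.
  apply/eqP; rewrite -enorm_eq0 -sqrf_eq0 enorm_sqr {1}pE sym_dotv Sp0.
  by rewrite dotv0r.
have rK : r \in K by rewrite -[r]addr0 -p0 (cg_dir H).
have := cg_active H; rewrite ltNge => /negP; apply.
suff -> : enorm r = 0 by [].
by apply/eqP; rewrite -sqrf_eq0 enorm_sqr (cg_orth H rK).
Qed.

Lemma cg_notin K i q r p : cg_invariant K i q r p -> r \notin K.
Proof.
move=> H; apply/negP => rK; have := cg_active H; rewrite ltNge => /negP; apply.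
suff -> : enorm r = 0 by [].
by apply/eqP; rewrite -sqrf_eq0 enorm_sqr (cg_orth H rK).
Qed.

(** One CG step adds the current residual to the Krylov space.  Orthogonality
    and conjugacy to the older vectors come from the Krylov inclusion, those to
    the newest vector from the choice of [alpha] and [beta]. *)
Lemma cg_step K i q r p : cg_invariant K i q r p ->
  let alpha := enorm r ^+ 2 / dotv p (S *m p) in
  let r' := r + alpha *: (S *m p) in
  let beta := enorm r' ^+ 2 / enorm r ^+ 2 in
  eps < enorm r' ->
  cg_invariant (<[r]> + K)%VS i.+1 (q + alpha *: p) r' (- r' + beta *: p).
Proof.
move=> H alpha r' beta r'eps.
have c0 := cg_curvature_gt0 H.
have r0 : 0 < enorm r := le_lt_trans eps_ge0 (cg_active H).
have a0 : 0 < alpha by rewrite divr_gt0// exprn_gt0.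
have KS : (K <= <[r]> + K)%VS by exact: addvSr.
have rK' : r \in (<[r]> + K)%VS by rewrite (subvP (addvSl _ _))// memv_line.
have pK' : p \in (<[r]> + K)%VS.
  by rewrite -[p](addKr r) rpredD ?rpredN// (subvP KS)// (cg_dir H).
have decomp x : x \in (<[r]> + K)%VS -> exists a y, y \in K /\ x = a *: p + y.
  move=> /memv_addP[u /vlineP[b ->] [v vK ->]].
  exists (- b), (b *: (r + p) + v); split.
    by rewrite rpredD// rpredZ// (cg_dir H).
  by apply/colP => j; rewrite !mxE; ring.
have Spr : dotv (S *m p) r = - dotv p (S *m p).
  have := cg_conj H (cg_dir H); rewrite dotvDr (dotvC _ p) => /eqP.
  by rewrite addr_eq0 => /eqP.
have r'K : forall x, x \in (<[r]> + K)%VS -> dotv r' x = 0.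
  move=> _ /memv_addP[_ /vlineP[b ->] [v vK ->]].
  rewrite dotvDr dotvZr /r' !dotvDl !dotvZl (cg_orth H vK) (cg_conj H vK) Spr.
  rewrite -enorm_sqr mulrN /alpha divfK ?gt_eqF// subrr.
  by rewrite !mulr0 !addr0.
have SpE : S *m p = alpha^-1 *: (r' - r).
  by rewrite /r' addrC addKr scalerA mulVf ?gt_eqF// scale1r.
have Spmem : S *m p \in (<[r']> + (<[r]> + K))%VS.
  rewrite SpE rpredZ// rpredB//; first by rewrite (subvP (addvSl _ _))// memv_line.
  by rewrite (subvP (addvSr _ _)).
split => //.
- by rewrite /r' (cg_residual H) mulmxDr -scalemxAr addrAC.
- rewrite dimv_disjoint_sum ?(cg_dim H).
    by rewrite dim_vline -enorm_gt0 r0.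
  apply/eqP; rewrite -subv0; apply/subvP => x /memv_capP[/vlineP[b ->]].
  rewrite rpredZeq (negbTE (cg_notin H)) orbF => /eqP ->.
  by rewrite scale0r rpred0.
- move=> x /decomp[a [y [yK ->]]].
  rewrite dotvDr dotvZr mulmxDr mulmxN -scalemxAr !dotvDl !dotvNl !dotvZl.
  rewrite (cg_conj H yK) mulr0 addr0 !sym_dotv.
  rewrite (r'K _ (cg_krylov H yK)) oppr0 addr0.
  rewrite SpE [in dotv r' _]dotvZr dotvDr dotvNr (r'K _ rK') subr0 -enorm_sqr -SpE.
  rewrite /beta /alpha invf_div.
  apply/eqP; rewrite mulf_eq0; apply/orP; right; apply/eqP.
  move: (dotv p _) (enorm r') (enorm r) c0 r0 => c r1 r2 c0' r0'.
  by field; rewrite gt_eqF.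
- by rewrite addrA subrr add0r rpredZ.
- move=> x /decomp[a [y [yK ->]]].
  rewrite mulmxDr -scalemxAr rpredD ?rpredZ//.
  by rewrite (subvP (addvSr _ _))// (cg_krylov H yK).
- have [w rE] := cg_range_r H; exists (w + alpha *: p).
  by rewrite /r' {1}rE mulmxDr -scalemxAr.
- have [w rE] := cg_range_r H; have [w' pE] := cg_range_p H.
  exists (- (w + alpha *: p) + beta *: w').
  by rewrite mulmxDr mulmxN mulmxDr -!scalemxAr -rE -pE.
Qed.

(** When no iteration is left the Krylov space is the whole space, and a
    residual orthogonal to it cannot be above the tolerance. *)
Lemma cg_loop_residual p0 m i K q r p : (m + i)%N = n -> cg_invariant K i q r p ->
  enorm (S *m cg_loop S eps p0 m i q r p + g) <= eps.
Proof.
elim: m i K q r p => [|m IH] i K q r p /= mi H.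
  have := cg_notin H; rewrite (_ : K = fullv) ?memvf//.
  apply/eqP; rewrite eqEdim subvf (cg_dim H) dimvf dim_matrix /= -mi.
  by rewrite add0n -[i in X in (_ <= X)%N]muln1.
have c0 := cg_curvature_gt0 H.
rewrite [dotv p _ <= 0]leNgt c0 /=.
have [r'eps|r'eps] :=
    leP (enorm (r + (enorm r ^+ 2 / dotv p (S *m p)) *: (S *m p))) eps.
  by rewrite mulmxDr addrAC -(cg_residual H) -scalemxAr.
apply: (IH _ (<[r]> + K)%VS); first by rewrite addnS -mi.
exact: (cg_step H).
Qed.

Lemma cg_residual_le w : g = S *m w -> enorm (S *m cg S g eps + g) <= eps.
Proof.
move=> gE; rewrite /cg; have [geps|geps] := leP (enorm g) eps; first by rewrite mulmx0 add0r.
apply: (@cg_loop_residual _ _ _ 0%VS); first by rewrite addn0.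
split => //.
- by rewrite mulmx0 add0r.
- by rewrite dimv0.
- by move=> x; rewrite memv0 => /eqP ->; rewrite dotv0r.
- by move=> x; rewrite memv0 => /eqP ->; rewrite dotv0r.
- by rewrite subrr rpred0.
- by move=> x; rewrite memv0 => /eqP ->; rewrite mulmx0 rpred0.
- by exists w.
- by exists (- w); rewrite mulmxN gE.
Qed.

End ConjugateGradient.

(** * Decay of real sequences *)

Section RealSequences.
Variable R : realType.

(** The sequence [H] converges, so its decrements tend to zero. *)
Lemma telescoping_small (H a : nat -> R) (m : R) :
  (forall k, H k.+1 <= H k - a k) -> (forall k, 0 <= a k) ->
  (forall k, m <= H k) -> forall d, 0 < d ->
  exists N, forall k, (N <= k)%N -> a k < d.
Proof.
move=> Hdec a0 Hm d d0.
have Hni : nonincreasing_seq H.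
  by apply/nonincreasing_seqP => k; have := Hdec k; have := a0 k; lra.
have : cvgn H.
  by apply: nonincreasing_is_cvgn => //; exists m => _ [k _ <-].
have d2 : 0 < d / 2 by rewrite divr_gt0.
move=> /cvg_ex[l /cvgrPdist_lt/(_ _ d2)[N _ HN]]; exists N => k Nk.
have h1 := HN k Nk; have h2 := HN k.+1 (leqW Nk).
move: h1 h2; rewrite /= !ltr_norml => /andP[h1 h2] /andP[h3 h4].
by have := Hdec k; lra.
Qed.

Lemma expr_small (r : R) : 0 <= r < 1 -> forall d, 0 < d ->
  exists N, forall k, (N <= k)%N -> r ^+ k < d.
Proof.
move=> /andP[r0 r1] d d0.
have : (fun k => r ^+ k) @ \oo --> (0 : R) by apply: cvg_expr; rewrite ger0_norm.
move=> /cvgrPdist_lt/(_ _ d0)[N _ HN]; exists N => k Nk.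
by have := HN k Nk; rewrite /= sub0r normrN ger0_norm// exprn_ge0.
Qed.

End RealSequences.

Section Decay.
Variable R : realType.

Lemma bernoulli_le (y : R) k : 0 <= y <= 1 -> 1 - k%:R * y <= (1 - y) ^+ k.
Proof.
move=> /andP[y0 y1]; elim: k => [|k IH]; first by rewrite mul0r subr0 expr0.
rewrite exprS -natr1; have y1' : 0 <= 1 - y by lra.
have := ler_wpM2l y1' IH; have : 0 <= k%:R * y ^+ 2 by rewrite mulr_ge0// sqr_ge0.
by move: ((1 - y) ^+ k) => p; lra.
Qed.

Lemma linear_times_geometric (y : R) k : 0 <= y <= 1 ->
  (1 - y) ^+ k * (1 + k%:R * y) <= 1.
Proof.
move=> /andP[y0 y1]; elim: k => [|k IH]; first by rewrite mul0r addr0 expr0 mulr1.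
apply: le_trans IH; rewrite exprSr -natr1 -mulrA; apply: ler_wpM2l.
  by rewrite exprn_ge0//; lra.
have : 0 <= k%:R * y ^+ 2 by rewrite mulr_ge0// sqr_ge0.
by have := sqr_ge0 y; lra.
Qed.

(** Bernoulli's inequality provides a root of the ratio, [(1 - y) ^+ m.+1 >= th],
    and each of [m] copies of the root pays for one factor [k]. *)
Lemma geometric_beats_power (A th : R) m : 0 <= A -> 0 < th < 1 ->
  forall e, 0 < e -> exists N, forall k, (N <= k)%N -> k%:R ^+ m * (A * th ^+ k) <= e.
Proof.
move=> A0 /andP[th0 th1] e e0.
have m0 : 0 < m.+1%:R :> R by [].
pose y := (1 - th) / m.+1%:R.
have y0 : 0 < y by rewrite divr_gt0// subr_gt0.
have y1 : y < 1.
  rewrite ltr_pdivrMr// mul1r; have : 1 <= m.+1%:R :> R by rewrite ler1n.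
  by lra.
have yI : 0 <= y <= 1 by rewrite !ltW.
set r := 1 - y; have r0 : 0 < r by rewrite subr_gt0.
have rth : th <= r ^+ m.+1.
  have := bernoulli_le m.+1 yI; rewrite /y mulrC divfK ?gt_eqF// -/y -/r.
  by apply: le_trans; lra.
have kr k : k%:R * r ^+ k <= y^-1.
  rewrite -(ler_pM2r y0) mulVf ?gt_eqF//.
  have := linear_times_geometric k yI; rewrite -/r.
  have : 0 <= r ^+ k by rewrite exprn_ge0// ltW.
  by move: (r ^+ k) => p; lra.
have c0 : 0 <= A * y^-1 ^+ m by rewrite mulr_ge0// exprn_ge0// invr_ge0 ltW.
have rI : 0 <= r < 1 by rewrite ltW//= gtrBl.
have ep : 0 < e / (A * y^-1 ^+ m + 1) by rewrite divr_gt0// ltr_wpDl.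
have [N NP] := expr_small rI ep.
exists N => k Nk.
have -> : e = e / (A * y^-1 ^+ m + 1) * (A * y^-1 ^+ m + 1).
  by rewrite divfK// gt_eqF//; lra.
have rk : 0 <= r ^+ k by rewrite exprn_ge0// ltW.
apply: (@le_trans _ _ (r ^+ k * (A * y^-1 ^+ m))).
  apply: (@le_trans _ _ (k%:R ^+ m * (A * (r ^+ m.+1) ^+ k))).
    apply: ler_wpM2l; first exact: exprn_ge0.
    apply: ler_wpM2l => //; apply: lerXn2r => //; rewrite nnegrE ?(ltW th0)//.
    by rewrite exprn_ge0// ltW.
  rewrite -exprM mulnC exprM exprSr; move: (kr k) rk; move: (r ^+ k) => p kp p0.
  have -> : k%:R ^+ m * (A * (p ^+ m * p)) = p * (A * (k%:R * p) ^+ m).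
    by rewrite exprMn; move: (k%:R ^+ m) (p ^+ m) => a b; ring.
  apply: ler_wpM2l => //; apply: ler_wpM2l => //.
  by apply: lerXn2r; rewrite ?nnegrE ?mulr_ge0 ?invr_ge0 ?(ltW y0).
apply: ler_pM => //; first by rewrite ltW// NP.
by rewrite lerDl.
Qed.

Lemma powR_small (s c : R) : 0 < s -> 0 < c -> exists2 e, 0 < e &
  forall x, 0 <= x <= e -> x `^ s <= c.
Proof.
move=> s0 c0; exists (c `^ s^-1); first by rewrite powR_gt0.
move=> x /andP[x0 xe].
have := ge0_ler_powR (ltW s0) x0 (powR_ge0 c s^-1) xe.
by rewrite -powRrM mulVf ?gt_eqF// powRr1// ltW.
Qed.

Lemma growthM s k (x : R) : 0 <= x ->
  growth s k * x `^ s = (k%:R * ln (k.+1%:R : R) ^+ 2 * x) `^ s.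
Proof. by move=> x0; rewrite /growth -powRM// mulr_ge0// sqr_ge0. Qed.

Lemma growth_sqrM s k (x : R) : 0 <= x ->
  growth s k ^+ 2 * x `^ (2 * s) = (k%:R * ln (k.+1%:R : R) ^+ 2 * x) `^ (2 * s).
Proof.
move=> x0; rewrite powRM//; last by rewrite mulr_ge0// sqr_ge0.
by rewrite /growth -powR_mulrn ?powR_ge0// -powRrM (mulrC s).
Qed.

Lemma geometric_beats_log (X : nat -> R) (A th : R) N0 : 0 <= A -> 0 < th < 1 ->
  (forall k, 0 <= X k) -> (forall k, (N0 <= k)%N -> X k ^+ 2 <= A * th ^+ k) ->
  forall e, 0 < e -> exists N, forall k, (N <= k)%N ->
    k%:R * ln (k.+1%:R : R) ^+ 2 * X k <= e.
Proof.
move=> A0 th01 X0 XA e e0.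
have [|N NP] := @geometric_beats_power A th 6 A0 th01 (e ^+ 2); first by rewrite exprn_gt0.
exists (maxn N N0) => k; rewrite geq_max => /andP[Nk N0k].
have lk : ln (k.+1%:R : R) <= k%:R.
  by rewrite -natr1 addrC le_ln1Dx// (lt_le_trans (ltrN10 _)).
have l0 : 0 <= ln (k.+1%:R : R) by rewrite ln_ge0// ler1n.
apply: (@le_trans _ _ (k%:R ^+ 3 * X k)).
  rewrite ler_wpM2r// (exprS _ 2) ler_wpM2l//.
  by apply: lerXn2r; rewrite ?nnegrE.
rewrite -(@ler_pXn2r _ 2)// ?nnegrE ?mulr_ge0 ?exprn_ge0 ?(ltW e0)//.
apply: le_trans (NP k Nk); rewrite exprMn -exprM; apply: ler_wpM2l; last exact: XA.
by rewrite exprn_ge0.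
Qed.

(** Nonnegativity of [G] turns its decrease into [c * Y k <= G k], and
    [G k <= C * Y k] turns the same decrease into a contraction of [G]. *)
Lemma geometric_decay (G Y : nat -> R) (c C : R) N : 0 < c -> 0 <= C ->
  (forall k, 0 <= G k) ->
  (forall k, (N <= k)%N -> G k.+1 <= G k - c * Y k) ->
  (forall k, (N <= k)%N -> G k <= C * Y k) -> (forall k, 0 <= Y k) ->
  exists A th, [/\ 0 <= A, 0 < th < 1 & forall k, (N <= k)%N -> Y k <= A * th ^+ k].
Proof.
move=> c0 C0 G0 Gdec GC Y0.
have D0 : 0 < C + 2 * c by lra.
pose th := 1 - c / (C + 2 * c).
have t0 : 0 < th.
  by rewrite subr_gt0 ltr_pdivrMr// mul1r; lra.
have t1 : th < 1 by rewrite gtrBl divr_gt0.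
have dec k : (N <= k)%N -> G k.+1 <= th * G k.
  move=> Nk; apply: le_trans (Gdec k Nk) _.
  rewrite /th mulrBl mul1r lerD2l lerN2 mulrAC ler_pdivrMr//.
  rewrite -mulrA ler_pM2l//; apply: le_trans (GC k Nk) _.
  by rewrite mulrC ler_wpM2l//; lra.
have iter j : G (N + j)%N <= th ^+ j * G N.
  elim: j => [|j IH]; first by rewrite addn0 expr0 mul1r.
  rewrite addnS exprS -mulrA; apply: le_trans (dec _ (leq_addr _ _)) _.
  by rewrite ler_pM2l.
exists (G N / (c * th ^+ N)), th; split => //.
- by rewrite divr_ge0// mulr_ge0 ?exprn_ge0// ltW.
- by rewrite t0.
- move=> k Nk; have := iter (k - N)%N; rewrite subnKC// => Gk.
  have tN : 0 < th ^+ N by rewrite exprn_gt0.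
  have -> : G N / (c * th ^+ N) * th ^+ k = th ^+ (k - N) * G N / c.
    rewrite -{1}(subnKC Nk) exprD; move: (th ^+ (k - N)) => p.
    by field; rewrite !gt_eqF.
  rewrite ler_pdivlMr// mulrC; apply: le_trans Gk.
  by have := Gdec k Nk; have := G0 k.+1; lra.
Qed.

End Decay.

(** * The normal map and the composite objective *)

Section Composite.
Variables (R : realType) (n : nat) (f : 'cV[R]_n -> R) (phi : 'cV[R]_n -> \bar R).
Variables (lam L : R).
Hypothesis f_C1 : C1 f.
Hypothesis phi_proper : eproper phi.
Hypothesis phi_lsc : lower_semicontinuous phi.
Hypothesis phi_convex : econvex phi.
Hypothesis lam_gt0 : 0 < lam.
Hypothesis L_ge0 : 0 <= L.
Hypothesis grad_lip : elipschitz_on L (edom phi) (grad f).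
Implicit Types x y z w u v : 'cV[R]_n.

Local Notation prx := (prox lam phi).
Local Notation pval := (prox_val phi lam).
Local Notation F := (Fnor lam f phi).

Let prox_dom z : edom phi (prx z).
Proof. exact: prox_edom. Qed.

Lemma edom_segment x y t : edom phi x -> edom phi y -> 0 <= t <= 1 ->
  edom phi (x + t *: (y - x)).
Proof.
move=> xd yd t01.
have -> : x + t *: (y - x) = t *: y + (1 - t) *: x.
  by rewrite scalerBr scalerBl scale1r addrCA.
rewrite /edom /=; apply: le_lt_trans (phi_convex y x t01) _.
move: xd yd; rewrite /edom /=; case: phi_proper => + _ => phiN.
have := phiN x; have := phiN y.
by case: (phi x) => // a; case: (phi y) => // b _ _ _ _; rewrite -!EFinM -EFinD ltry.
Qed.

Lemma taylor1_bound x y : edom phi x -> edom phi y ->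
  `|f y - f x - dotv (grad f x) (y - x)| <= L * enorm (y - x) ^+ 2.
Proof.
move=> xd yd.
have [|c /andP[c0 c1]] := @mean_value_unit _ (fun t => f (x + t *: (y - x)))
    (fun t => dotv (grad f (x + t *: (y - x))) (y - x)) 1 ltr01.
  by move=> s _; apply: is_derive_line; exact: (proj1 f_C1).
rewrite scale0r addr0 scale1r [x + (y - x)]addrC subrK mulr1 => ->.
rewrite -dotvNl -dotvDl; apply: le_trans (cauchy_schwarz_norm _ _) _.
rewrite expr2 mulrA; apply: ler_wpM2r; first exact: enorm_ge0.
have cd : edom phi (x + c *: (y - x)) by apply: edom_segment => //; rewrite !ltW.
apply: le_trans (grad_lip cd xd) _.
apply: ler_wpM2l => //; rewrite addrAC subrr add0r enormZ gtr0_norm//.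
by rewrite ler_piMl ?enorm_ge0// ltW.
Qed.

Lemma FnorB z w : F z - F w = (grad f (prx z) - grad f (prx w))
  + lam^-1 *: ((z - w) - (prx z - prx w)).
Proof.
rewrite /Fnor; move: (prx z) (prx w) (grad f _) (grad f _) => a b c d.
by apply/colP => i; rewrite !mxE; ring.
Qed.

Lemma Fnor_lip z w : enorm (F z - F w) <= (L + lam^-1 * 2) * enorm (z - w).
Proof.
rewrite FnorB mulrDl; apply: le_trans (enormD _ _) _; apply: lerD.
  apply: le_trans (grad_lip (prox_dom z) (prox_dom w)) _.
  by apply: ler_wpM2l => //; exact: prox_nonexpansive.
rewrite enormZ gtr0_norm ?invr_gt0// -mulrA; apply: ler_wpM2l.
  by rewrite invr_ge0 ltW.
rewrite mulr2n mulrDl mul1r; apply: le_trans (enormB _ _) _.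
by rewrite lerD2l prox_nonexpansive.
Qed.

(** Composite objective along the range of the proximal mapping; real-valued,
    which keeps the merit estimates free of extended reals. *)
Definition psi_val z : R := f (prx z) + pval z.

Lemma psi_valE z : psi f phi (prx z) = (psi_val z)%:E.
Proof. by rewrite /psi (prox_valE phi_proper phi_lsc phi_convex lam_gt0). Qed.

Lemma meritE tau z :
  merit lam f phi tau z = (psi_val z + tau * lam / 2 * enorm (F z) ^+ 2)%:E.
Proof. by rewrite /merit psi_valE. Qed.

(** The subgradient of [phi] is taken at the new point [prx w]; this is what
    produces the negative quadratic term. *)
Lemma psi_val_step z w (U : R) :
  f (prx w) - f (prx z) - dotv (grad f (prx z)) (prx w - prx z) <= U ->
  psi_val w - psi_val z <= dotv (F z + lam^-1 *: (w - z)) (prx w - prx z)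
    - lam^-1 * enorm (prx w - prx z) ^+ 2 + U.
Proof.
move=> HU; have := prox_val_ge phi_proper phi_lsc phi_convex lam_gt0 w z.
move: HU; rewrite /psi_val /Fnor.
move: (prx z) (prx w) (grad f _) (f _) (f _) (pval _) (pval _) => p q g a b c d.
rewrite !dotvE enorm_sqr !dotvE (dotvC q p).
by lra.
Qed.

Lemma psi_val_upper z w : psi_val z - psi_val w <=
  enorm (F z) * enorm (prx z - prx w) + L * enorm (prx z - prx w) ^+ 2.
Proof.
have h1 := prox_val_ge phi_proper phi_lsc phi_convex lam_gt0 z w.
have := taylor1_bound (prox_dom z) (prox_dom w); rewrite ler_norml => /andP[h2 _].
have h3 := cauchy_schwarz (F z) (prx z - prx w).
have h4 : dotv (F z) (prx z - prx w) =
    - dotv (grad f (prx z)) (prx w - prx z) - lam^-1 * dotv (z - prx z) (prx w - prx z).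
  rewrite /Fnor; move: (prx z) (prx w) (grad f _) => p q g.
  by rewrite !dotvE; ring.
rewrite h4 in h3; rewrite (enormC (prx w)) in h2.
rewrite /psi_val; move: h1 h2 h3; clear.
move: (dotv _ _) (dotv _ _) (enorm _) (enorm _) (f _) (f _) (pval _) (pval _).
by move=> a b c d e f1 g h; lra.
Qed.

End Composite.

(** * Acceptance of small steps by the linesearch *)

Section Linesearch.
Variable R : realType.

(** The scalar core of the descent estimate.  Firm nonexpansiveness makes
    [<F, p - x>] at most [- V^2 / (lam * alpha)] up to second order terms, and
    the choice of [tau] lets this quantity absorb the cross term
    [tau * lam * Lt * V * chi]; whatever remains is of order [alpha^2]. *)
Lemma linesearch_scalar (al lam tau Lt Lm C chi V Fv ev nw dpsi F2 gam nu sig : R) :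
  0 < al <= 1 -> 0 < lam -> 0 < tau -> 0 <= Lt <= Lm -> 0 <= C -> 0 <= chi ->
  0 <= V -> 0 < gam < 1 -> 0 <= nu < 1 ->
  V ^+ 2 <= lam * al * (al * ev - Fv) ->
  ev <= C * chi * V ->
  dpsi <= ((1 - al) * Fv + al ^+ 2 * ev) - lam^-1 * V ^+ 2 + Lt * V ^+ 2 / 2 ->
  F2 <= nw ^+ 2 + 2 * (nw * (Lt * V)) - 2 * lam^-1 * ((1 - al) * Fv + al ^+ 2 * ev)
    + (Lt * V + lam^-1 * V) ^+ 2 ->
  0 <= nw <= (1 - al) * chi + al ^+ 2 * (C * chi) ->
  V <= al * lam * ((1 + C) * chi) ->
  tau * (Lt ^+ 2 * lam ^+ 2 + 2) <= 2 * gam * (1 - nu) ->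
  (lam * (C * (1 + C)) + Lm / 2 * (lam * (1 + C)) ^+ 2
    + lam / 2 * ((Lm + lam^-1) * (lam * (1 + C))) ^+ 2
    + lam * C * Lm * (lam * (1 + C)) + lam / 2 * (1 + C) ^+ 2) * al
    <= (1 - sig) * tau * lam / 2 ->
  dpsi + tau * lam / 2 * (F2 - chi ^+ 2) <=
    - (sig * lam * tau * al / 2 * chi ^+ 2) - nu / (lam * al) * V ^+ 2.
Proof.
move=> /andP[al0 al1] lam0 tau0 /andP[Lt0 LtLm] C0 chi0 V0 /andP[gam0 gam1]
  /andP[nu0 nu1] firm evb dpsib F2b /andP[nw0 nwb] Vb taub small.
set w := (1 - al) * Fv + al ^+ 2 * ev in dpsib F2b.
set V2 := V ^+ 2 in firm dpsib *.
have V20 : 0 <= V2 by rewrite exprn_ge0.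
pose Q := V2 / (lam * al).
have la0 : 0 < lam * al by rewrite mulr_gt0.
have V2E : V2 = Q * (lam * al) by rewrite /Q divfK// gt_eqF.
have Q0 : 0 <= Q by rewrite divr_ge0// ltW.
have firm' : Q <= al * ev - Fv by rewrite /Q ler_pdivrMr// mulrC.
have tau1 : tau <= gam * (1 - nu).
  have : 0 <= tau * (Lt ^+ 2 * lam ^+ 2).
    by rewrite mulr_ge0 ?mulr_ge0 ?sqr_ge0// ltW.
  by move: taub; lra.
have gnu : gam * (1 - nu) <= 1 - nu by rewrite ler_piMl ?ltW//; lra.
have gnu' : nu <= 1 - gam * (1 - nu) by lra.
have tau2 : tau <= 1 by lra.
have tau2' : 0 <= 1 - tau by lra.
have C1 : 0 <= 1 + C by lra.
have wb : w <= - Q + Q * al + al * (C * chi * V).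
  have h1 : (1 - al) * Fv <= (1 - al) * (al * ev - Q).
    by apply: ler_wpM2l; lra.
  have h2 : al * ev <= al * (C * chi * V) by rewrite ler_pM2l.
  by rewrite /w; lra.
have lamV2 : lam^-1 * V2 = Q * al.
  by rewrite V2E; field; rewrite gt_eqF.
have s1 : al * (C * chi * V) <= al ^+ 2 * (lam * (C * (1 + C)) * chi ^+ 2).
  have : C * chi * V <= C * chi * (al * lam * ((1 + C) * chi)).
    by apply: ler_wpM2l => //; rewrite mulr_ge0.
  move/(ler_wpM2l (ltW al0)) => h; apply: le_trans h _.
  by rewrite le_eqVlt; apply/orP; left; apply/eqP; ring.
have Lm0 : 0 <= Lm by lra.
have Vb0 : 0 <= al * lam * ((1 + C) * chi) by apply: le_trans Vb.
have V2b : V2 <= (al * lam * ((1 + C) * chi)) ^+ 2.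
  by rewrite /V2 ler_pXn2r// nnegrE.
have s2 : Lt * V2 / 2 <= al ^+ 2 * (Lm / 2 * (lam * (1 + C)) ^+ 2 * chi ^+ 2).
  have : Lt * V2 <= Lm * (al * lam * ((1 + C) * chi)) ^+ 2 by apply: ler_pM.
  by lra.
have li0 : 0 < lam^-1 by rewrite invr_gt0.
have s3 : (Lt * V + lam^-1 * V) ^+ 2 <=
    al ^+ 2 * (((Lm + lam^-1) * (lam * (1 + C))) ^+ 2 * chi ^+ 2).
  have h0 : 0 <= Lt * V + lam^-1 * V.
    by rewrite addr_ge0// mulr_ge0// ltW.
  have h1 : Lt * V + lam^-1 * V <= (Lm + lam^-1) * (al * lam * ((1 + C) * chi)).
    rewrite -mulrDl; apply: ler_pM => //; last by lra.
    by rewrite addr_ge0// ltW.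
  have : (Lt * V + lam^-1 * V) ^+ 2 <=
      ((Lm + lam^-1) * (al * lam * ((1 + C) * chi))) ^+ 2.
    by rewrite ler_pXn2r// nnegrE// (le_trans h0 h1).
  by move=> h; apply: le_trans h _; rewrite le_eqVlt; apply/orP; left; apply/eqP; ring.
have Cchi0 : 0 <= C * chi by rewrite mulr_ge0.
have nwb' : nw <= chi + al * (C * chi).
  have : 0 <= al * chi by rewrite mulr_ge0// ltW.
  have : al ^+ 2 * (C * chi) <= al * (C * chi).
    by rewrite ler_wpM2r// expr2 ler_piMl// ltW.
  by lra.
have s4 : nw * (Lt * V) <= chi * (Lt * V)
    + al ^+ 2 * (C * Lm * (lam * (1 + C)) * chi ^+ 2).
  have LV0 : 0 <= Lt * V by rewrite mulr_ge0.
  have h1 : nw * (Lt * V) <= (chi + al * (C * chi)) * (Lt * V) by rewrite ler_wpM2r.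
  have h2 : Lt * V <= Lm * (al * lam * ((1 + C) * chi)) by apply: ler_pM.
  have h3 : al * (C * chi) * (Lt * V) <=
      al * (C * chi) * (Lm * (al * lam * ((1 + C) * chi))).
    by apply: ler_wpM2l => //; rewrite mulr_ge0// ltW.
  by lra.
have s5 : nw ^+ 2 <= chi ^+ 2 - 2 * al * chi ^+ 2 + al ^+ 2 * ((1 + C) ^+ 2 * chi ^+ 2).
  have : nw ^+ 2 <= ((1 - al) * chi + al ^+ 2 * (C * chi)) ^+ 2.
    by rewrite ler_pXn2r// nnegrE// (le_trans nw0 nwb).
  move/le_trans; apply.
  have -> : ((1 - al) * chi + al ^+ 2 * (C * chi)) ^+ 2 =
    (1 - 2 * al + al ^+ 2 + 2 * ((1 - al) * al ^+ 2) * C + al ^+ 4 * C ^+ 2) * chi ^+ 2.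
    by ring.
  have -> : chi ^+ 2 - 2 * al * chi ^+ 2 + al ^+ 2 * ((1 + C) ^+ 2 * chi ^+ 2) =
    (1 - 2 * al + al ^+ 2 + 2 * al ^+ 2 * C + al ^+ 2 * C ^+ 2) * chi ^+ 2 by ring.
  apply: ler_wpM2r; first exact: sqr_ge0.
  have a20 : 0 <= al ^+ 2 by rewrite sqr_ge0.
  have a21 : al ^+ 2 <= 1 by rewrite expr_le1// ltW.
  have h1 : 0 <= al * al ^+ 2 * C by rewrite mulr_ge0 ?mulr_ge0// ltW.
  have h2 : al ^+ 4 * C ^+ 2 <= al ^+ 2 * C ^+ 2.
    rewrite ler_wpM2r ?sqr_ge0// (_ : al ^+ 4 = al ^+ 2 * al ^+ 2); last by ring.
    by rewrite ler_piMr.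
  by lra.
(* Young's inequality for the cross term *)
have s6 : tau * lam * (chi * (Lt * V)) <=
    (gam * (1 - nu) - tau) * Q + tau * lam * al / 2 * chi ^+ 2.
  have y : chi * (Lt * V) <= (Lt ^+ 2 * (V2 / al) + al * chi ^+ 2) / 2.
    rewrite -(ler_pM2l al0).
    have : 0 <= (Lt * V - al * chi) ^+ 2 by rewrite sqr_ge0.
    have -> : al * ((Lt ^+ 2 * (V2 / al) + al * chi ^+ 2) / 2) =
      (Lt ^+ 2 * V2 + al ^+ 2 * chi ^+ 2) / 2.
      by field; rewrite gt_eqF.
    by rewrite /V2; clear; lra.
  have tl0 : 0 <= tau * lam by rewrite mulr_ge0// ltW.
  have := ler_wpM2l tl0 y.
  have -> : tau * lam * ((Lt ^+ 2 * (V2 / al) + al * chi ^+ 2) / 2) =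
     (tau * (Lt ^+ 2 * lam ^+ 2) / 2) * Q + tau * lam * al / 2 * chi ^+ 2.
    by rewrite /Q; field; rewrite !gt_eqF.
  have : tau * (Lt ^+ 2 * lam ^+ 2) / 2 * Q <= (gam * (1 - nu) - tau) * Q.
    by rewrite ler_wpM2r//; move: taub; clear; lra.
  by clear; lra.
set A := chi ^+ 2 in s1 s2 s3 s4 s5 s6 *.
have A0 : 0 <= A by rewrite sqr_ge0.
have s7 := ler_wpM2r (mulr_ge0 (ltW al0) A0) small.
have tl : 0 < tau * lam by rewrite mulr_gt0.
have tl2 : 0 <= tau * lam / 2 by rewrite divr_ge0// ltW.
have t1 : dpsi + tau * lam / 2 * (F2 - A) <=
   (1 - tau) * w - Q * al + Lt * V2 / 2 +
   tau * lam / 2 * (nw ^+ 2 - A + 2 * (nw * (Lt * V)) + (Lt * V + lam^-1 * V) ^+ 2).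
  have h := ler_wpM2l tl2 F2b.
  have h' : tau * lam / 2 * (2 * lam^-1 * w) = tau * w.
    by field; rewrite gt_eqF.
  by move: dpsib; rewrite lamV2; move: h h'; clear; lra.
have t2 : (1 - tau) * w <= - (1 - tau) * Q + Q * al
    + al ^+ 2 * (lam * (C * (1 + C)) * A).
  have h1 : (1 - tau) * w <= (1 - tau) * (- Q + Q * al + al * (C * chi * V)).
    exact: ler_wpM2l.
  have h2 : 0 <= tau * (Q * al).
    by apply: mulr_ge0; [exact: ltW|apply: mulr_ge0 => //; exact: ltW].
  have h3 : 0 <= tau * (al * (C * chi * V)).
    apply: mulr_ge0; first exact: ltW.
    by apply: mulr_ge0; [exact: ltW|exact: mulr_ge0].
  by move: h1 h2 h3 s1; clear; lra.
have lamtau z : 0 <= z -> tau * lam / 2 * z <= lam / 2 * z.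
  move=> z0; rewrite ler_wpM2r//; rewrite ler_pM2r ?invr_gt0//.
  by rewrite ler_piMl// ltW.
have al2 : 0 <= al ^+ 2 by rewrite sqr_ge0.
have p1 : 0 <= al ^+ 2 * (((Lm + lam^-1) * (lam * (1 + C))) ^+ 2 * A).
  by rewrite mulr_ge0// mulr_ge0// sqr_ge0.
have p2 : 0 <= al ^+ 2 * (C * Lm * (lam * (1 + C)) * A).
  rewrite mulr_ge0// mulr_ge0// mulr_ge0//; first exact: mulr_ge0.
  by rewrite mulr_ge0// ltW.
have p3 : 0 <= al ^+ 2 * ((1 + C) ^+ 2 * A).
  by rewrite mulr_ge0// mulr_ge0// sqr_ge0.
have q1 := lamtau _ p1; have q2 := lamtau _ p2; have q3 := lamtau _ p3.
have r3 := ler_wpM2l tl2 s3; have r4 := ler_wpM2l tl2 s4; have r5 := ler_wpM2l tl2 s5.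
have nuQ : nu / (lam * al) * V2 = nu * Q by rewrite /Q mulrAC mulrA.
have fin : nu * Q <= (1 - gam * (1 - nu)) * Q by rewrite ler_wpM2r.
rewrite nuQ.
by move: s2 s6 s7 t1 t2 q1 q2 q3 r3 r4 r5 fin; clear; lra.
Qed.

End Linesearch.
(** * Global behaviour of the iterates *)

(** Inner products of the step [s], of [w = F0 + s / lam] and of the new normal
    map value [F1], where [v] and [g] are the increments of the proximal point
    and of the gradient. *)
Lemma step_vectors (R : realType) n (F1 F0 e v g s w : 'cV[R]_n) (lam al : R) :
  0 < lam -> s = (al * lam) *: (- F0 + al *: e) -> w = F0 + lam^-1 *: s ->
  F1 = F0 + (g + lam^-1 *: (s - v)) ->
  [/\ w = (1 - al) *: F0 + al ^+ 2 *: e,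
      dotv w v = (1 - al) * dotv F0 v + al ^+ 2 * dotv e v,
      dotv v s = lam * al * (al * dotv e v - dotv F0 v) &
      enorm F1 ^+ 2 = enorm w ^+ 2 + 2 * dotv w g - 2 * lam^-1 * dotv w v
        + enorm (g - lam^-1 *: v) ^+ 2].
Proof.
move=> lam0 sE wE F1E.
have wE' : w = (1 - al) *: F0 + al ^+ 2 *: e.
  rewrite wE sE scalerA mulrCA mulVf ?gt_eqF// mulr1.
  by apply/colP => i; rewrite !mxE; ring.
split => //.
- by rewrite wE' !dotvE.
- by rewrite dotvC sE !dotvE; ring.
- have -> : F1 = w + (g - lam^-1 *: v).
    by rewrite F1E wE; apply/colP => i; rewrite !mxE; ring.
  move: (w) => w'; rewrite !enorm_sqr !dotvE (dotvC g w') (dotvC v w') (dotvC v g).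
  by ring.
Qed.

Lemma merit_regroup (R : realDomainType) (a b c d t e : R) :
  (a - b) + t * (c - d) <= e -> a + t * c - (b + t * d) <= e.
Proof. by lra. Qed.

Lemma decrease_aux (R : realDomainType) (a a' p p' t d s nu : R) :
  a <= a' -> d <= s -> 0 <= nu -> p + a' - (p' + t) <= - s - nu ->
  p + a <= p' + t - d.
Proof. by lra. Qed.

Section Algorithm.
Variables (R : realType) (n : nat).
Variables (f : 'cV[R]_n -> R) (phi : 'cV[R]_n -> \bar R).
Variables (P : params R n) (I : iterates R n).
Variables (L : R).
Hypothesis f_C1 : C1 f.
Hypothesis phi_proper : eproper phi.
Hypothesis phi_lsc : lower_semicontinuous phi.
Hypothesis phi_convex : econvex phi.
Hypothesis P_valid : valid_params P.
Hypothesis I_gen : generated P f phi I.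
Hypothesis L_ge0 : 0 <= L.
Hypothesis grad_lip : elipschitz_on L (edom phi) (grad f).

Local Notation lam := (par_lam P).
Local Notation prx := (prox lam phi).
Local Notation z := (it_z I).
Local Notation F := (Fnor lam f phi).
Local Notation psiv := (psi_val f phi lam).

Let lam_gt0 : 0 < lam. Proof. by case: P_valid => _ []. Qed.
Let Lbar_gt0 : 0 < par_Lbar P. Proof. by case: P_valid => _ []. Qed.
Let tau0_gt0 : 0 < par_tau0 P. Proof. by case: P_valid => _ []. Qed.
Let rho01 : 0 < par_rho P < 1. Proof. by case: P_valid => _ _ []. Qed.
Let sigma01 : 0 < par_sigma P < 1. Proof. by case: P_valid => _ _ []. Qed.
Let gamma01 : 0 < par_gamma P < 1. Proof. by case: P_valid => _ _ []. Qed.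
Let nu01 : 0 < par_nu P < 1. Proof. by case: P_valid => _ _ []. Qed.
Let rho_gt0 : 0 < par_rho P. Proof. by case/andP: rho01. Qed.

(** Treats both kinds of step at once: a first order step is a step with zero
    correction. *)
Definition used_e k : 'cV[R]_n :=
  if second_order P f phi I k then it_e P f phi I k else 0.

Lemma it_stepE k al :
  it_step P f phi I k al = (al * lam) *: (- F (z k) + al *: used_e k).
Proof.
by rewrite /it_step /used_e; case: ifP; rewrite ?scaler0 ?addr0.
Qed.

Lemma it_alpha_gt0 k : 0 < it_alpha P I k.
Proof. by rewrite exprn_gt0. Qed.

Lemma it_alpha_le1 k : it_alpha P I k <= 1.
Proof. by rewrite exprn_ile1 ?ltW//; case/andP: rho01. Qed.

Lemma trial_z_accepted k : trial_z P f phi I k (it_t I k) = z k.+1.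
Proof. by rewrite (gen_next I_gen). Qed.

Lemma acceptE k t : let tau := trial_tau P f phi I k t in
  let al := par_rho P ^+ t in
  accept P f phi I k t <->
  psiv (trial_z P f phi I k t) + tau * lam / 2 * enorm (F (trial_z P f phi I k t)) ^+ 2
    - (psiv (z k) + tau * lam / 2 * enorm (F (z k)) ^+ 2) <=
  - (par_sigma P * lam * tau * al / 2 * enorm (F (z k)) ^+ 2)
    - trial_nu P f phi I k t / (lam * al) *
      enorm (trial_x P f phi I k t - it_x P phi I k) ^+ 2.
Proof.
move=> tau al; rewrite /accept.
by rewrite !(meritE f phi_proper phi_lsc phi_convex lam_gt0) -EFinB lee_fin.
Qed.

(** Bounds all local Lipschitz estimates of the linesearch; the factor 2 pays
    for the first order Taylor bound, whose constant is [L] rather than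
    [L / 2]. *)
Definition Lmax := Num.max (2 * L) (par_Lbar P).

Lemma Lmax_gt0 : 0 < Lmax.
Proof. by rewrite lt_max Lbar_gt0 orbT. Qed.

Lemma trial_L_bounds k t :
  let x := it_x P phi I k in let y := trial_x P f phi I k t in
  let Lt := trial_L P f phi I k t in
  [/\ 0 <= Lt <= Lmax,
      f y - f x - dotv (grad f x) (y - x) <= Lt * enorm (y - x) ^+ 2 / 2 &
      enorm (grad f y - grad f x) <= Lt * enorm (y - x)].
Proof.
move=> x y Lt.
have xd : edom phi x by exact: prox_edom.
have yd : edom phi y by exact: prox_edom.
have U := taylor1_bound f_C1 phi_proper phi_convex L_ge0 grad_lip xd yd.
have W := grad_lip yd xd.
rewrite /Lt /trial_L -/x -/y.
have [V0|V0] /= := eqVneq (enorm (y - x)) 0.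
  rewrite V0 expr0n !mulr0 in U W *.
  rewrite mul0r; split => //.
    by rewrite (ltW Lbar_gt0) /Lmax le_max lexx orbT.
  exact: le_trans (ler_norm _) U.
have Vgt : 0 < enorm (y - x) by rewrite lt_neqAle eq_sym V0 enorm_ge0.
set V := enorm (y - x) in U W V0 Vgt *.
have V2 : 0 < V ^+ 2 by rewrite exprn_gt0.
split.
- apply/andP; split; first by rewrite le_max; apply/orP; right; rewrite divr_ge0 ?enorm_ge0.
  rewrite /Lmax le_max ge_max ler_pdivrMr//; apply/orP; left.
  apply/andP; split.
    by rewrite -mulrA ler_pM2l// (le_trans (ler_norm _) U).
  rewrite ler_pdivrMr// (le_trans W)// ler_wpM2r ?(ltW Vgt)//.
  by rewrite mulr_natl mulr2n lerDl.
- rewrite ler_pdivlMr// mulrC -ler_pdivrMr//.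
  by rewrite le_max lexx.
- by rewrite -ler_pdivrMr// le_max lexx orbT.
Qed.

Lemma trial_nu_bounds k t : 0 <= trial_nu P f phi I k t <= par_nu P.
Proof.
rewrite /trial_nu ge_min lexx /= le_min; case/andP: nu01 => nu0 _.
by rewrite (ltW nu0) mulr_ge0 ?sqr_ge0 ?powR_ge0 //.
Qed.

Definition tau_min := Num.min
  (2 * par_gamma P * (1 - par_nu P) / (Lmax ^+ 2 * lam ^+ 2 + 2)) (par_tau0 P).

Lemma tau_min_gt0 : 0 < tau_min.
Proof.
case/andP: nu01 => _ nu1; case/andP: gamma01 => gam0 _.
rewrite lt_min tau0_gt0 andbT divr_gt0//.
  by rewrite mulr_gt0 ?mulr_gt0// subr_gt0.
by rewrite ltr_wpDl// mulr_ge0// sqr_ge0.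
Qed.

Lemma trial_tau_ge k t : tau_min <= prev_tau P I k -> tau_min <= trial_tau P f phi I k t.
Proof.
move=> h; rewrite /trial_tau le_min h andbT.
have [/andP[Lt0 LtL] _ _] := trial_L_bounds k t.
have /andP[nt0 nt1] := trial_nu_bounds k t.
case/andP: nu01 => _ nu1; case/andP: gamma01 => gam0 _.
apply: (@le_trans _ _ (2 * par_gamma P * (1 - par_nu P) / (Lmax ^+ 2 * lam ^+ 2 + 2))).
  by rewrite ge_min lexx.
have pos (a : R) : 0 < a ^+ 2 * lam ^+ 2 + 2.
  by rewrite ltr_wpDl// mulr_ge0// sqr_ge0.
apply: ler_pM.
- by rewrite mulr_ge0 ?mulr_ge0 ?(ltW gam0)// subr_ge0 ltW.
- by rewrite invr_ge0 ltW.
- by rewrite ler_pM2l ?mulr_gt0// lerD2l lerN2.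
- rewrite lef_pV2 ?posrE// lerD2r ler_wpM2r ?sqr_ge0//.
  by rewrite ler_pXn2r// ?nnegrE// (le_trans Lt0).
Qed.

Lemma prev_tau_ge k : tau_min <= prev_tau P I k.
Proof.
elim: k => [|k IH]; first by rewrite /tau_min ge_min lexx orbT.
by rewrite /= (gen_tau I_gen) trial_tau_ge.
Qed.

Lemma it_tau_ge k : tau_min <= it_tau I k.
Proof. exact: (prev_tau_ge k.+1). Qed.

Lemma it_tau_noninc k : it_tau I k.+1 <= it_tau I k.
Proof. by rewrite (gen_tau I_gen) /trial_tau ge_min lexx orbT. Qed.

Lemma trial_tau_le k t : trial_tau P f phi I k t <= par_tau0 P.
Proof.
have prev j : prev_tau P I j <= par_tau0 P.
  elim: j => //= j IH; rewrite (gen_tau I_gen) (le_trans _ IH)//.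
  by rewrite /trial_tau ge_min lexx orbT.
by rewrite (le_trans _ (prev k))// /trial_tau ge_min lexx orbT.
Qed.

Lemma trial_tau_bound k t :
  trial_tau P f phi I k t * (trial_L P f phi I k t ^+ 2 * lam ^+ 2 + 2)
    <= 2 * par_gamma P * (1 - trial_nu P f phi I k t).
Proof.
rewrite -ler_pdivlMr; first by rewrite /trial_tau ge_min lexx.
by rewrite ltr_wpDl// mulr_ge0// sqr_ge0.
Qed.

Lemma trial_firm k t : enorm (trial_x P f phi I k t - it_x P phi I k) ^+ 2 <=
  dotv (trial_x P f phi I k t - it_x P phi I k) (it_step P f phi I k (par_rho P ^+ t)).
Proof.
have := prox_firm phi_proper phi_lsc phi_convex lam_gt0 (trial_z P f phi I k t) (z k).
by rewrite {3}/trial_z (addrC (z k)) addrK.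
Qed.

(** The remainder of the descent estimate is at most [K1 * alpha^2 * chi^2] with
    [K1] depending only on [C], [lam] and [Lmax], while the slack in the
    acceptance test is at least [(1 - sigma) * tau_min * lam * alpha * chi^2 / 2];
    hence the threshold for [alpha] is independent of the iteration. *)
Lemma accept_small_step (C : R) : 0 <= C -> exists2 a, 0 < a &
  forall k t, enorm (used_e k) <= C * enorm (F (z k)) ->
    par_rho P ^+ t <= a -> accept P f phi I k t.
Proof.
move=> C0; have Lm0 := Lmax_gt0.
set K1 := lam * (C * (1 + C)) + Lmax / 2 * (lam * (1 + C)) ^+ 2
    + lam / 2 * ((Lmax + lam^-1) * (lam * (1 + C))) ^+ 2
    + lam * C * Lmax * (lam * (1 + C)) + lam / 2 * (1 + C) ^+ 2.
have K1_gt0 : 0 < K1.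
  have C1 : 0 < 1 + C by rewrite ltr_wpDr.
  rewrite ltr_wpDl//; last by rewrite mulr_gt0 ?divr_gt0 ?exprn_gt0.
  rewrite addr_ge0//; last by rewrite !mulr_ge0// ltW.
  rewrite addr_ge0//; last by rewrite mulr_ge0 ?divr_ge0 ?exprn_even_ge0// ltW.
  rewrite addr_ge0//; last by rewrite mulr_ge0 ?divr_ge0 ?exprn_even_ge0// ltW.
  by rewrite mulr_ge0 ?mulr_ge0// ltW.
have tm0 := tau_min_gt0; have /andP[sig0 sig1] := sigma01.
exists ((1 - par_sigma P) * tau_min * lam / 2 / K1).
  by rewrite divr_gt0// divr_gt0// mulr_gt0// mulr_gt0// subr_gt0.
move=> k t eC ta; apply/acceptE.
have [] := trial_L_bounds k t.
have taub := trial_tau_bound k t; have taul := trial_tau_ge t (prev_tau_ge k).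
have /andP[nt0 nt1] := trial_nu_bounds k t.
have firm := trial_firm k t.
set tau := trial_tau P f phi I k t in taub taul *.
set Lt := trial_L P f phi I k t in taub *.
set nu := trial_nu P f phi I k t in taub nt0 nt1 *.
set al := par_rho P ^+ t in ta firm *.
set x := it_x P phi I k in firm *; set y := trial_x P f phi I k t in firm *.
set w' := trial_z P f phi I k t.
move=> LtL Ub Wb.
have al01 : 0 < al <= 1.
  by rewrite exprn_gt0//= exprn_ile1 ?ltW//; case/andP: rho01.
have sE := it_stepE k al; set s := it_step P f phi I k al in sE firm.
have wzE : w' - z k = s by rewrite /w' /trial_z addrC addKr.
have pstep := psi_val_step phi_proper phi_lsc phi_convex lam_gt0 Ub.
rewrite -/x -/y wzE in pstep.
have FE : F w' = F (z k) + ((grad f y - grad f x) + lam^-1 *: (s - (y - x))).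
  by rewrite -wzE -(FnorB f phi lam w' (z k)) addrC subrK.
have [wE wv vs F2] := step_vectors lam_gt0 sE erefl FE.
rewrite vs in firm; rewrite wv in pstep.
set g := grad f y - grad f x in Wb F2.
set Fk := F (z k) in eC wE wv vs F2 firm pstep *.
set e := used_e k in eC wE wv vs F2 firm pstep.
set v := y - x in Ub Wb firm pstep wv vs F2 *.
set w := Fk + lam^-1 *: s in wE wv F2.
have nwb : enorm w <= (1 - al) * enorm Fk + al ^+ 2 * (C * enorm Fk).
  case/andP: al01 => al0 al1.
  rewrite wE; apply: le_trans (enormD _ _) _.
  rewrite !enormZ ger0_norm ?subr_ge0// ger0_norm ?sqr_ge0// lerD2l.
  by rewrite ler_wpM2l// sqr_ge0.
have Vb : enorm v <= al * lam * ((1 + C) * enorm Fk).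
  case/andP: al01 => al0 al1.
  have : enorm v <= enorm s.
    by rewrite -wzE; apply: (prox_nonexpansive phi_proper phi_lsc phi_convex lam_gt0).
  have alam : 0 < al * lam by rewrite mulr_gt0.
  move=> /le_trans; apply; rewrite sE enormZ gtr0_norm//.
  apply: ler_wpM2l; first exact: ltW.
  apply: le_trans (enormD _ _) _; rewrite enormN enormZ gtr0_norm// mulrDl mul1r lerD2l.
  by apply: le_trans eC; rewrite ler_piMl// enorm_ge0.
have evb : dotv e v <= C * enorm Fk * enorm v.
  by apply: le_trans (cauchy_schwarz _ _) _; rewrite ler_wpM2r// enorm_ge0.
have wg : dotv w g <= enorm w * (Lt * enorm v).
  by apply: le_trans (cauchy_schwarz _ _) _; rewrite ler_wpM2l// enorm_ge0.
have gv : enorm (g - lam^-1 *: v) ^+ 2 <= (Lt * enorm v + lam^-1 * enorm v) ^+ 2.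
  have h : enorm (g - lam^-1 *: v) <= Lt * enorm v + lam^-1 * enorm v.
    apply: le_trans (enormB _ _) _; rewrite enormZ gtr0_norm ?invr_gt0//.
    by rewrite lerD2r.
  by rewrite ler_pXn2r ?nnegrE ?enorm_ge0// (le_trans (enorm_ge0 _) h).
have tau_gt0 : 0 < tau := lt_le_trans tm0 taul.
have nu01' : 0 <= nu < 1.
  by rewrite nt0; case/andP: nu01 => _; apply: le_lt_trans.
have small : K1 * al <= (1 - par_sigma P) * tau * lam / 2.
  rewrite mulrC -ler_pdivlMr// (le_trans ta)// ler_pM2r ?invr_gt0//.
  rewrite ler_pM2r ?invr_gt0// ler_pM2r// ler_wpM2l// subr_ge0.
  exact: ltW.
have nw0 : 0 <= enorm w <= (1 - al) * enorm Fk + al ^+ 2 * (C * enorm Fk).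
  by rewrite enorm_ge0.
have F2b : enorm (F w') ^+ 2 <= enorm w ^+ 2 + 2 * (enorm w * (Lt * enorm v))
    - 2 * lam^-1 * ((1 - al) * dotv Fk v + al ^+ 2 * dotv e v)
    + (Lt * enorm v + lam^-1 * enorm v) ^+ 2.
  rewrite F2 wv; apply: lerD gv.
  by rewrite lerD2r lerD2l ler_pM2l.
have := linesearch_scalar al01 lam_gt0 tau_gt0 LtL C0 (enorm_ge0 Fk) (enorm_ge0 v)
  gamma01 nu01' firm evb pstep F2b nw0 Vb taub small.
exact: merit_regroup.
Qed.

Lemma alpha_lower_bound (C : R) : 0 <= C -> exists2 a, 0 < a &
  forall k, enorm (used_e k) <= C * enorm (F (z k)) -> a <= it_alpha P I k.
Proof.
move=> C0; have [a a0 aP] := accept_small_step C0.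
have r01 : 0 <= par_rho P < 1 by case/andP: rho01 => /ltW -> ->.
have [N NP] := expr_small r01 a0.
exists (par_rho P ^+ N); first by rewrite exprn_gt0.
move=> k ek; rewrite ler_wiXn2l ?ltW//; first by case/andP: rho01.
rewrite leqNgt; apply/negP => /(gen_first I_gen); apply.
by apply: aP => //; rewrite ltW// NP.
Qed.

(** The merit function at [z k] is taken with the parameter [tau_k] of the step
    leaving [z k]; since [tau] is nonincreasing, this makes it monotone. *)
Definition Hval k := psiv (z k) + it_tau I k * lam / 2 * enorm (F (z k)) ^+ 2.

Definition decrease_rate := par_sigma P * lam * tau_min / 2.

Lemma decrease_rate_gt0 : 0 < decrease_rate.
Proof.
case/andP: sigma01 => sig0 _.
by rewrite divr_gt0// mulr_gt0 ?tau_min_gt0// mulr_gt0.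
Qed.

Lemma Hval_decrease k : Hval k.+1 <=
  Hval k - decrease_rate * it_alpha P I k * enorm (F (z k)) ^+ 2.
Proof.
have /acceptE := gen_accept I_gen k; rewrite trial_z_accepted -(gen_tau I_gen) -/(it_alpha P I k).
have /andP[nt0 _] := trial_nu_bounds k (it_t I k).
have al0 := it_alpha_gt0 k.
have : 0 <= trial_nu P f phi I k (it_t I k) / (lam * it_alpha P I k) *
    enorm (trial_x P f phi I k (it_t I k) - it_x P phi I k) ^+ 2.
  by rewrite mulr_ge0 ?sqr_ge0// divr_ge0// ltW// mulr_gt0.
have tn := it_tau_noninc k; have tl := it_tau_ge k.
case/andP: sigma01 => sig0 _.
have h1 : it_tau I k.+1 * lam / 2 * enorm (F (z k.+1)) ^+ 2 <=
    it_tau I k * lam / 2 * enorm (F (z k.+1)) ^+ 2.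
  by rewrite ler_wpM2r ?sqr_ge0// ler_pM2r ?invr_gt0// ler_pM2r.
have h2 : decrease_rate * it_alpha P I k * enorm (F (z k)) ^+ 2 <=
    par_sigma P * lam * it_tau I k * it_alpha P I k / 2 * enorm (F (z k)) ^+ 2.
  rewrite ler_wpM2r ?sqr_ge0// /decrease_rate mulrAC ler_pM2r ?invr_gt0//.
  by rewrite ler_pM2r// ler_pM2l ?mulr_gt0.
rewrite /Hval; move: h1 h2.
move=> h1 h2 h3 h4; exact: (decrease_aux h1 h2 h3 h4).
Qed.

End Algorithm.
(** * Algebra of the Newton step *)

Section NewtonAlgebra.
Variables (R : realType) (n : nat).
Implicit Types (B D M : 'M[R]_n) (q g h v w : 'cV[R]_n).

(** The normal map step [q - lam * (g + M q)] built from an approximate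
    solution [q] of the symmetrized system solves the Newton equation up to the
    residual of that system. *)
Lemma newton_equation B D M q g (lam : R) : lam != 0 ->
  M = B *m D + lam^-1 *: (1%:M - D) ->
  M *m (q - lam *: (g + M *m q)) =
  - g + (D *m (g + M *m q) - lam *: (B *m (D *m (g + M *m q)))).
Proof.
move=> lam0 ME; set y := g + M *m q.
have My : M *m y = B *m (D *m y) + lam^-1 *: (y - D *m y).
  by rewrite ME mulmxDl -mulmxA -scalemxAl mulmxBl mul1mx.
rewrite mulmxBr -scalemxAr My scalerDr scalerA mulfV// scale1r.
have -> : M *m q = y - g by rewrite /y addrC addKr.
move: (D *m y) => b; move: (B *m b) => a.
by apply/colP => i; rewrite !mxE; ring.
Qed.

(** With [g] and [v] the increments of the gradient and of the proximal point,
    the second bracket is the increment of the normal map over [h]: the Newton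
    model errs by the linearization errors of [prox] and of the gradient. *)
Lemma newton_defect B D M h v g (lam : R) :
  M = B *m D + lam^-1 *: (1%:M - D) ->
  M *m h - (g + lam^-1 *: (h - v)) =
  - (B *m (v - D *m h)) + (B *m v - g) + lam^-1 *: (v - D *m h).
Proof.
move=> ->; rewrite mulmxDl -mulmxA -scalemxAl mulmxBl mul1mx mulmxBr.
move: (D *m h) => w; move: (B *m w) (B *m v) => a b.
by apply/colP => i; rewrite !mxE; ring.
Qed.

Lemma enorm_mulmx_mxnorm (A : 'M[R]_n) v :
  enorm (A *m v) <= n%:R * (n%:R * `|A|) * enorm v.
Proof.
apply: le_trans (enorm_le_mxnorm _) _; rewrite -mulrA; apply: ler_wpM2l => //.
rewrite [leLHS]/Num.norm /= mx_normrE; apply/bigmax_leP; split.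
  by rewrite !mulr_ge0// enorm_ge0.
move=> [i j] _ /=; rewrite mxE; apply: le_trans (ler_norm_sum _ _ _) _.
rewrite -mulrA mulr_natl (_ : _ *+ n = \sum_(k < n) (`|A| * enorm v)); last first.
  by rewrite sumr_const card_ord.
apply: ler_sum => k _; rewrite normrM; apply: ler_pM => //.
  rewrite [leRHS]/Num.norm /= mx_normrE; apply/bigmax_geP; right => /=.
  by exists (i, k).
rewrite ord1; exact: le_trans (coord_le_mxnorm v k) (mxnorm_le_enorm v).
Qed.

End NewtonAlgebra.

(** * Estimates combined in the local analysis *)

Lemma secant_split (R : realType) n (B H H0 : 'M[R]_n) (v g : 'cV[R]_n) (e h : R) :
  enorm ((B - H) *m v) <= e / 3 * h -> enorm ((H - H0) *m v) <= e / 3 * h ->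
  enorm (g - H0 *m v) <= e / 3 * h -> enorm (B *m v - g) <= e * h.
Proof.
rewrite !mulmxBl; move: (B *m v) (H *m v) (H0 *m v) => a b c h1 h2 h3.
have -> : a - g = (a - b) + ((b - c) - (g - c)).
  by apply/colP => i; rewrite !mxE; ring.
have -> : e * h = e / 3 * h + (e / 3 * h + e / 3 * h) by field.
apply: le_trans (enormD _ _) _; apply: lerD => //.
by apply: le_trans (enormB _ _) _; apply: lerD.
Qed.

Lemma newton_scalar (R : realType) (kM lB CF kl e a b c h F : R) :
  0 < kM -> 0 < lB -> 0 < CF -> 0 < kl -> 0 < e ->
  a <= e / (3 * kM) / kl * h -> b <= e / (3 * kM) * h ->
  c <= e / (3 * kM) / (lB * CF) * F -> F <= CF * h ->
  kM * (kl * a + b + lB * c) <= e * h.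
Proof.
move=> kM0 lB0 CF0 kl0 e0 ha hb hc hF.
have h1 : kM * (kl * a) <= e / 3 * h.
  have := ler_wpM2l (ltW (mulr_gt0 kM0 kl0)) ha.
  by rewrite -mulrA => /le_trans; apply; rewrite le_eqVlt; apply/orP; left; apply/eqP;
    field; rewrite !gt_eqF.
have h2 : kM * b <= e / 3 * h.
  have := ler_wpM2l (ltW kM0) hb.
  by move=> /le_trans; apply; rewrite le_eqVlt; apply/orP; left; apply/eqP;
    field; rewrite !gt_eqF.
have h3 : kM * (lB * c) <= e / 3 * h.
  have p : 0 <= e / (3 * kM) / (lB * CF).
    by rewrite !divr_ge0 ?mulr_ge0// ltW.
  have := ler_wpM2l (ltW (mulr_gt0 kM0 lB0)) (le_trans hc (ler_wpM2l p hF)).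
  by rewrite -mulrA => /le_trans; apply; rewrite le_eqVlt; apply/orP; left; apply/eqP;
    field; rewrite !gt_eqF.
by lra.
Qed.

Lemma error_scalar (R : realType) (a b c d : R) :
  a <= b * (c * d) + 1 / 2 * a -> a <= 2 * (b * c) * d.
Proof. by lra. Qed.

Lemma hval_gap_scalar (R : realType) (p t F C1 L v h t0 lam : R) :
  0 <= L -> 0 <= F -> 0 <= v <= h -> h <= C1 * F -> p <= F * v + L * v ^+ 2 ->
  0 < lam -> t <= t0 ->
  p + t * lam / 2 * F ^+ 2 <= (C1 + L * C1 ^+ 2 + t0 * lam / 2) * F ^+ 2.
Proof.
move=> L0 F0 /andP[v0 vh] hC hp lam0 tt.
have vC : v <= C1 * F by apply: le_trans vh hC.
have h1 : F * v <= F * (C1 * F) by rewrite ler_wpM2l.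
have h2 : L * v ^+ 2 <= L * (C1 * F) ^+ 2.
  by rewrite ler_wpM2l//; apply: lerXn2r => //; rewrite nnegrE ?(le_trans v0).
have h3 : t * lam / 2 * F ^+ 2 <= t0 * lam / 2 * F ^+ 2.
  by rewrite ler_wpM2r ?sqr_ge0// ler_pM2r ?invr_gt0// ler_pM2r.
by move: h1 h2 h3 hp; move: (t * lam / 2 * F ^+ 2) => a; lra.
Qed.

(** For [v = D h] the curvature on the right is [<h, D M h>], which is
    nonnegative; replacing [D h] by [v] costs [O(e |h|^2)]. *)
Lemma psd_curvature (R : realType) n (B D M : 'M[R]_n) (h v : 'cV[R]_n) (lam kB e : R) :
  0 < lam -> 0 <= kB -> 0 <= e <= 1 -> D^T = D ->
  M = B *m D + lam^-1 *: (1%:M - D) -> 0 <= dotv h ((D *m M) *m h) ->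
  (forall u, enorm (B *m u) <= kB * enorm u) ->
  enorm v <= enorm h -> enorm (v - D *m h) <= e * enorm h ->
  - ((3 * kB + 4 * lam^-1) * e * enorm h ^+ 2) <=
    dotv (B *m v) v + lam^-1 * dotv (h - v) v.
Proof.
move=> lam0 kB0 /andP[e0 e1] Dsym ME psdh HB vh dh.
set a := D *m h in dh; set d := v - a in dh.
have vE : v = a + d by rewrite /d addrC subrK.
have h0 := enorm_ge0 h; have li : 0 < lam^-1 by rewrite invr_gt0.
have psd' : 0 <= dotv a (B *m a) + lam^-1 * dotv a (h - a).
  move: psdh; rewrite -mulmxA dotv_mulmx Dsym -/a ME mulmxDl -mulmxA -/a.
  by rewrite -scalemxAl mulmxBl mul1mx -/a [X in 0 <= X -> _]dotvDr dotvZr.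
have ah : enorm a <= 2 * enorm h.
  have -> : a = v - d by rewrite vE addrK.
  apply: le_trans (enormB _ _) _.
  have : e * enorm h <= 1 * enorm h by rewrite ler_wpM2r.
  by move: vh dh; clear psd' vE HB; move: (enorm v) (enorm d) (enorm h) => *; lra.
have eh : 0 <= e * enorm h by rewrite mulr_ge0.
have b1 : - dotv (B *m v) d <= kB * enorm h * (e * enorm h).
  apply: le_trans (cauchy_schwarzN _ _) _; apply: ler_pM; rewrite ?enorm_ge0//.
  by apply: le_trans (HB v) _; rewrite ler_wpM2l.
have b2 : - dotv (B *m d) a <= kB * (e * enorm h) * (2 * enorm h).
  apply: le_trans (cauchy_schwarzN _ _) _; apply: ler_pM; rewrite ?enorm_ge0//.
  by apply: le_trans (HB d) _; rewrite ler_wpM2l.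
have b3 : - dotv h d <= enorm h * (e * enorm h).
  by apply: le_trans (cauchy_schwarzN _ _) _; apply: ler_pM; rewrite ?enorm_ge0.
have b4 : dotv v d <= enorm h * (e * enorm h).
  by apply: le_trans (cauchy_schwarz _ _) _; apply: ler_pM; rewrite ?enorm_ge0.
have b5 : dotv d a <= (e * enorm h) * (2 * enorm h).
  by apply: le_trans (cauchy_schwarz _ _) _; apply: ler_pM; rewrite ?enorm_ge0.
have E1 : dotv (B *m v) v = dotv (B *m v) d + dotv (B *m d) a + dotv a (B *m a).
  have H x y : dotv (B *m (x + y)) (x + y) =
      dotv (B *m (x + y)) y + dotv (B *m y) x + dotv x (B *m x).
    by rewrite mulmxDr !dotvE (dotvC x (B *m x)); ring.
  by have := H a d; rewrite -vE.
have E2 : dotv (h - v) v = dotv a (h - a) + dotv h d - dotv v d - dotv d a.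
  have H x y : dotv (h - (x + y)) (x + y) =
      dotv x (h - x) + dotv h y - dotv (x + y) y - dotv y x.
    by rewrite !dotvE (dotvC x h); ring.
  by have := H a d; rewrite -vE.
rewrite E1 E2.
have c3 := ler_wpM2l (ltW li) b3; have c4 := ler_wpM2l (ltW li) b4.
have c5 := ler_wpM2l (ltW li) b5.
clear E1 E2 b3 b4 b5 vE HB psdh ME.
move: psd' b1 b2 c3 c4 c5.
move: (dotv (B *m v) d) (dotv (B *m d) a) (dotv a (B *m a)) (dotv a (h - a))
  (dotv h d) (dotv v d) (dotv d a) (enorm h) => x1 x2 x3 x4 x5 x6 x7 y.
by rewrite !mulrDr !mulrN; move: lam^-1 => l; lra.
Qed.

Lemma curvature_replace (R : realType) n (B H : 'M[R]_n) (v g : 'cV[R]_n) (e r : R) :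
  0 <= e -> enorm (B *m v - g) <= e * r -> enorm (g - H *m v) <= e * r -> enorm v <= r ->
  dotv (B *m v) v - 2 * e * r ^+ 2 <= dotv (H *m v) v.
Proof.
move=> e0 h1 h2 vr.
have -> : H *m v = B *m v - ((B *m v - g) + (g - H *m v)).
  by rewrite addrA subrK opprB addrC subrK.
rewrite [dotv (B *m v - _) v]dotvDl dotvNl lerD2l lerN2.
apply: le_trans (cauchy_schwarz _ _) _.
rewrite (_ : 2 * e * r ^+ 2 = (e * r + e * r) * r); last by ring.
apply: ler_pM; rewrite ?enorm_ge0//.
by apply: le_trans (enormD _ _) _; apply: lerD.
Qed.

Lemma second_order_scalar (R : realType) (lam e pz fz pb fb gv wv Hv Bv hv r k : R) :
  0 < lam -> 0 <= e -> 0 <= r ->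
  lam^-1 * wv + lam^-1 * (hv / 2) - lam^-1 * (e * r) <= pz - pb ->
  gv + Hv / 2 - e * r <= fz - fb -> gv + lam^-1 * wv = 0 ->
  Bv - 2 * e * r <= Hv -> - (k * e * r) <= Bv + lam^-1 * hv ->
  (fb + pb) - (fz + pz) <= (k / 2 + 2 + lam^-1) * (e * r).
Proof.
move=> lam0 e0 r0; move: (lam^-1) => l h1 h2 h3 h4 h5.
have : 0 <= e * r by rewrite mulr_ge0.
by move: h1 h2 h3 h4 h5; rewrite -!mulrA; move: (e * r) => y; lra.
Qed.

(** Collects the four error terms of the unit step test, each of which is made
    at most a quarter of the available decrease. *)
Lemma unit_step_scalar (R : realType) (pp pz pb h hp Fz Fp d lam tau tau0 taum sig L CF C1
    eps e nu b : R) :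
  0 < lam -> taum <= tau <= tau0 -> 0 < sig < 1 -> 0 <= L -> 0 < CF -> 0 < C1 ->
  0 <= h -> 0 <= hp -> 0 <= Fp -> 0 <= d -> 0 <= Fz -> 0 <= nu -> 0 < taum ->
  0 <= eps <= 1 -> 0 < b ->
  pp - pb <= Fp * hp + L * hp ^+ 2 -> pb - pz <= e * h ^+ 2 ->
  Fp <= CF * hp -> hp <= eps * h -> h <= C1 * Fz -> d <= hp + h ->
  (CF + L) * eps <= b -> e <= b -> tau0 * lam / 2 * CF ^+ 2 * eps <= b ->
  nu * 4 <= lam * b -> 4 * b * C1 ^+ 2 <= (1 - sig) * taum * lam / 2 ->
  pp + tau * lam / 2 * Fp ^+ 2 - (pz + tau * lam / 2 * Fz ^+ 2) <=
  - (sig * lam * tau * 1 / 2 * Fz ^+ 2) - nu / (lam * 1) * d ^+ 2.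
Proof.
move=> lam0 /andP[tm t0] /andP[s0 s1] L0 CF0 C10 h0 hp0 Fp0 d0 Fz0 nu0 tm0
  /andP[eps0 eps1] b0 H1 H2 H3 H4 H5 H6 K1 K2 K3 K4 K5.
have hp2 : hp ^+ 2 <= eps * h ^+ 2.
  have : hp ^+ 2 <= (eps * h) ^+ 2 by apply: lerXn2r; rewrite ?nnegrE ?mulr_ge0.
  move=> /le_trans; apply; rewrite exprMn ler_wpM2r ?sqr_ge0// expr2.
  by rewrite ler_piMl.
have h20 : 0 <= h ^+ 2 by rewrite sqr_ge0.
have A1 : pp - pb <= b * h ^+ 2.
  have q1 : Fp * hp <= CF * hp * hp by rewrite ler_wpM2r.
  have q2 : (CF + L) * hp ^+ 2 <= (CF + L) * (eps * h ^+ 2).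
    by rewrite ler_wpM2l// addr_ge0// ltW.
  have q3 : (CF + L) * eps * h ^+ 2 <= b * h ^+ 2 by rewrite ler_wpM2r.
  by move: H1 q1 q2 q3; clear; lra.
have A2 : pb - pz <= b * h ^+ 2 by apply: le_trans H2 _; rewrite ler_wpM2r.
have tau_ge0 : 0 <= tau by apply: le_trans tm; exact: ltW.
have A3 : tau * lam / 2 * Fp ^+ 2 <= b * h ^+ 2.
  have q1 : Fp ^+ 2 <= (CF * hp) ^+ 2.
    by apply: lerXn2r; rewrite ?nnegrE ?mulr_ge0// ltW.
  have q2 : (CF * hp) ^+ 2 <= CF ^+ 2 * (eps * h ^+ 2).
    by rewrite exprMn ler_wpM2l ?sqr_ge0.
  have q3 : tau * lam / 2 <= tau0 * lam / 2.
    by rewrite ler_pM2r ?invr_gt0// ler_pM2r.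
  have q4 : tau * lam / 2 * Fp ^+ 2 <= tau0 * lam / 2 * (CF ^+ 2 * (eps * h ^+ 2)).
    apply: ler_pM; rewrite ?sqr_ge0//; last exact: le_trans q2.
    by rewrite divr_ge0// mulr_ge0// ltW.
  have q5 : tau0 * lam / 2 * CF ^+ 2 * eps * h ^+ 2 <= b * h ^+ 2 by rewrite ler_wpM2r.
  by move: q4 q5; rewrite !mulrA => /le_trans; apply.
have A4 : nu / (lam * 1) * d ^+ 2 <= b * h ^+ 2.
  have q1 : d <= 2 * h.
    have : eps * h <= 1 * h by rewrite ler_wpM2r.
    by move: H4 H6; lra.
  have q2 : d ^+ 2 <= (2 * h) ^+ 2.
    by apply: lerXn2r; rewrite ?nnegrE ?mulr_ge0.
  have q3 : nu / (lam * 1) * d ^+ 2 <= nu / (lam * 1) * (2 * h) ^+ 2.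
    by rewrite ler_wpM2l// divr_ge0// mulr1 ltW.
  apply: le_trans q3 _; rewrite mulr1 -mulrA mulrC -mulrA mulrC.
  rewrite exprMn (_ : 2 ^+ 2 = 4 :> R); last by ring.
  have : nu / lam * 4 <= b by rewrite mulrAC ler_pdivrMr// mulrC [b * _]mulrC mulrC.
  move=> q; have := ler_wpM2r h20 q; clear; move: (nu) (h ^+ 2) (lam^-1) => x y w.
  by lra.
have A5 : 4 * b * h ^+ 2 <= (1 - sig) * tau * lam / 2 * Fz ^+ 2.
  have q1 : h ^+ 2 <= (C1 * Fz) ^+ 2.
    by apply: lerXn2r; rewrite ?nnegrE ?mulr_ge0// ltW.
  have q2 : 4 * b * h ^+ 2 <= 4 * b * C1 ^+ 2 * Fz ^+ 2.
    by rewrite -[leRHS]mulrA -exprMn ler_wpM2l// mulr_ge0// ltW.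
  apply: le_trans q2 _; rewrite ler_wpM2r ?sqr_ge0//; apply: le_trans K5 _.
  by rewrite ler_pM2r ?invr_gt0// ler_pM2r// ler_wpM2l// subr_ge0 ltW.
move: A1 A2 A3 A4 A5; move: (nu / _ * _) (tau * lam / 2 * Fp ^+ 2) => x y.
by clear; lra.
Qed.

Lemma taylor_scalar (R : realType) (p1 p0 q g c Hv b : R) :
  p1 - Hv / 2 - p0 = g - c * Hv -> - (g - q - c * Hv) <= b ->
  q + Hv / 2 - b <= p1 - p0.
Proof. by lra. Qed.

Lemma order_scalar (R : realType) (kM kl lB c l cE CF a b eps p pp : R) :
  0 < kM -> 0 <= kl -> 0 <= lB -> 0 <= cE ->
  a <= c * p -> b <= l * p -> eps <= cE * pp -> pp <= CF * p ->
  kM * (kl * a + b + lB * eps) <= kM * (kl * c + l + lB * (cE * CF)) * p.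
Proof.
move=> kM0 kl0 lB0 cE0 ha hb he hp; rewrite -mulrA ler_pM2l// !mulrDl.
apply: lerD; first apply: lerD => //.
  by rewrite -mulrA ler_wpM2l.
rewrite -mulrA -(mulrA cE); apply: ler_wpM2l => //; apply: le_trans he _.
exact: ler_wpM2l.
Qed.

Lemma residual_inner (R : realType) n (u a b g1 g0 : 'cV[R]_n) :
  u = a - (g1 - g0) -> dotv u g1 - dotv u g0 = dotv u b -> dotv u u = dotv u (a - b).
Proof. by move=> uE h; rewrite {2}uE !dotvE -h; ring. Qed.

(** * Stationarity of the accumulation point *)

Section Local.
Variables (R : realType) (n : nat).
Variables (f : 'cV[R]_n -> R) (phi : 'cV[R]_n -> \bar R).
Variables (P : params R n) (I : iterates R n) (zbar : 'cV[R]_n).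
Variables (L kappaM kappaB : R) (K : nat) (E : 'cV[R]_n -> R).
Hypothesis f_C1 : C1 f.
Hypothesis phi_proper : eproper phi.
Hypothesis phi_lsc : lower_semicontinuous phi.
Hypothesis phi_convex : econvex phi.
Hypothesis P_valid : valid_params P.
Hypothesis I_gen : generated P f phi I.
Hypothesis L_ge0 : 0 <= L.
Hypothesis grad_lip : elipschitz_on L (edom phi) (grad f).
Hypothesis z_cluster : cluster (it_z I @ \oo) zbar.
Hypothesis psi_below :
  exists m : R, forall x, dom_subdiff phi x -> (m%:E <= psi f phi x)%E.
Hypothesis f_C2 : C2_on (edom phi) f.
Hypothesis prox_semismooth : semismooth (prox (par_lam P) phi) zbar.
Hypothesis kappaM_gt0 : 0 < kappaM.
Hypothesis kappaB_ge0 : 0 <= kappaB.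
Hypothesis M_regular : forall k, (K <= k)%N ->
  [/\ psd (it_D I k *m it_M P I k), it_M P I k \in unitmx &
      specnorm (invmx (it_M P I k)) <= kappaM].
Hypothesis dennis_more : (fun k => enorm ((it_B I k - hess f (it_x P phi I k))
    *m (it_x P phi I k - prox (par_lam P) phi zbar))
    / enorm (it_z I k - zbar)) @ \oo --> (0 : R).
Hypothesis eps_le : forall k, par_eps P k <= E (it_F P f phi I k).
Hypothesis E_cont : continuous E.
Hypothesis E_littleo : E =o_ (0 : 'cV[R]_n) (fun h => enorm h).
Hypothesis B_bounded : forall k, specnorm (it_B I k) <= kappaB.

Local Notation lam := (par_lam P).
Local Notation prx := (prox lam phi).
Local Notation z := (it_z I).
Local Notation F := (Fnor lam f phi).
Local Notation psiv := (psi_val f phi lam).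

Let lam_gt0 : 0 < lam. Proof. by case: P_valid => _ []. Qed.
Let eps_ge0 k : 0 <= par_eps P k. Proof. by case: P_valid. Qed.

Lemma cluster_frequently d N : 0 < d ->
  exists2 k, (N <= k)%N & enorm (z k - zbar) < d.
Proof.
move=> d0; have zA : (z @ \oo) [set z k | k in [set k | (N <= k)%N]].
  by exists N => // k Nk; exists k.
have zB : nbhs zbar [set y | enorm (y - zbar) < d].
  by apply/nbhs_enormP; exists d.
by have [_ [[k Nk <-] kd]] := z_cluster zA zB; exists k.
Qed.

(** The second order step with stepsize one. *)
Definition newton_step k : 'cV[R]_n := lam *: (it_d P f phi I k + it_e P f phi I k).

(** The residual of the system solved by CG, at its output [q_k]. *)
Definition cg_defect k : 'cV[R]_n :=
  it_D I k *m (F (z k) + it_M P I k *m it_q P f phi I k).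

Lemma newton_stepE k : newton_step k =
  it_q P f phi I k - lam *: (F (z k) + it_M P I k *m it_q P f phi I k).
Proof.
rewrite /newton_step /it_d /it_e /it_F.
move: (it_q _ _ _ _ _) (it_M _ _ _ *m _) => q Mq.
rewrite !scalerDr scalerA mulfV ?gt_eqF// scale1r.
by apply/colP => i; rewrite !mxE; ring.
Qed.

Lemma it_D_sym k : (it_D I k)^T = it_D I k.
Proof.
exact: (clarke_prox_sym phi_proper phi_lsc phi_convex lam_gt0 (gen_D I_gen k)).
Qed.

Lemma it_DM_sym k : (it_D I k *m it_M P I k)^T = it_D I k *m it_M P I k.
Proof.
rewrite /it_M mulmxDr linearD /= -scalemxAr !linearZ /= !trmx_mul linearB /= trmx1.
rewrite it_D_sym (gen_Bsym I_gen) mulmxA; congr (_ + _ *: _).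
by rewrite mulmxBl mulmxBr mul1mx mulmx1.
Qed.

Lemma cg_defect_le k : (K <= k)%N -> enorm (cg_defect k) <= par_eps P k.
Proof.
move=> /M_regular[Mpsd Munit _].
have := @cg_residual_le _ _ _ (it_D I k *m F (z k)) _ (it_DM_sym k) Mpsd (eps_ge0 k)
  (invmx (it_M P I k) *m F (z k)).
rewrite -mulmxA mulKVmx// => /(_ erefl).
by rewrite /cg_defect (mulmxDr _ (F (z k))) (mulmxA _ (it_M P I k)) addrC.
Qed.

Lemma newton_step_eq k : it_M P I k *m newton_step k =
  - F (z k) + (cg_defect k - lam *: (it_B I k *m cg_defect k)).
Proof. by rewrite newton_stepE (newton_equation _ _ (lt0r_neq0 lam_gt0) erefl). Qed.

Lemma defect_bound k : (K <= k)%N ->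
  enorm (cg_defect k - lam *: (it_B I k *m cg_defect k))
    <= (1 + lam * kappaB) * par_eps P k.
Proof.
move=> Kk; have r := cg_defect_le Kk.
apply: le_trans (enormB _ _) _; rewrite mulrDl mul1r; apply: lerD => //.
rewrite enormZ gtr0_norm// -mulrA; apply: ler_wpM2l; first exact: ltW.
apply: le_trans (enorm_mulmx_le _ (B_bounded k)) _.
exact: ler_wpM2l.
Qed.

Lemma enorm_le_M k w : (K <= k)%N -> enorm w <= kappaM * enorm (it_M P I k *m w).
Proof.
move=> /M_regular[_ Mu Mk].
by rewrite -{1}[w](mulKmx Mu); exact: enorm_mulmx_le _ Mk.
Qed.

Lemma it_e_bound k : (K <= k)%N -> enorm (it_e P f phi I k) <=
  (lam^-1 * kappaM + 1) * enorm (F (z k))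
    + lam^-1 * kappaM * (1 + lam * kappaB) * par_eps P k.
Proof.
move=> Kk.
have -> : it_e P f phi I k = lam^-1 *: newton_step k + F (z k).
  rewrite /newton_step scalerA mulVf ?gt_eqF// scale1r /it_d /it_F.
  by rewrite addrAC addNr add0r.
apply: le_trans (enormD _ _) _.
rewrite enormZ gtr0_norm ?invr_gt0//.
have sb : enorm (newton_step k) <= kappaM * (enorm (F (z k))
    + (1 + lam * kappaB) * par_eps P k).
  apply: le_trans (enorm_le_M _ Kk) _; apply: ler_wpM2l; first exact: ltW.
  rewrite newton_step_eq; apply: le_trans (enormD _ _) _; rewrite enormN lerD2l.
  exact: defect_bound.
have li : 0 <= lam^-1 by rewrite invr_ge0 ltW.
have := ler_wpM2l li sb.
move: (enorm (newton_step k)) (enorm (F (z k))) (par_eps P k) => a b c.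
move=> h; rewrite (_ : _ + _ * c = lam^-1 * (kappaM * (b + (1 + lam * kappaB) * c)) + b).
  by rewrite lerD2r.
by ring.
Qed.

Lemma Fnor_lip_zbar k : enorm (F (z k) - F zbar) <=
  (L + lam^-1 * 2) * enorm (z k - zbar).
Proof. exact: Fnor_lip. Qed.

Let CF := L + lam^-1 * 2.
Let CF_gt0 : 0 < CF.
Proof. by rewrite ltr_wpDl// mulr_gt0 ?invr_gt0. Qed.

(** Proximal points lie in the domain of the subdifferential. *)
Lemma Hval_lbound : exists m, forall k, m <= Hval f phi P I k.
Proof.
have [m mP] := psi_below; exists m => k.
have : m <= psiv (z k).
  rewrite -lee_fin -(psi_valE f phi_proper phi_lsc phi_convex lam_gt0).
  apply: mP; exists (lam^-1 *: (z k - prx (z k))).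
  exact: prox_subdiff.
move=> /le_trans; apply; rewrite /Hval lerDl.
have t0 := tau_min_gt0 L P_valid.
have := it_tau_ge f_C1 phi_proper phi_lsc phi_convex P_valid I_gen L_ge0 grad_lip k.
move=> /(lt_le_trans t0) t1.
by rewrite mulr_ge0 ?sqr_ge0// divr_ge0// mulr_ge0// ltW.
Qed.

(** If the residual stayed away from zero near [zbar], the corrections [e_k]
    would be bounded relatively to it, stepsizes would be bounded below and the
    merit function would decrease by a fixed amount infinitely often. *)
Lemma residual_small_near : exists2 r0, 0 < r0 & forall d, 0 < d ->
  exists N, forall k, (N <= k)%N -> enorm (z k - zbar) < r0 -> enorm (F (z k)) < d.
Proof.
have /(@cvgrPdist_lt _ _ _ (nbhs (F zbar)))/(_ _ ltr01) := @E_cont (F zbar).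
move=> /nbhs_enormP[d0 d0_gt0 Ed].
exists (d0 / CF) => [|d d_gt0]; first by rewrite divr_gt0.
pose C := lam^-1 * kappaM + 1 + lam^-1 * kappaM * (1 + lam * kappaB) * (E (F zbar) + 1) / d.
have li : 0 < lam^-1 by rewrite invr_gt0.
have lB : 0 <= 1 + lam * kappaB by rewrite addr_ge0// mulr_ge0// ltW.
have c1 : 0 <= lam^-1 * kappaM * (1 + lam * kappaB).
  by rewrite mulr_ge0// mulr_ge0// ltW.
have epsb k : enorm (z k - zbar) < d0 / CF -> par_eps P k <= E (F zbar) + 1.
  move=> zk; apply: le_trans (eps_le k) _.
  have : enorm (F (z k) - F zbar) < d0.
    apply: le_lt_trans (Fnor_lip_zbar k) _; rewrite -/CF.
    by move: zk; rewrite ltr_pdivlMr// mulrC.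
  move=> /Ed; rewrite /= ltr_norml => /andP[h _]; rewrite /it_F.
  by move: h; rewrite ltrBrDl ltrBlDr => /ltW.
have E1 : 0 <= E (F zbar) + 1.
  have [k _ kd] := @cluster_frequently (d0 / CF) 0 (divr_gt0 d0_gt0 CF_gt0).
  exact: le_trans (eps_ge0 k) (epsb _ kd).
have C0 : 0 <= C.
  rewrite addr_ge0// ?divr_ge0 ?(ltW d_gt0)//; last exact: mulr_ge0.
  by rewrite addr_ge0// mulr_ge0// ltW.
have [a a0 aP] := alpha_lower_bound f_C1 phi_proper phi_lsc phi_convex P_valid I_gen
  L_ge0 grad_lip C0.
have [m mP] := Hval_lbound.
have dr0 := decrease_rate_gt0 L P_valid.
have drp : 0 < decrease_rate P L * a * d ^+ 2.
  by rewrite mulr_gt0 ?exprn_gt0// mulr_gt0.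
have dec k : 0 <= decrease_rate P L * it_alpha P I k * enorm (F (z k)) ^+ 2.
  by rewrite mulr_ge0 ?sqr_ge0// mulr_ge0 ?(ltW dr0)// ltW// it_alpha_gt0.
have [N NP] := telescoping_small (Hval_decrease f_C1 phi_proper phi_lsc phi_convex
  P_valid I_gen L_ge0 grad_lip) dec mP drp.
exists (maxn N K) => k; rewrite geq_max => /andP[Nk Kk] zk.
rewrite ltNge; apply/negP => Fk.
have ek : enorm (used_e f phi P I k) <= C * enorm (F (z k)).
  rewrite /used_e; case: ifP => _; last by rewrite enorm0 mulr_ge0// enorm_ge0.
  apply: le_trans (it_e_bound Kk) _; rewrite /C [leRHS]mulrDl lerD2l.
  apply: le_trans (ler_wpM2l c1 (epsb _ zk)) _.
  rewrite -[leRHS]mulrA; apply: ler_peMr; first exact: mulr_ge0.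
  by rewrite mulrC ler_pdivlMr// mul1r.
have := NP k Nk; rewrite ltNge => /negP; apply.
rewrite -(mulrA _ a) -(mulrA _ (it_alpha P I k)).
apply: ler_wpM2l; first exact: ltW.
apply: ler_pM; [exact: ltW|exact: sqr_ge0|exact: aP|].
by rewrite ler_pXn2r// nnegrE ?enorm_ge0// ltW.
Qed.

Lemma Fzbar0 : F zbar = 0.
Proof.
apply/eqP; rewrite -enorm_eq0 -[_ == _]negbK -/(_ != _).
apply/negP => Fn0.
have F0 : 0 < enorm (F zbar) by rewrite lt_neqAle eq_sym Fn0 enorm_ge0.
have [r0 r0_gt0 H] := residual_small_near.
have [|N NP] := H (enorm (F zbar) / 2); first by rewrite divr_gt0.
have rr : 0 < Num.min r0 (enorm (F zbar) / 2 / CF).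
  by rewrite lt_min r0_gt0 !divr_gt0.
have [k Nk] := cluster_frequently N rr.
rewrite lt_min ltr_pdivlMr// => /andP[k1 k2].
have h1 := NP k Nk k1.
have h2 := Fnor_lip_zbar k; rewrite -/CF in h2.
have h3 := enorm_le_dist (F zbar) (F (z k)).
rewrite mulrC in k2.
have := le_lt_trans h3 (ltrD (le_lt_trans h2 k2) h1).
by rewrite -splitr ltxx.
Qed.

(** * Superlinear contraction of the Newton step *)

Lemma E_small e : 0 < e -> exists2 d, 0 < d & forall h, enorm h < d -> E h <= e * enorm h.
Proof.
move=> e0; have /eqoP/(_ _ e0)/nbhs_enormP[d d0 dP] := E_littleo.
exists d => // h hd; have := dP h; rewrite subr0 => /(_ hd).
by rewrite (ger0_norm (enorm_ge0 h)); apply: le_trans; exact: ler_norm.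
Qed.

Lemma residual_le k : enorm (F (z k)) <= CF * enorm (z k - zbar).
Proof. by have := Fnor_lip_zbar k; rewrite Fzbar0 subr0. Qed.

Lemma eps_small e : 0 < e -> exists2 d, 0 < d & forall k,
  enorm (z k - zbar) < d -> par_eps P k <= e * enorm (F (z k)).
Proof.
move=> e0; have [d d0 dP] := E_small e0.
exists (d / CF) => [|k kd]; first by rewrite divr_gt0.
apply: le_trans (eps_le k) _; apply: dP.
apply: le_lt_trans (residual_le k) _.
by rewrite mulrC -ltr_pdivlMr.
Qed.

Lemma e_bound_near : exists2 C, 0 <= C & exists2 d, 0 < d & forall k, (K <= k)%N ->
  enorm (z k - zbar) < d -> enorm (it_e P f phi I k) <= C * enorm (F (z k)).
Proof.
have [d d0 dP] := eps_small ltr01.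
have c1 : 0 <= lam^-1 * kappaM by rewrite mulr_ge0 ?invr_ge0// ltW.
have c2 : 0 <= lam^-1 * kappaM * (1 + lam * kappaB).
  by rewrite mulr_ge0// addr_ge0// mulr_ge0// ltW.
exists (lam^-1 * kappaM + 1 + lam^-1 * kappaM * (1 + lam * kappaB)).
  by rewrite addr_ge0// addr_ge0.
exists d => // k Kk kd; apply: le_trans (it_e_bound Kk) _.
rewrite [leRHS]mulrDl lerD2l; apply: ler_wpM2l => //.
by rewrite -[leRHS]mul1r dP.
Qed.

Lemma prox_zbar_lip k : enorm (prx (z k) - prx zbar) <= enorm (z k - zbar).
Proof. exact: prox_nonexpansive. Qed.

Let prox_dom y : edom phi (prx y).
Proof. exact: prox_edom. Qed.

Lemma hess_near e : 0 < e -> exists2 d, 0 < d & forall x, edom phi x ->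
  enorm (x - prx zbar) < d -> forall v,
  enorm ((hess f x - hess f (prx zbar)) *m v) <= e * enorm v.
Proof.
move=> e0; have [_ /subspace_continuousP hc] := f_C2.
have c0 : 0 < n%:R * n%:R + 1 :> R by rewrite ltr_wpDl// mulr_ge0.
have /(@cvgrPdist_lt _ _ _ (within (edom phi) (nbhs (prx zbar)))) := hc _ (prox_dom zbar).
move=> /(_ _ (divr_gt0 e0 c0)); rewrite near_withinE => /nbhs_enormP[d d0 dP].
exists d => // x xd xl v; move: (dP x xl xd).
rewrite -normrN opprB; move: (hess f x - hess f (prx zbar)) => A.
rewrite ltr_pdivlMr// => /ltW H; apply: le_trans (enorm_mulmx_mxnorm _ _) _.
apply: ler_wpM2r; first exact: enorm_ge0.
apply: le_trans H; rewrite mulrA mulrC; apply: ler_wpM2l => //.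
by rewrite lerDl.
Qed.

(** [B_k] may be traded for the Hessian at [x_k] by the Dennis-More condition,
    that one for the Hessian at the limit by continuity, and the latter for the
    gradient increment by differentiability. *)
Lemma secant_defect e : 0 < e -> exists2 d, 0 < d & exists N, forall k, (N <= k)%N ->
  enorm (z k - zbar) < d ->
  enorm (it_B I k *m (prx (z k) - prx zbar) - (grad f (prx (z k)) - grad f (prx zbar)))
    <= e * enorm (z k - zbar).
Proof.
move=> e0; have e3 : 0 < e / 3 by rewrite divr_gt0.
have [d1 d10 H1] := hess_near e3.
have gd : differentiable (grad f) (prx zbar) := (proj1 f_C2) _ (prox_dom zbar).
have [d2 d20 H2] := differentiable_expansion gd e3.
have /cvgrPdist_lt/(_ _ e3)[N _ HN] := dennis_more.
exists (Num.min d1 d2); first by rewrite lt_min d10.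
exists N => k Nk; rewrite lt_min => /andP[k1 k2].
have xl := prox_zbar_lip k.
have [h0|h0] := eqVneq (enorm (z k - zbar)) 0.
  have v0 : prx (z k) - prx zbar = 0.
    by apply/eqP; rewrite -enorm_eq0 eq_le enorm_ge0 andbT -h0.
  have -> : prx (z k) = prx zbar by apply/eqP; rewrite -subr_eq0 v0.
  by rewrite !subrr mulmx0 subr0 enorm0 h0 mulr0.
have hgt : 0 < enorm (z k - zbar) by rewrite lt_neqAle eq_sym h0 enorm_ge0.
have b1 := H1 _ (prox_dom (z k)) (le_lt_trans xl k1) (prx (z k) - prx zbar).
have b2 := H2 _ (le_lt_trans xl k2).
rewrite [prx zbar + _]addrC subrK in b2.
have b3 : enorm ((it_B I k - hess f (prx (z k))) *m (prx (z k) - prx zbar)) <=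
    e / 3 * enorm (z k - zbar).
  have := HN k Nk; rewrite /= sub0r normrN ger0_norm.
    by rewrite ltr_pdivrMr// => /ltW.
  by rewrite divr_ge0 ?enorm_ge0.
have e3' := ltW e3.
have b1' := le_trans b1 (ler_wpM2l e3' xl).
have b2' := le_trans b2 (ler_wpM2l e3' xl).
exact: (secant_split b3 b1' b2').
Qed.

Lemma semismooth_near e : 0 < e -> exists2 d, 0 < d & forall k,
  enorm (z k - zbar) < d ->
  enorm (prx (z k) - prx zbar - it_D I k *m (z k - zbar)) <= e * enorm (z k - zbar).
Proof.
move=> e0; have [_ _ /(_ _ e0)/nbhs_enormP[d d0 dP]] := prox_semismooth.
exists d => // k kd; have := dP (z k - zbar); rewrite subr0 => /(_ kd).
rewrite -lee_fin; apply: le_trans; apply: ereal_sup_ubound.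
have zE : zbar + (z k - zbar) = z k by rewrite addrC subrK.
exists (it_D I k); first by rewrite zE; exact: (gen_D I_gen).
by rewrite zE.
Qed.

(** The three error sources of the Newton step: semismoothness of [prox], the
    secant defect of [B_k] and the CG tolerance. *)
Lemma newton_bound k : (K <= k)%N -> enorm (z k + newton_step k - zbar) <=
  kappaM * ((kappaB + lam^-1) * enorm (prx (z k) - prx zbar - it_D I k *m (z k - zbar))
    + enorm (it_B I k *m (prx (z k) - prx zbar)
             - (grad f (prx (z k)) - grad f (prx zbar)))
    + (1 + lam * kappaB) * par_eps P k).
Proof.
move=> Kk; apply: le_trans (enorm_le_M _ Kk) _; apply: ler_wpM2l; first exact: ltW.
have FE : F (z k) = (grad f (prx (z k)) - grad f (prx zbar))
    + lam^-1 *: ((z k - zbar) - (prx (z k) - prx zbar)).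
  by rewrite -FnorB Fzbar0 subr0.
have -> : it_M P I k *m (z k + newton_step k - zbar) =
    (it_M P I k *m (z k - zbar) - F (z k))
    + (cg_defect k - lam *: (it_B I k *m cg_defect k)).
  by rewrite (addrAC (z k)) (mulmxDr _ (z k - zbar)) newton_step_eq addrA.
rewrite {1}FE (newton_defect _ _ _ (erefl (it_M P I k))).
apply: le_trans (enormD _ _) _; apply: lerD; last exact: defect_bound.
set w := _ - it_D I k *m _; set u := _ - (grad f _ - _).
apply: le_trans (enormD _ _) _.
rewrite mulrDl addrAC; apply: lerD; last first.
  by rewrite enormZ gtr0_norm// invr_gt0.
apply: le_trans (enormD _ _) _; rewrite enormN lerD2r.
exact: (enorm_mulmx_le _ (B_bounded k)).
Qed.

Lemma newton_superlinear e : 0 < e -> exists2 d, 0 < d & exists N, forall k,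
  (N <= k)%N -> enorm (z k - zbar) < d ->
  enorm (z k + newton_step k - zbar) <= e * enorm (z k - zbar).
Proof.
move=> e0.
have li : 0 < lam^-1 by rewrite invr_gt0.
have lB : 0 < 1 + lam * kappaB by rewrite ltr_pwDl// mulr_ge0// ltW.
have kl : 0 < kappaB + lam^-1 by rewrite ltr_wpDl.
have e1 : 0 < e / (3 * kappaM) by rewrite divr_gt0// mulr_gt0.
have [d1 d10 H1] := semismooth_near (divr_gt0 e1 kl).
have [d2 d20 [N H2]] := secant_defect e1.
have [d3 d30 H3] := eps_small (divr_gt0 e1 (mulr_gt0 lB CF_gt0)).
exists (Num.min d1 (Num.min d2 d3)); first by rewrite !lt_min d10 d20.
exists (maxn N K) => k; rewrite geq_max !lt_min => /andP[Nk Kk] /and3P[k1 k2 k3].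
apply: le_trans (newton_bound Kk) _.
have b1 := H1 k k1; have b2 := H2 k Nk k2; have b3 := H3 k k3.
have b4 := residual_le k.
exact: (newton_scalar kappaM_gt0 lB CF_gt0 kl e0 b1 b2 b3 b4).
Qed.

(** The Newton step halves [|h|], so its length is at least [|h| / 2], whereas
    it is at most a multiple of the residual. *)
Lemma error_bound : exists2 C, 0 < C & exists2 d, 0 < d & exists N, forall k,
  (N <= k)%N -> enorm (z k - zbar) < d -> enorm (z k - zbar) <= C * enorm (F (z k)).
Proof.
have h2 : 0 < 1 / 2 :> R by rewrite divr_gt0.
have [d1 d10 [N H1]] := newton_superlinear h2.
have [C C0 [d2 d20 H2]] := e_bound_near.
exists (2 * (lam * (1 + C))); first by rewrite mulr_gt0// mulr_gt0// ltr_pwDl.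
exists (Num.min d1 d2); first by rewrite lt_min d10.
exists (maxn N K) => k; rewrite geq_max lt_min => /andP[Nk Kk] /andP[k1 k2].
have b1 := H1 k Nk k1; have b2 := H2 k Kk k2.
have b3 := enorm_le_dist (z k - zbar) (z k + newton_step k - zbar).
have b4 : enorm (newton_step k) <= lam * ((1 + C) * enorm (F (z k))).
  rewrite /newton_step enormZ gtr0_norm//; apply: ler_wpM2l; first exact: ltW.
  apply: le_trans (enormD _ _) _; rewrite /it_d enormN mulrDl mul1r.
  exact: lerD.
have vE : z k + newton_step k - zbar - (z k - zbar) = newton_step k.
  by move: (newton_step k) (z k) => a b; apply/colP => i; rewrite !mxE; ring.
rewrite vE in b3; have := le_trans b3 (lerD b4 b1).
exact: error_scalar.
Qed.

(** Accumulation at [zbar] is upgraded to convergence: near [zbar] the residual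
    controls both the distance to [zbar] and the length of the next step, and
    it is eventually small there, so the iterates cannot leave a small ball
    once they have entered it late enough. *)
Lemma z_converges r : 0 < r -> exists N, forall k, (N <= k)%N -> enorm (z k - zbar) < r.
Proof.
move=> r_gt0.
have [C1 C1_gt0 [d1 d10 [N1 H1]]] := error_bound.
have [C2 C2_ge0 [d2 d20 H2]] := e_bound_near.
have [r0 r0_gt0 H3] := residual_small_near.
pose R0 := Num.min (Num.min d1 d2) r0.
have R0_gt0 : 0 < R0 by rewrite !lt_min d10 d20.
pose R1 := Num.min (r / 2) (R0 / 2).
have R1_gt0 : 0 < R1 by rewrite lt_min !divr_gt0.
have st : 0 < lam * (1 + C2) by rewrite mulr_gt0// ltr_pwDl.
pose d := Num.min (R1 / C1) (R1 / (lam * (1 + C2))).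
have d_gt0 : 0 < d by rewrite lt_min !divr_gt0.
have [N3 H3'] := H3 d d_gt0.
pose M := maxn (maxn N1 K) N3.
have stay k : (M <= k)%N -> enorm (z k - zbar) < R0 -> enorm (z k - zbar) < R1 /\
    enorm (z k.+1 - z k) < R1.
  rewrite !geq_max => /andP[/andP[k1 k2] k3] hR.
  have /and3P[h1 h2 h3] : [&& enorm (z k - zbar) < d1, enorm (z k - zbar) < d2 &
      enorm (z k - zbar) < r0] by move: hR; rewrite !lt_min andbA.
  have /andP[f1 f2] : (enorm (F (z k)) < R1 / C1) &&
      (enorm (F (z k)) < R1 / (lam * (1 + C2))) by rewrite -lt_min H3'.
  split.
    apply: le_lt_trans (H1 k k1 h1) _; by rewrite mulrC -ltr_pdivlMr.
  rewrite (gen_next I_gen) addrC addKr it_stepE.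
  have a0 := it_alpha_gt0 I P_valid k; have a1 := it_alpha_le1 I P_valid k.
  rewrite enormZ gtr0_norm ?mulr_gt0//.
  apply: (@le_lt_trans _ _ (lam * ((1 + C2) * enorm (F (z k))))); last first.
    by rewrite mulrA mulrC -ltr_pdivlMr.
  rewrite -mulrA; apply: le_trans (_ : 1 * (lam * ((1 + C2) * enorm (F (z k)))) <= _);
    last by rewrite mul1r.
  apply: ler_pM => //; first exact: ltW.
    by rewrite mulr_ge0 ?enorm_ge0// ltW.
  apply: ler_wpM2l; first exact: ltW.
  apply: le_trans (enormD _ _) _; rewrite enormN mulrDl mul1r lerD2l enormZ gtr0_norm//.
  have ub : enorm (used_e f phi P I k) <= C2 * enorm (F (z k)).
    rewrite /used_e; case: ifP => _; first exact: H2.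
    by rewrite enorm0 mulr_ge0// enorm_ge0.
  by apply: le_trans ub; rewrite ler_piMl// enorm_ge0.
have [k0 Mk0 k0R] := cluster_frequently M R0_gt0.
have inv j : enorm (z (k0 + j)%N - zbar) < R0.
  elim: j => [|j IH]; first by rewrite addn0.
  have [h1 h2] := stay _ (leq_trans Mk0 (leq_addr j k0)) IH.
  rewrite addnS; apply: le_lt_trans (enorm_triangle _ (z (k0 + j)%N) _) _.
  have RR : R1 + R1 <= R0.
    have : R1 <= R0 / 2 by rewrite /R1 ge_min lexx orbT.
    by move=> hR; rewrite [leRHS]splitr; apply: lerD.
  exact: lt_le_trans (ltrD h2 h1) RR.
exists k0 => k kk; have [h1 _] : enorm (z k - zbar) < R1 /\ enorm (z k.+1 - z k) < R1.
  apply: stay; first exact: leq_trans kk.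
  by rewrite -(subnKC kk).
apply: lt_le_trans h1 _; rewrite /R1 ge_min; apply/orP; left.
by rewrite ler_pdivrMr// ler_peMr ?ltW// ltrDl.
Qed.

(** * Geometric decay of the residual *)

Lemma residual_tail r : 0 < r -> exists N, forall k, (N <= k)%N ->
  (K <= k)%N /\ enorm (z k - zbar) < r.
Proof.
move=> /z_converges[N NP]; exists (maxn N K) => k; rewrite geq_max => /andP[Nk Kk].
by split => //; exact: NP.
Qed.

Lemma used_e_eventually : exists2 C, 0 <= C & exists N, forall k, (N <= k)%N ->
  enorm (it_e P f phi I k) <= C * enorm (F (z k)) /\
  enorm (used_e f phi P I k) <= C * enorm (F (z k)).
Proof.
have [C C0 [d d0 H]] := e_bound_near; have [N NP] := residual_tail d0.
exists C => //; exists N => k /NP[Kk kd]; have h := H k Kk kd; split => //.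
by rewrite /used_e; case: ifP => // _; rewrite enorm0 mulr_ge0// enorm_ge0.
Qed.

Lemma error_bound_eventually : exists2 C, 0 < C & exists N, forall k, (N <= k)%N ->
  enorm (z k - zbar) <= C * enorm (F (z k)).
Proof.
have [C C0 [d d0 [N1 H]]] := error_bound; have [N2 NP] := residual_tail d0.
exists C => //; exists (maxn N1 N2) => k; rewrite geq_max => /andP[k1 k2].
by apply: H => //; case: (NP k k2).
Qed.

Lemma psi_zbar_le_near k :
  psiv zbar - L * enorm (z k - zbar) ^+ 2 <= psiv (z k).
Proof.
have := psi_val_upper f_C1 phi_proper phi_lsc phi_convex lam_gt0 L_ge0 grad_lip zbar (z k).
rewrite Fzbar0 enorm0 mul0r add0r lerBlDl => H.
rewrite lerBlDr; apply: le_trans H _; rewrite lerD2l.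
apply: ler_wpM2l => //; apply: lerXn2r; rewrite ?nnegrE ?enorm_ge0//.
by rewrite enormC prox_zbar_lip.
Qed.

Lemma Hval_noninc k j : Hval f phi P I (k + j)%N <= Hval f phi P I k.
Proof.
elim: j => [|j IH]; first by rewrite addn0.
rewrite addnS; apply: le_trans IH.
apply: le_trans (Hval_decrease f_C1 phi_proper phi_lsc phi_convex
  P_valid I_gen L_ge0 grad_lip _) _.
rewrite gerBl; apply: mulr_ge0; last exact: sqr_ge0.
by apply: mulr_ge0; rewrite ltW ?decrease_rate_gt0 ?it_alpha_gt0.
Qed.

Lemma psi_le_Hval k : psiv (z k) <= Hval f phi P I k.
Proof.
rewrite /Hval lerDl; have t0 := tau_min_gt0 L P_valid.
have := it_tau_ge f_C1 phi_proper phi_lsc phi_convex P_valid I_gen L_ge0 grad_lip k.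
move=> /(lt_le_trans t0) t1.
by rewrite mulr_ge0 ?sqr_ge0// divr_ge0// mulr_ge0// ltW.
Qed.

(** The merit values decrease, and the objective values below them tend to at
    least the value at [zbar]. *)
Lemma psi_zbar_le_Hval k : psiv zbar <= Hval f phi P I k.
Proof.
apply/ler_addgt0Pr => e e0.
have L1 : 0 < L + 1 by rewrite ltr_wpDl.
have r0 : 0 < Num.min 1 (e / (L + 1)) by rewrite lt_min ltr01 divr_gt0.
have [N NP] := z_converges r0.
have := NP (k + N)%N (leq_addl _ _); rewrite lt_min => /andP[h1 h2].
have := psi_zbar_le_near (k + N); rewrite lerBlDr => /le_trans; apply.
apply: lerD; first exact: le_trans (psi_le_Hval _) (Hval_noninc _ _).
move: h2; rewrite ltr_pdivlMr// => h2.
apply: le_trans (_ : L * enorm (z (k + N)%N - zbar) <= _).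
  apply: ler_wpM2l => //; rewrite expr2 ler_piMl ?enorm_ge0//.
  exact: ltW.
apply: le_trans (ltW h2); rewrite mulrC; apply: ler_wpM2l; first exact: enorm_ge0.
by rewrite lerDl.
Qed.

Lemma it_tau_le k : it_tau I k <= par_tau0 P.
Proof. by rewrite (gen_tau I_gen) trial_tau_le. Qed.

(** The merit gap is at most a multiple of [chi_k^2] and every step reduces it
    by at least another multiple of [chi_k^2]. *)
Lemma residual_geometric : exists A th N,
  [/\ 0 <= A, 0 < th < 1 &
      forall k, (N <= k)%N -> enorm (F (z k)) ^+ 2 <= A * th ^+ k].
Proof.
have [C1 C10 [N1 H1]] := error_bound_eventually.
have [C2 C20 [N2 H2]] := used_e_eventually.
have [a a0 aP] := alpha_lower_bound f_C1 phi_proper phi_lsc phi_convex P_valid I_gen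
  L_ge0 grad_lip C20.
have dr0 := decrease_rate_gt0 L P_valid.
have tau0 : 0 <= par_tau0 P by case: P_valid => _ [_ _ /ltW].
have [||||||A [th [A0 th01 Ath]]] := @geometric_decay R
    (fun k => Hval f phi P I k - psiv zbar) (fun k => enorm (F (z k)) ^+ 2)
    (decrease_rate P L * a) (C1 + L * C1 ^+ 2 + par_tau0 P * lam / 2) (maxn N1 N2).
- by rewrite mulr_gt0.
- by rewrite addr_ge0 ?addr_ge0 ?mulr_ge0 ?sqr_ge0 ?invr_ge0// ltW.
- by move=> k; rewrite subr_ge0 psi_zbar_le_Hval.
- move=> k; rewrite geq_max => /andP[k1 k2].
  rewrite [leRHS]addrAC lerD2r.
  apply: le_trans (Hval_decrease f_C1 phi_proper phi_lsc phi_convex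
    P_valid I_gen L_ge0 grad_lip _) _.
  rewrite lerD2l lerN2; apply: ler_wpM2r; first exact: sqr_ge0.
  by rewrite ler_pM2l// aP//; case: (H2 k k2).
- move=> k; rewrite geq_max => /andP[k1 k2].
  rewrite /Hval addrAC.
  have vh : 0 <= enorm (prx (z k) - prx zbar) <= enorm (z k - zbar).
    by rewrite enorm_ge0 prox_zbar_lip.
  apply: (hval_gap_scalar L_ge0 (enorm_ge0 _) vh (H1 k k1) _ lam_gt0 (it_tau_le k)).
  exact: (psi_val_upper f_C1 phi_proper phi_lsc phi_convex lam_gt0 L_ge0 grad_lip).
- by move=> k; exact: sqr_ge0.
by exists A, th, (maxn N1 N2).
Qed.

Lemma residual_beats_log e : 0 < e -> exists N, forall k, (N <= k)%N ->
  k%:R * ln (k.+1%:R : R) ^+ 2 * enorm (F (z k)) <= e.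
Proof.
have [A [th [N [A0 th01 H]]]] := residual_geometric.
exact: (geometric_beats_log A0 th01 (fun k => enorm_ge0 (F (z k))) H).
Qed.

(** * Eventual acceptance of the full Newton step *)

(** Since [e_k] is at most [C] times the residual, the test only requires
    [eta_k <= 1 / C], and [eta_k <= (k ln^2 (k + 1) chi_k)^q] tends to zero. *)
Lemma second_order_eventually : exists N, forall k, (N <= k)%N ->
  second_order P f phi I k.
Proof.
have q0 : 0 < par_q P by case: P_valid => _ _ _ [].
have [C C0 [N1 H1]] := used_e_eventually.
have C1 : 0 < (C + 1)^-1 by rewrite invr_gt0 ltr_wpDl.
have [e e0 H] := powR_small q0 C1.
have [N2 H2] := residual_beats_log e0.
exists (maxn N1 N2) => k; rewrite geq_max => /andP[/H1[ek _] k2].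
have X0 : 0 <= it_chi P f phi I k by exact: enorm_ge0.
rewrite /second_order.
have eta_le : it_eta P f phi I k <= (C + 1)^-1.
  rewrite /it_eta ge_min growthM// H// H2// andbT.
  by rewrite mulr_ge0// mulr_ge0// sqr_ge0.
apply: (@le_trans _ _ ((C + 1)^-1 * enorm (it_e P f phi I k))).
  by apply: ler_wpM2r => //; exact: enorm_ge0.
rewrite mulrC ler_pdivrMr; last by rewrite ltr_wpDl.
apply: le_trans ek _; rewrite mulrC; apply: ler_wpM2l; first exact: enorm_ge0.
by rewrite lerDl.
Qed.

Lemma trial_z0 k : second_order P f phi I k ->
  trial_z P f phi I k 0 = z k + newton_step k.
Proof.
by move=> so; rewrite /trial_z /it_step so expr0 mul1r scale1r.
Qed.

(** Differentiability of the gradient at the single point [prx zbar] suffices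
    for a second order expansion along segments from it. *)
Lemma f_second_order e : 0 < e -> exists2 d, 0 < d & forall v, enorm v < d ->
  dotv (grad f (prx zbar)) v + dotv (hess f (prx zbar) *m v) v / 2 - e * enorm v ^+ 2
    <= f (prx zbar + v) - f (prx zbar).
Proof.
move=> e0; set xb := prx zbar; set H := hess f xb.
have gd : differentiable (grad f) xb := (proj1 f_C2) _ (prox_dom zbar).
have [d d0 dP] := differentiable_expansion gd e0.
exists d => // v vd.
pose gg s := f (xb + s *: v) - s ^+ 2 * (dotv (H *m v) v / 2).
have [|c /andP[c0 c1]] := @mean_value_unit _ gg (fun s => dotv (grad f (xb + s *: v)) v
    - s * dotv (H *m v) v) 1 ltr01.
  move=> s _.
  have dq : is_derive s 1 (fun s : R => s ^+ 2 * (dotv (H *m v) v / 2)) (s * dotv (H *m v) v).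
    apply: is_derive_eq; rewrite /GRing.scale /=.
    by move: (dotv _ v) => a; field.
  exact: (is_deriveB (is_derive_line (proj1 f_C1 _)) dq).
rewrite /gg scale0r scale1r addr0 expr1n expr0n mul0r subr0 mul1r mulr1 => E1.
have cv : enorm (c *: v) <= enorm v.
  by rewrite enormZ gtr0_norm// ler_piMl ?enorm_ge0// ltW.
have b1 := le_trans (dP _ (le_lt_trans cv vd)) (ler_wpM2l (ltW e0) cv).
have := le_trans (cauchy_schwarzN _ _) (ler_wpM2r (enorm_ge0 v) b1).
rewrite -/H -scalemxAr dotvDl dotvDl !dotvNl dotvZl expr2 mulrA.
by move: E1; apply: taylor_scalar.
Qed.

(** The curvatures of the smooth part and of the proximal part add up to
    [<h, D M h> / 2] up to [o(|h|^2)], and [D M] is positive semidefinite. *)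
Lemma psi_second_order e : 0 < e -> exists N, forall k, (N <= k)%N ->
  psiv zbar - psiv (z k) <= e * enorm (z k - zbar) ^+ 2.
Proof.
move=> e_gt0.
have li : 0 < lam^-1 by rewrite invr_gt0.
pose c := (3 * kappaB + 4 * lam^-1) / 2 + 2 + lam^-1.
have c0 : 0 < c.
  by rewrite ltr_pwDl ?(ltW li)// ltr_wpDl// divr_ge0// addr_ge0 ?mulr_ge0// ltW.
pose e1 := Num.min 1 (e / c).
have e10 : 0 < e1 by rewrite lt_min ltr01 divr_gt0.
have e11 : 0 <= e1 <= 1 by rewrite (ltW e10) /e1 ge_min lexx.
have e1c : e1 <= e / c by rewrite ge_min lexx orbT.
have [_ Pdir _] := prox_semismooth.
have [d1 d10 H1] := prox_val_second_order phi_proper phi_lsc phi_convex lam_gt0 Pdir e10.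
have [d2 d20 H2] := f_second_order e10.
have [d3 d30 [N3 H3]] := secant_defect e10.
have gd : differentiable (grad f) (prx zbar) := (proj1 f_C2) _ (prox_dom zbar).
have [d4 d40 H4] := differentiable_expansion gd e10.
have [d5 d50 H5] := semismooth_near e10.
have d0 : 0 < Num.min d1 (Num.min d2 (Num.min d3 (Num.min d4 d5))).
  by rewrite !lt_min d10 d20 d30 d40.
have [N NP] := residual_tail d0.
exists (maxn N N3) => k; rewrite geq_max => /andP[/NP[Kk kd] k3].
move: kd; rewrite !lt_min => /and5P[k1 k2 k3' k4 k5].
set h := z k - zbar in k1 k2 k3' k4 k5 *.
set v := prx (z k) - prx zbar.
have zE : zbar + h = z k by rewrite addrC subrK.
have xE : prx zbar + v = prx (z k) by rewrite addrC subrK.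
have vh : enorm v <= enorm h by exact: prox_zbar_lip.
have b1 := H1 h v k1 (congr1 (fun y => prx y - prx zbar) (esym zE)).
have b2 := H2 v (le_lt_trans vh k2).
have b3 := H3 k k3 k3'.
have b4 := H4 v (le_lt_trans vh k4).
have b5 := H5 k k5.
rewrite zE in b1; rewrite xE in b2 b4.
have [Mpsd _ _] := M_regular Kk.
have b6 := psd_curvature lam_gt0 kappaB_ge0 e11 (it_D_sym k) erefl (Mpsd h)
  (fun u => enorm_mulmx_le u (B_bounded k)) vh b5.
have b4' := le_trans b4 (ler_wpM2l (ltW e10) vh).
have b7 := curvature_replace (ltW e10) b3 b4' vh.
have F0 : dotv (grad f (prx zbar)) v + lam^-1 * dotv (zbar - prx zbar) v = 0.
  by rewrite -dotvZl -dotvDl -[_ + _]/(F zbar) Fzbar0 dotv0l.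
have h2 : 0 <= enorm h ^+ 2 by rewrite sqr_ge0.
have b1' : lam^-1 * dotv (zbar - prx zbar) v + lam^-1 * (dotv (h - v) v / 2)
    - lam^-1 * (e1 * enorm h ^+ 2) <= prox_val phi lam (z k) - prox_val phi lam zbar.
  by rewrite -mulrDr -mulrBr mulrC ler_pdivrMr// [leRHS]mulrC.
have b2' : dotv (grad f (prx zbar)) v + dotv (hess f (prx zbar) *m v) v / 2
    - e1 * enorm h ^+ 2 <= f (prx (z k)) - f (prx zbar).
  apply: le_trans b2; rewrite lerD2l lerN2; apply: ler_wpM2l; first exact: ltW.
  by apply: lerXn2r; rewrite ?nnegrE ?enorm_ge0.
have := second_order_scalar lam_gt0 (ltW e10) h2 b1' b2' F0 b7 b6.
rewrite /psi_val => /le_trans; apply; rewrite -/c mulrA; apply: ler_wpM2r => //.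
by rewrite mulrC -ler_pdivlMr.
Qed.

(** The available decrease is [(1 - sigma) tau lam chi^2 / 2], and all error
    terms are small multiples of [|h|^2], hence of [chi^2] by the error bound.
    The constant [b] is a quarter of this decrease per unit of [|h|^2]. *)
Lemma unit_step_eventually : exists N, forall k, (N <= k)%N ->
  second_order P f phi I k /\ accept P f phi I k 0.
Proof.
have p0 : 0 < par_p P by case: P_valid => _ _ _ [].
have tau00 : 0 < par_tau0 P by case: P_valid => _ [].
have sig01 : 0 < par_sigma P < 1 by case: P_valid => _ _ [].
have tm0 := tau_min_gt0 L P_valid.
have [C1 C10 [N1 H1]] := error_bound_eventually.
have [N2 H2] := second_order_eventually.
pose b := (1 - par_sigma P) * tau_min P L * lam / 2 / (4 * C1 ^+ 2).
have s1 : 0 < 1 - par_sigma P by rewrite subr_gt0; case/andP: sig01.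
have C12 : 0 < 4 * C1 ^+ 2 by rewrite mulr_gt0// exprn_gt0.
have b0 : 0 < b by rewrite !divr_gt0// !mulr_gt0.
have [N3 H3] := psi_second_order b0.
pose m1 := CF + L; pose m2 := par_tau0 P * lam / 2 * CF ^+ 2.
have m10 : 0 < m1 by rewrite ltr_wpDr.
have m20 : 0 < m2 by rewrite mulr_gt0 ?exprn_gt0// divr_gt0// mulr_gt0.
pose eps := Num.min 1 (Num.min (b / m1) (b / m2)).
have eps0 : 0 < eps by rewrite !lt_min ltr01 (divr_gt0 b0 m10) (divr_gt0 b0 m20).
have eps1 : 0 <= eps <= 1 by rewrite (ltW eps0) /eps ge_min lexx.
have K1 : m1 * eps <= b.
  by rewrite mulrC -ler_pdivlMr// /eps !ge_min lexx !orbT.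
have K3 : m2 * eps <= b.
  by rewrite mulrC -ler_pdivlMr// /eps !ge_min lexx !orbT.
have [d4 d40 [N4 H4]] := newton_superlinear eps0.
have [N5 H5] := residual_tail d40.
have nub : 0 < lam * b / 4 by rewrite divr_gt0// mulr_gt0.
have [e6 e60 H6] := powR_small (mulr_gt0 (ltr0Sn R 1) p0) nub.
have e6' : 0 < e6 / (2 * C1) by rewrite divr_gt0// mulr_gt0.
have [N7 H7] := residual_beats_log e6'.
exists (maxn (maxn N1 N2) (maxn (maxn N3 N4) (maxn N5 N7))) => k.
rewrite !geq_max => /andP[/andP[k1 k2] /andP[/andP[k3 k4] /andP[k5 k7]]].
have so := H2 k k2; split => //.
apply/(acceptE f I phi_proper phi_lsc phi_convex P_valid); rewrite /trial_x trial_z0// expr0.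
have [Kk kd] := H5 k k5.
have hp := H4 k k4 kd.
set zp := z k + newton_step k in hp *.
have zt : trial_z P f phi I k 0 = zp by rewrite trial_z0.
have taul := trial_tau_ge f_C1 phi_proper phi_lsc phi_convex P_valid L_ge0 grad_lip 0
  (prev_tau_ge f_C1 phi_proper phi_lsc phi_convex P_valid I_gen L_ge0 grad_lip k).
have tauu := trial_tau_le I_gen k 0.
have up := psi_val_upper f_C1 phi_proper phi_lsc phi_convex lam_gt0 L_ge0 grad_lip zp zbar.
have Fp : enorm (F zp) <= CF * enorm (zp - zbar).
  have := Fnor_lip phi_proper phi_lsc phi_convex lam_gt0 L_ge0 grad_lip zp zbar.
  by rewrite Fzbar0 subr0.
have xzp : enorm (prx zp - prx zbar) <= enorm (zp - zbar) by exact: prox_nonexpansive.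
have up' : psiv zp - psiv zbar <=
    enorm (F zp) * enorm (zp - zbar) + L * enorm (zp - zbar) ^+ 2.
  exact: (le_trans up (lerD (ler_wpM2l (enorm_ge0 _) xzp)
    (ler_wpM2l L_ge0 (lerXn2r 2 (enorm_ge0 _) (enorm_ge0 _) xzp)))).
have dd : enorm (prx zp - prx (z k)) <= enorm (zp - zbar) + enorm (z k - zbar).
  apply: le_trans (prox_nonexpansive phi_proper phi_lsc phi_convex lam_gt0 zp (z k)) _.
  by rewrite [enorm (z k - zbar)]enormC; exact: enorm_triangle.
have nu_le : trial_nu P f phi I k 0 * 4 <= lam * b.
  rewrite -ler_pdivlMr// /trial_nu ge_min; apply/orP; right.
  rewrite /trial_x zt growth_sqrM ?enorm_ge0//; apply: H6.
  have kl : 0 <= k%:R * ln (k.+1%:R : R) ^+ 2 by rewrite mulr_ge0// sqr_ge0.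
  rewrite mulr_ge0 ?enorm_ge0//=.
  have dC : enorm (prx zp - prx (z k)) <= 2 * C1 * enorm (F (z k)).
    apply: le_trans dd _.
    have h1 := H1 k k1.
    have h3 : enorm (zp - zbar) <= 1 * enorm (z k - zbar).
      apply: (le_trans hp); apply: ler_wpM2r; first exact: enorm_ge0.
      by case/andP: eps1.
    rewrite mul1r in h3; rewrite -mulrA mulr2n mulrDl mul1r.
    exact: (lerD (le_trans h3 h1) h1).
  apply: le_trans (ler_wpM2l kl dC) _.
  have := H7 k k7; rewrite ler_pdivlMr ?mulr_gt0//.
  by apply: le_trans; rewrite -!mulrA (mulrC (enorm _)) -!mulrA.
have tt : tau_min P L <= trial_tau P f phi I k 0 <= par_tau0 P by rewrite taul.
have /andP[nu0 _] := trial_nu_bounds f phi I P_valid k 0.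
have K5 : 4 * b * C1 ^+ 2 <= (1 - par_sigma P) * tau_min P L * lam / 2.
  by rewrite mulrAC /b mulrC divfK// gt_eqF.
exact: (unit_step_scalar lam_gt0 tt sig01 L_ge0 CF_gt0 C10 (enorm_ge0 _) (enorm_ge0 _)
  (enorm_ge0 _) (enorm_ge0 _) (enorm_ge0 _) nu0 tm0 eps1 b0 up' (H3 k k3) Fp hp (H1 k k1)
  dd K1 (lexx _) K3 nu_le K5).
Qed.

Lemma newton_eventually : exists N, forall k, (N <= k)%N ->
  [/\ second_order P f phi I k, it_alpha P I k = 1 & z k.+1 = z k + newton_step k].
Proof.
have [N NP] := unit_step_eventually; exists N => k /NP[so acc].
have t0 : it_t I k = 0%N.
  apply/eqP; rewrite -leqn0 leqNgt; apply/negP => /(gen_first I_gen).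
  exact.
have a1 : it_alpha P I k = 1 by rewrite /it_alpha t0 expr0.
by split => //; rewrite (gen_next I_gen) a1 /it_step so mul1r scale1r.
Qed.

(** * Convergence of higher order *)

(** The mean value theorem is applied to the component of [grad f] along the
    defect [u] itself, which turns a scalar identity into a bound on [|u|]. *)
Lemma hess_secant_quadratic : hess_lipschitz_near (edom phi) f (prx zbar) ->
  exists2 l, 0 <= l & exists2 d, 0 < d & forall x, edom phi x -> enorm (x - prx zbar) < d ->
  enorm (hess f x *m (x - prx zbar) - (grad f x - grad f (prx zbar)))
    <= l * enorm (x - prx zbar) ^+ 2.
Proof.
set xb := prx zbar; move=> [l0 [U /nbhs_enormP[d d0 dU] UP]].
pose l := Num.max l0 0; have l_ge0 : 0 <= l by rewrite le_max lexx orbT.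
exists l => //; exists d => // x xd xl.
set v := x - xb in xl *; set g := grad f x - grad f xb; set u := hess f x *m v - g.
have xdom t : 0 <= t <= 1 -> edom phi (xb + t *: v).
  by move=> t01; apply: (edom_segment phi_proper phi_convex) => //; exact: prox_dom.
have [|c /andP[c0 c1] E1] := @mean_value_unit _ (fun t => dotv u (grad f (xb + t *: v)))
    (fun t => dotv u (hess f (xb + t *: v) *m v)) 1 ltr01.
  by move=> s s01; apply: is_derive_line_dotv; apply: (proj1 f_C2); exact: xdom.
have xE : xb + v = x by rewrite /v addrC subrK.
move: E1; rewrite scale0r addr0 scale1r xE mulr1 => E1.
have c01 : 0 <= c <= 1 by rewrite !ltW.
have cv : enorm (xb + c *: v - xb) < d.
  rewrite addrAC subrr add0r enormZ gtr0_norm//; apply: le_lt_trans xl.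
  by rewrite ler_piMl ?enorm_ge0// ltW.
have xc : enorm (x - (xb + c *: v)) <= enorm v.
  have -> : x - (xb + c *: v) = (1 - c) *: v.
    by rewrite -xE opprD addrACA subrr add0r scalerBl scale1r.
  have c1' : 0 <= 1 - c by rewrite subr_ge0 ltW.
  rewrite enormZ ger0_norm// ler_piMl ?enorm_ge0//.
  by rewrite gerBl ltW.
have hl : enorm ((hess f x - hess f (xb + c *: v)) *m v) <= l * enorm v ^+ 2.
  apply: le_trans (enorm_mulmx _ _) _; rewrite expr2 mulrA.
  apply: ler_wpM2r; first exact: enorm_ge0.
  apply: le_trans (UP _ _ (dU _ xl) xd (dU _ cv) (xdom _ c01)) _.
  apply: le_trans (_ : l * enorm (x - (xb + c *: v)) <= _); last exact: ler_wpM2l.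
  by apply: ler_wpM2r; [exact: enorm_ge0|rewrite le_max lexx].
have uu : dotv u u = dotv u ((hess f x - hess f (xb + c *: v)) *m v).
  by rewrite mulmxBl; exact: (residual_inner (erefl u) E1).
have [->|un] := eqVneq (enorm u) 0; first by rewrite mulr_ge0// sqr_ge0.
have u0 : 0 < enorm u by rewrite lt_neqAle eq_sym un enorm_ge0.
have uE : enorm u * enorm u = dotv u u by rewrite -expr2 enorm_sqr.
rewrite -(ler_pM2l u0) -/v -/g -/u uE uu.
apply: le_trans (cauchy_schwarz _ _) _.
by apply: ler_wpM2l hl; exact: enorm_ge0.
Qed.

Lemma newton_order (beta : R) : 0 < beta <= 1 ->
  semismooth_order beta prx zbar ->
  E =O_ (0 : 'cV[R]_n) (fun h => enorm h `^ (1 + beta)) ->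
  (forall k, it_B I k = hess f (it_x P phi I k)) ->
  hess_lipschitz_near (edom phi) f (prx zbar) ->
  exists2 C, 0 < C & exists N, forall k, (N <= k)%N ->
    enorm (z k + newton_step k - zbar) <= C * enorm (z k - zbar) `^ (1 + beta).
Proof.
move=> /andP[b0 b1] [_ _ [c0 /nbhs_enormP[d1 d10 H1]]] /eqO_exP[cE [cE0 /nbhs_enormP[d2 d20 H2]]]
  BH /hess_secant_quadratic[l l0 [d3 d30 H3]].
have H2' y : enorm y < d2 -> E y <= cE * enorm y `^ (1 + beta).
  move=> yd; have := H2 y; rewrite subr0 => /(_ yd).
  by rewrite (ger0_norm (powR_ge0 _ _)); apply: le_trans; exact: ler_norm.
have B1 : 0 <= 1 + beta by rewrite addr_ge0// ltW.
pose c := Num.max c0 0.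
have lB : 0 <= 1 + lam * kappaB by rewrite addr_ge0// mulr_ge0// ltW.
have kl : 0 <= kappaB + lam^-1 by rewrite addr_ge0// invr_ge0 ltW.
pose C := kappaM * ((kappaB + lam^-1) * c + l + (1 + lam * kappaB) *
  (cE * CF `^ (1 + beta))).
have C_ge0 : 0 <= C.
  rewrite mulr_ge0 ?(ltW kappaM_gt0)// !addr_ge0// mulr_ge0// ?le_max ?lexx ?orbT//.
  by rewrite mulr_ge0 ?powR_ge0// ltW.
exists (C + 1); first by rewrite ltr_wpDl.
have r0 : 0 < Num.min 1 (Num.min d1 (Num.min (d2 / CF) d3)).
  by rewrite !lt_min ltr01 d10 d30 divr_gt0.
have [N NP] := residual_tail r0.
exists N => k /NP[Kk]; rewrite !lt_min => /and4P[k0 k1 k2 k3].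
have h0 := enorm_ge0 (z k - zbar).
have p0 : 0 <= enorm (z k - zbar) `^ (1 + beta) by exact: powR_ge0.
apply: le_trans (_ : C * enorm (z k - zbar) `^ (1 + beta) <= _); last first.
  by apply: ler_wpM2r => //; rewrite lerDl.
apply: le_trans (newton_bound Kk) _.
have a1 : enorm (prx (z k) - prx zbar - it_D I k *m (z k - zbar)) <=
    c * enorm (z k - zbar) `^ (1 + beta).
  have zE : zbar + (z k - zbar) = z k by rewrite addrC subrK.
  apply: le_trans (_ : c0 * enorm (z k - zbar) `^ (1 + beta) <= _); last first.
    by apply: ler_wpM2r => //; rewrite le_max lexx.
  have := H1 (z k - zbar); rewrite subr0 => /(_ k1).
  rewrite -lee_fin; apply: le_trans; apply: ereal_sup_ubound.
  exists (it_D I k); first by rewrite zE; exact: (gen_D I_gen).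
  by rewrite zE.
have a2 : enorm (it_B I k *m (prx (z k) - prx zbar)
    - (grad f (prx (z k)) - grad f (prx zbar))) <= l * enorm (z k - zbar) `^ (1 + beta).
  have xl := prox_zbar_lip k.
  rewrite BH; apply: le_trans (H3 _ (prox_dom (z k)) (le_lt_trans xl k3)) _.
  apply: ler_wpM2l => //.
  apply: le_trans (_ : enorm (z k - zbar) ^+ 2 <= _).
    exact: (lerXn2r 2 (enorm_ge0 _) (enorm_ge0 _) xl).
  have [->|hn] := eqVneq (enorm (z k - zbar)) 0; first by rewrite expr0n powR_ge0.
  rewrite -powR_mulrn//; apply: ger_powR.
    by rewrite lt_neqAle eq_sym hn h0 ltW.
  by rewrite mulr2n lerD2l.
have a3 : par_eps P k <= cE * enorm (F (z k)) `^ (1 + beta).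
  have Fd : enorm (F (z k)) < d2.
    by apply: le_lt_trans (residual_le k) _; rewrite mulrC -ltr_pdivlMr.
  exact: le_trans (eps_le k) (H2' _ Fd).
have a4 : enorm (F (z k)) `^ (1 + beta) <= CF `^ (1 + beta) * enorm (z k - zbar) `^ (1 + beta).
  rewrite -powRM ?(ltW CF_gt0)//; apply: ge0_ler_powR => //; rewrite ?nnegrE ?enorm_ge0//.
    by rewrite mulr_ge0// ltW.
  exact: residual_le.
exact: (order_scalar kappaM_gt0 kl lB (ltW cE0) a1 a2 a3 a4).
Qed.

End Local.

Theorem theorem3p14 (R : realType) (n : nat)
    (f : 'cV[R]_n -> R) (phi : 'cV[R]_n -> \bar R)
    (P : params R n) (I : iterates R n) (zbar : 'cV[R]_n)
    (L kappaM kappaB : R) (K : nat) (E : 'cV[R]_n -> R)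
    (hf : C1 f)
    (hphi_proper : eproper phi) (hphi_lsc : lower_semicontinuous phi)
    (hphi_conv : econvex phi)
    (hP : valid_params P)
    (hI : generated P f phi I)
    (hnonterm : forall k, it_F P f phi I k <> 0)
    (hacc : cluster (it_z I @ \oo) zbar)
    (hLip : elipschitz_on L (edom phi) (grad f))
    (hbelow : exists m : R, forall x, dom_subdiff phi x -> (m%:E <= psi f phi x)%E)
    (hC2 : C2_on (edom phi) f)
    (hsemi : semismooth (prox (par_lam P) phi) zbar)
    (hkappaM : 0 < kappaM)
    (hM : forall k, (K <= k)%N ->
       [/\ psd (it_D I k *m it_M P I k), it_M P I k \in unitmx &
           specnorm (invmx (it_M P I k)) <= kappaM])
    (hDM : (fun k => enorm ((it_B I k - hess f (it_x P phi I k))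
                            *m (it_x P phi I k - prox (par_lam P) phi zbar))
                     / enorm (it_z I k - zbar)) @ \oo --> (0 : R))
    (heps : forall k, par_eps P k <= E (it_F P f phi I k))
    (hE_ge0 : forall h, 0 <= E h) (hE_cont : continuous E) (hE0 : E 0 = 0)
    (hE_o : E =o_ (0 : 'cV[R]_n) (fun h => enorm h))
    (hB : forall k, specnorm (it_B I k) <= kappaB) :
  [/\ exists kbar : nat, forall k, (kbar <= k)%N ->
        [/\ second_order P f phi I k, it_alpha P I k = 1 &
            it_z I k.+1 = it_z I k
              + par_lam P *: (it_d P f phi I k + it_e P f phi I k)],
      it_z I @ \oo --> zbar,
      (fun k => enorm (it_z I k.+1 - zbar))
        =o_\oo (fun k => enorm (it_z I k - zbar)) &
      forall beta : R, 0 < beta <= 1 ->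
        semismooth_order beta (prox (par_lam P) phi) zbar ->
        E =O_ (0 : 'cV[R]_n) (fun h => enorm h `^ (1 + beta)) ->
        (forall k, it_B I k = hess f (it_x P phi I k)) ->
        hess_lipschitz_near (edom phi) f (prox (par_lam P) phi zbar) ->
        (fun k => enorm (it_z I k.+1 - zbar))
          =O_\oo (fun k => enorm (it_z I k - zbar) `^ (1 + beta))].
Proof.
pose L' := Num.max L 0; pose kB := Num.max kappaB 0.
have L'_ge0 : 0 <= L' by rewrite le_max lexx orbT.
have kB_ge0 : 0 <= kB by rewrite le_max lexx orbT.
have hLip' : elipschitz_on L' (edom phi) (grad f).
  move=> x y xd yd; apply: le_trans (hLip x y xd yd) _.
  by apply: ler_wpM2r; [exact: enorm_ge0|rewrite le_max lexx].
have hB' k : specnorm (it_B I k) <= kB by rewrite le_max hB.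
have [N NP] := newton_eventually hf hphi_proper hphi_lsc hphi_conv hP hI L'_ge0 hLip'
  hacc hbelow hC2 hsemi hkappaM kB_ge0 hM hDM heps hE_cont hE_o hB'.
split.
- by exists N => k /NP[so a1 zE]; split.
- apply/cvg_enormP => e e0.
  have [M MP] := z_converges hf hphi_proper hphi_lsc hphi_conv hP hI L'_ge0 hLip'
    hacc hbelow hC2 hsemi hkappaM kB_ge0 hM hDM heps hE_cont hE_o hB' e0.
  by exists M.
- apply/eqoP => e e0.
  have [d d0 [M MP]] := newton_superlinear hf hphi_proper hphi_lsc hphi_conv hP hI
    L'_ge0 hLip' hacc hbelow hC2 hsemi hkappaM kB_ge0 hM hDM heps hE_cont hE_o hB' e0.
  have [M' MP'] := z_converges hf hphi_proper hphi_lsc hphi_conv hP hI L'_ge0 hLip'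
    hacc hbelow hC2 hsemi hkappaM kB_ge0 hM hDM heps hE_cont hE_o hB' d0.
  exists (maxn N (maxn M M')) => // k; rewrite /= !geq_max => /and3P[k1 k2 k3].
  have [_ _ zE] := NP k k1.
  rewrite !ger0_norm ?enorm_ge0// zE.
  exact: (MP k k2 (MP' k k3)).
- move=> beta b01 hso hEO hBH hHL.
  have [C C0 [M MP]] := newton_order hf hphi_proper hphi_lsc hphi_conv hP hI
    L'_ge0 hLip' hacc hbelow hC2 hsemi hkappaM kB_ge0 hM hDM heps hE_cont hE_o hB'
    b01 hso hEO hBH hHL.
  apply/eqO_exP; exists C => //.
  exists (maxn N M) => // k; rewrite /= !geq_max => /andP[k1 k2].
  have [_ _ zE] := NP k k1.
  rewrite !ger0_norm ?enorm_ge0 ?powR_ge0// zE.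
  exact: MP.
Qed.
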